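(* Let $\{U_j\}_{j=1}^J$ and $\{V_i\}_{i=1}^I$ be two finite collections of simple adapted biprocesses in $\mathcal{B}$. Let $N=\sum_{i=1}^IN_i$ and $M=\sum_{j=1}^JM_j$, where $$N_i=\int V_i(t)\,\sharp\, d\Delta_i(t),\qquad M_j=\int U_j(t)\,\sharp\, d\Delta_j(t),$$ and let $N(t)=\sum_{i=1}^I\int_0^tV_i\,\sharp\, d\Delta_i$, $M(t)=\sum_{j=1}^J\int_0^tU_j\,\sharp\, d\Delta_j$. Then $$NM=\sum_{j=1}^J\int (N(t)\otimes1)\,\sharp\, U_j(t)\,\sharp\, d\Delta_j(t)+\sum_{i=1}^I\int(1\otimes M(t))\,\sharp\, V_i(t)\,\sharp\, d\Delta_i(t)+\sum_{m=2}^{I+J}\ \sum_{\substack{1\le i\le I,\ 1\le j\le J\\ i+j=m}}\int (V_i(t)\otimes_2U_j(t))\,\sharp\, d\Delta_m(t).$$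
   Context: Setting. $\mathcal{A}$ is a finite von Neumann algebra with a faithful normal trace state $\phi$; $\|S\|_p=\phi[|S|^p]^{1/p}$, $\|S\|_\infty=\|S\|$ is the operator norm, $L^p(\mathcal{A},\phi)$ are the completions of $\mathcal{A}$. $(\mathcal{A}_t)_{t\ge0}$ is an increasing family of von Neumann subalgebras of $\mathcal{A}$. $\mu$ is a compactly supported freely infinitely divisible probability measure on $\mathbb{R}$ of variance $1$; $r_k$ are its free cumulants, and $(\mu_t)_{t\ge0}$ is the free convolution semigroup whose free cumulants are $t r_k$. $X$ is a fixed adapted free stochastic measure with distribution $\mu$: a map $I\mapsto X(I)$ from finite half-open intervals $I=[a,b)\subset[0,\infty)$ to self-adjoint elements of $\mathcal{A}$ such that $X(I_1)+X(I_2)=X(I_1\cup I_2)$ when $I_1\cap I_2=\emptyset$ and $I_1\cup I_2$ is an interval; $X(I)$ has distribution $\mu_{|I|}$; $X(I_1),\dots,X(I_n)$ are freely independent for disjoint $I_1,\dots,I_n$; $X(I)\in\mathcal{A}_t$ if $I\subset[0,t)$; and $X(I)$ is freely independent from $\mathcal{A}_t$ if $I\cap[0,t)=\emptyset$. Put $X(t)=X([0,t))$. Diagonal measures. For $I=[a,b)$, $\Delta_k(I)=\lim_{N\to\infty}\sum_{i=1}^N X\bigl([a+\tfrac{i-1}{N}(b-a),a+\tfrac{i}{N}(b-a))\bigr)^k$, the limit being in operator norm (it is known to exist); $\Delta_k(t)=\Delta_k([0,t))$, $\Delta_1=X$. Each $\Delta_k$ is known to be an adapted process with freely independent stationary increments,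 and the free cumulants of $\Delta_k(t)$ are $r_n(\Delta_k(t))=t\,r_{nk}$. Biprocesses and integrals. A biprocess is a map $[0,\infty)\to\mathcal{A}\otimes\mathcal{A}^{op}$. $\mathcal{B}$ is the space of simple adapted biprocesses, spanned by $S\otimes T\,\mathbf{1}_{[a,b)}$ with $S,T\in\mathcal{A}_a$. For such a biprocess $\int (S\otimes T\mathbf{1}_{[a,b)})\,\sharp\, d\Delta_k=S(\Delta_k(b)-\Delta_k(a))T$, extended linearly; $\int_{t_1}^{t_2}U\,\sharp\, d\Delta_k=\int U\mathbf{1}_{[t_1,t_2)}\,\sharp\, d\Delta_k$. For non-simple adapted $W$ the integral is defined by continuous extension: if $W_n\in\mathcal{B}$ with $\int\|W_n-W\|_2^2ds\to0$ and $\|\int m(W_n-W)ds\|_2\to0$, then $\int W\,\sharp\, d\Delta_k$ is the limit of $\int W_n\,\sharp\, d\Delta_k$ in $L^2(\mathcal{A},\phi)$; here $m(S\otimes T)=ST$, and $\|\cdot\|_2$ on $\mathcal{A}\otimes\mathcal{A}^{op}$ comes from $\langle A\otimes B,C\otimes D\rangle=\phi[C^*A]\phi[BD^*]$. Notation. Products $\sharp$ of elements of $\mathcal{A}\otimes\mathcal{A}^{op}$ are taken in that algebra, so $(N\otimes1)\,\sharp\,(A\otimes B)=NA\otimes B$ and $(1\otimes M)\,\sharp\,(A\otimes B)=A\otimes BM$ (products on the right-hand sides taken in $\mathcal{A}$). The operation $\otimes_2$ is the bilinear extension of $(A\otimes B)\otimes_2(C\otimes D)=\phi[BC]\,A\otimes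 D$. *)

(* Defs.v *)
From HB Require Import structures.
From mathcomp Require Import all_boot all_order all_algebra generic_quotient.
From mathcomp Require Import complex.
From mathcomp Require Import all_classical all_reals all_analysis.

Set Implicit Arguments.
Unset Strict Implicit.
Unset Printing Implicit Defensive.

Import Order.TTheory GRing.Theory Num.Theory.
Import numFieldNormedType.Exports.

Local Open Scope classical_set_scope.
Local Open Scope ring_scope.
Local Open Scope complex_scope.

(** * Algebraic tensor products

    [tensor U V] is the quotient of finite formal sums of pairs by the relation
    "every bilinear map takes the same value on both sums". *)

Definition formal_eval (K : comNzRingType) (U V W : lmodType K)
    (f : U -> V -> W) (s : seq (U * V)) : W :=
  \sum_(p <- s) f p.1 p.2.

Definition tensor_rel (K : comNzRingType) (U V : lmodType K) :
    rel (seq (U * V)) :=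
  fun s t => `[< forall (W : lmodType K) (f : U -> V -> W),
    bilinear_for *:%R *:%R f -> formal_eval f s = formal_eval f t >].

Lemma tensor_rel_refl (K : comNzRingType) (U V : lmodType K) :
  reflexive (@tensor_rel K U V).
Proof. by move=> s; apply/asboolP. Qed.

Lemma tensor_rel_sym (K : comNzRingType) (U V : lmodType K) :
  symmetric (@tensor_rel K U V).
Proof.
by move=> s t; apply/asboolP/asboolP => st W f bf; rewrite (st W f bf).
Qed.

Lemma tensor_rel_trans (K : comNzRingType) (U V : lmodType K) :
  transitive (@tensor_rel K U V).
Proof.
move=> t s u /asboolP st /asboolP tu; apply/asboolP => W f bf.
by rewrite (st W f bf) (tu W f bf).
Qed.

Canonical tensor_equiv (K : comNzRingType) (U V : lmodType K) :=
  EquivRel (@tensor_rel K U V) (@tensor_rel_refl K U V)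
    (@tensor_rel_sym K U V) (@tensor_rel_trans K U V).

Definition tensor (K : comNzRingType) (U V : lmodType K) :=
  {eq_quot (tensor_equiv U V)}%qT.

HB.instance Definition _ (K : comNzRingType) (U V : lmodType K) :=
  Choice.on (tensor U V).

Definition tclass (K : comNzRingType) (U V : lmodType K) (s : seq (U * V)) :
  tensor U V := (\pi_(tensor U V) s)%qT.

Definition tsum (K : comNzRingType) (U V : lmodType K) (x : tensor U V) :
  seq (U * V) := repr (x : {eq_quot (tensor_equiv U V)}%qT).

Definition tens (K : comNzRingType) (U V : lmodType K) (u : U) (v : V) :
  tensor U V := tclass [:: (u, v)].

(* The map induced by [f]; meaningful when [f] is bilinear (see [tlift_tens],
   [tlift_linear]). *)
Definition tlift (K : comNzRingType) (U V W : lmodType K) (f : U -> V -> W)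
  (x : tensor U V) : W := formal_eval f (tsum x).

Definition formal_scale (K : comNzRingType) (U V : lmodType K) (c : K)
  (s : seq (U * V)) : seq (U * V) := [seq (c *: p.1, p.2) | p <- s].

Definition tadd (K : comNzRingType) (U V : lmodType K) (x y : tensor U V) :=
  tclass (tsum x ++ tsum y).
Definition tzero (K : comNzRingType) (U V : lmodType K) : tensor U V :=
  tclass [::].
Definition tscale (K : comNzRingType) (U V : lmodType K) (c : K)
  (x : tensor U V) := tclass (formal_scale c (tsum x)).

Lemma tclassP (K : comNzRingType) (U V : lmodType K) (s t : seq (U * V)) :
  (forall (W : lmodType K) (f : U -> V -> W),
    bilinear_for *:%R *:%R f -> formal_eval f s = formal_eval f t) <->
  tclass s = tclass t.
Proof.
split=> [st|]; first by apply/eqmodP/asboolP.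
by move=> /eqmodP /asboolP.
Qed.

Lemma tsumK (K : comNzRingType) (U V : lmodType K) (x : tensor U V) :
  tclass (tsum x) = x.
Proof. exact: reprK. Qed.

Lemma eval_tsum (K : comNzRingType) (U V W : lmodType K) (f : U -> V -> W) s :
  bilinear_for *:%R *:%R f -> formal_eval f (tsum (tclass s)) = formal_eval f s.
Proof. by move=> bf; apply: (tclassP _ _).2 bf; rewrite tsumK. Qed.

Lemma formal_eval_cat (K : comNzRingType) (U V W : lmodType K)
  (f : U -> V -> W) s t :
  formal_eval f (s ++ t) = formal_eval f s + formal_eval f t.
Proof. exact: big_cat. Qed.

Lemma formal_eval_scale (K : comNzRingType) (U V W : lmodType K)
  (f : U -> V -> W) c s : bilinear_for *:%R *:%R f ->
  formal_eval f (formal_scale c s) = c *: formal_eval f s.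
Proof.
move=> bf; rewrite /formal_eval big_map scaler_sumr; apply: eq_bigr => p _ /=.
have := scalable_linear (bf.1 p.2); exact.
Qed.

Lemma taddA (K : comNzRingType) (U V : lmodType K) :
  associative (@tadd K U V).
Proof.
move=> x y z; apply/tclassP => W f bf.
by rewrite !formal_eval_cat !eval_tsum// !formal_eval_cat addrA.
Qed.

Lemma taddC (K : comNzRingType) (U V : lmodType K) :
  commutative (@tadd K U V).
Proof. by move=> x y; apply/tclassP => W f bf; rewrite !formal_eval_cat addrC. Qed.

Lemma tadd0 (K : comNzRingType) (U V : lmodType K) :
  left_id (@tzero K U V) (@tadd K U V).
Proof.
move=> x; rewrite -[RHS]tsumK; apply/tclassP => W f bf.
by rewrite formal_eval_cat eval_tsum// [formal_eval f [::]]big_nil add0r.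
Qed.

Lemma taddN (K : comNzRingType) (U V : lmodType K) :
  left_inverse (@tzero K U V) (@tscale K U V (-1)) (@tadd K U V).
Proof.
move=> x; apply/tclassP => W f bf.
rewrite formal_eval_cat eval_tsum// formal_eval_scale// scaleN1r addNr.
by rewrite [RHS]big_nil.
Qed.

HB.instance Definition _ (K : comNzRingType) (U V : lmodType K) :=
  GRing.isZmodule.Build (tensor U V)
    (@taddA K U V) (@taddC K U V) (@tadd0 K U V) (@taddN K U V).

Lemma tscaleA (K : comNzRingType) (U V : lmodType K) a b (x : tensor U V) :
  tscale a (tscale b x) = tscale (a * b) x.
Proof.
apply/tclassP => W f bf.
by rewrite !formal_eval_scale// eval_tsum// formal_eval_scale// scalerA.
Qed.

Lemma tscale1 (K : comNzRingType) (U V : lmodType K) :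
  left_id 1 (@tscale K U V).
Proof.
move=> x; rewrite -[RHS]tsumK; apply/tclassP => W f bf.
by rewrite formal_eval_scale// scale1r.
Qed.

Lemma tscaleDr (K : comNzRingType) (U V : lmodType K) :
  right_distributive (@tscale K U V) +%R.
Proof.
move=> c x y; apply/tclassP => W f bf.
rewrite formal_eval_scale// !formal_eval_cat !eval_tsum// formal_eval_cat.
by rewrite !formal_eval_scale// scalerDr.
Qed.

Lemma tscaleDl (K : comNzRingType) (U V : lmodType K) (x : tensor U V) :
  {morph (@tscale K U V)^~ x : a b / a + b}.
Proof.
move=> a b; apply/tclassP => W f bf.
by rewrite formal_eval_cat !eval_tsum// !formal_eval_scale// scalerDl.
Qed.

HB.instance Definition _ (K : comNzRingType) (U V : lmodType K) :=
  GRing.Zmodule_isLmodule.Build K (tensor U V)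
    (@tscaleA K U V) (@tscale1 K U V) (@tscaleDr K U V) (@tscaleDl K U V).

Lemma tlift_tens (K : comNzRingType) (U V W : lmodType K) (f : U -> V -> W)
  u v : bilinear_for *:%R *:%R f -> tlift f (tens u v) = f u v.
Proof. by move=> bf; rewrite /tlift eval_tsum// [LHS]big_seq1. Qed.

Lemma tlift_linear (K : comNzRingType) (U V W : lmodType K) (f : U -> V -> W) :
  bilinear_for *:%R *:%R f -> linear (tlift f).
Proof.
move=> bf c x y; rewrite /tlift [LHS]eval_tsum// formal_eval_cat.
by rewrite [in LHS]eval_tsum// formal_eval_scale.
Qed.

Lemma tens_bilinear (K : comNzRingType) (U V : lmodType K) :
  bilinear_for *:%R *:%R (@tens K U V).
Proof.
split=> [v c x y|u c x y]; apply/tclassP => W f bf;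
  rewrite formal_eval_cat !eval_tsum// formal_eval_scale// ?eval_tsum//;
  rewrite /formal_eval !big_seq1 /=.
- by have := bf.1 v; apply.
- by have := bf.2 u; apply.
Qed.

(** * Hilbert spaces and von Neumann algebras *)

Record preHilbert (R : realType) := PreHilbert {
  ph_sort :> lmodType R[i];
  hdot : {dot ph_sort for (@Num.conj R[i])} }.

Arguments hdot {R p}.

Definition hnorm (R : realType) (H : preHilbert R) (x : H) : R :=
  Num.sqrt (complex.Re (hdot x x)).

Record hilbert (R : realType) := Hilbert {
  hil_sort :> preHilbert R;
  hil_complete : forall u : nat -> hil_sort,
    (forall e : R, 0 < e -> exists n0, forall m n,
       (n0 <= m)%N -> (n0 <= n)%N -> hnorm (u m - u n) < e) ->
    exists l, hnorm (u n - l) @[n --> \oo] --> (0 : R) }.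

Definition bounded_op (R : realType) (H : hilbert R) : set (H -> H) :=
  [set T | linear T /\ exists M : R, forall x, hnorm (T x) <= M * hnorm x].

Definition commutant (R : realType) (H : hilbert R) (S : set (H -> H)) :
    set (H -> H) :=
  [set T | bounded_op T /\ forall s, S s -> T \o s = s \o T].

(* A von Neumann algebra, as an abstract unital algebra with an involution and
   a faithful representation identifying it with a self-adjoint unital algebra
   of bounded operators on a Hilbert space that equals its bicommutant. *)
Record vnAlgebra (R : realType) := VnAlgebra {
  vn_alg :> algType R[i];
  star : vn_alg -> vn_alg;
  vn_space : hilbert R;
  vn_rep : vn_alg -> vn_space -> vn_space;
  vn_rep_bounded : forall a, bounded_op (vn_rep a);
  vn_rep_linear : forall c a b x,
    vn_rep (c *: a + b) x = c *: vn_rep a x + vn_rep b x;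
  vn_rep1 : forall x, vn_rep 1 x = x;
  vn_repM : forall a b x, vn_rep (a * b) x = vn_rep a (vn_rep b x);
  vn_rep_star : forall a x y, hdot (vn_rep a x) y = hdot x (vn_rep (star a) y);
  vn_rep_inj : injective vn_rep;
  vn_bicommutant : commutant (commutant (range vn_rep)) = range vn_rep }.

Arguments star {R v}.
Arguments vn_rep {R v}.

Definition opnorm (R : realType) (A : vnAlgebra R) (a : A) : R :=
  sup [set hnorm (vn_rep a x) | x in [set x | hnorm x <= 1]].

Definition selfadjoint (R : realType) (A : vnAlgebra R) : set A :=
  [set a | star a = a].

Definition op_le (R : realType) (A : vnAlgebra R) (a b : A) : Prop :=
  forall x, 0 <= hdot (vn_rep (b - a) x) x.

Definition star_subalg (R : realType) (A : vnAlgebra R) (B : set A) : Prop :=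
  [/\ B 1,
      forall (c : R[i]) a b, B a -> B b -> B (c *: a + b),
      forall a b, B a -> B b -> B (a * b) &
      forall a, B a -> B (star a)].

Definition vn_subalg (R : realType) (A : vnAlgebra R) (B : set A) : Prop :=
  star_subalg B /\ commutant (commutant (vn_rep @` B)) = vn_rep @` B.

Definition op_lub (R : realType) (A : vnAlgebra R) (D : set A) (s : A) : Prop :=
  [/\ selfadjoint s, forall a, D a -> op_le a s &
      forall b, selfadjoint b -> (forall a, D a -> op_le a b) -> op_le s b].

(* Normality is preservation of suprema of bounded increasing nets of
   self-adjoint elements, nets being replaced by directed sets. *)
Definition normal_functional (R : realType) (A : vnAlgebra R)
    (phi : A -> R[i]) : Prop :=
  forall (D : set A) (s : A), D !=set0 -> D `<=` @selfadjoint R A ->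
    (forall a b, D a -> D b -> exists c, [/\ D c, op_le a c & op_le b c]) ->
    op_lub D s -> complex.Re (phi s) = sup [set complex.Re (phi a) | a in D].

(* A finite von Neumann algebra with a faithful normal trace state. *)
Record tracialVN (R : realType) := TracialVN {
  tvn_alg :> vnAlgebra R;
  phi : {scalar tvn_alg};
  phi1 : phi 1 = 1;
  phi_ge0 : forall a, 0 <= phi (star a * a);
  phi_faithful : forall a, phi (star a * a) = 0 -> a = 0;
  phi_trace : forall a b, phi (a * b) = phi (b * a);
  phi_normal : normal_functional phi }.

Arguments phi {R t}.

(* The Hilbert space completion of the algebra for <a, b> = phi (b^* a); it is
   determined up to unique isomorphism. *)
Record L2_space (R : realType) (A : tracialVN R) := L2Space {
  L2_sort :> hilbert R;
  toL2 : {linear A -> L2_sort};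
  toL2_dot : forall a b : A, hdot (toL2 a) (toL2 b) = phi (star b * a);
  toL2_dense : forall (y : L2_sort) (e : R), 0 < e ->
    exists a, hnorm (y - toL2 a) < e }.

Arguments toL2 {R A} l.

(** * The algebra A (x) A^op *)

(* (a (x) b) # (c (x) d) = ac (x) db : the second leg multiplies in A^op. *)
Definition sharp (R : realType) (A : tracialVN R) (x y : tensor A A) :
    tensor A A :=
  tlift (fun a b => tlift (fun c d => tens (a * c) (d * b)) y) x.

(* (a (x) b) (x)_2 (c (x) d) = phi (b c) a (x) d *)
Definition tens2 (R : realType) (A : tracialVN R) (x y : tensor A A) :
    tensor A A :=
  tlift (fun a b => tlift (fun c d => phi (b * c) *: tens a d) y) x.

Definition tmul (R : realType) (A : tracialVN R) (x : tensor A A) : A :=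
  tlift (fun a b => a * b) x.

(* <a (x) b, c (x) d> = phi (c^* a) phi (b d^* ) *)
Definition tdot (R : realType) (A : tracialVN R) (x y : tensor A A) : R[i] :=
  \sum_(p <- tsum x) \sum_(q <- tsum y)
    phi (star q.1 * p.1) * phi (p.2 * star q.2).

Definition tnorm (R : realType) (A : tracialVN R) (x : tensor A A) : R :=
  Num.sqrt (complex.Re (tdot x x)).

Lemma tlift_fun_linear (K : comNzRingType) (U V W : lmodType K)
  (f g h : U -> V -> W) (c : K) (x : tensor U V) :
  (forall u v, f u v = c *: g u v + h u v) ->
  tlift f x = c *: tlift g x + tlift h x.
Proof.
move=> fgh; rewrite /tlift /formal_eval scaler_sumr -big_split /=.
by apply: eq_bigr => p _.
Qed.

Lemma sharp_tens (R : realType) (A : tracialVN R) (a b c d : A) :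
  sharp (tens a b) (tens c d) = tens (a * c) (d * b).
Proof.
have bi a' b' : bilinear_for *:%R *:%R
    (fun c d : A => tens (a' * c) (d * b') : tensor A A).
  split=> [v k x y|u k x y].
    by rewrite mulrDr -scalerAr (tens_bilinear A A).1.
  by rewrite mulrDl -scalerAl (tens_bilinear A A).2.
rewrite /sharp tlift_tens ?tlift_tens//.
split=> [v k x y|u k x y]; apply: tlift_fun_linear => u' v'.
  by rewrite mulrDl -scalerAl (tens_bilinear A A).1.
by rewrite mulrDr -scalerAr (tens_bilinear A A).2.
Qed.

Lemma tens2_tens (R : realType) (A : tracialVN R) (a b c d : A) :
  tens2 (tens a b) (tens c d) = phi (b * c) *: tens a d.
Proof.
have bi a' b' : bilinear_for *:%R *:%R
    (fun c d : A => phi (b' * c) *: tens a' d : tensor A A).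
  split=> [v k x y|u k x y].
    by rewrite mulrDr -scalerAr linearP scalerDl -scalerA.
  by rewrite (tens_bilinear A A).2 scalerDr !scalerA mulrC -scalerA.
rewrite /tens2 tlift_tens ?tlift_tens//.
split=> [v k x y|u k x y]; apply: tlift_fun_linear => u' v'.
  by rewrite (tens_bilinear A A).1 scalerDr !scalerA [k * _]mulrC.
by rewrite mulrDl -scalerAl linearP scalerDl -scalerA.
Qed.

Lemma tmul_tens (R : realType) (A : tracialVN R) (a b : A) :
  tmul (tens a b) = a * b.
Proof.
rewrite /tmul tlift_tens//.
split=> [v k x y|u k x y]; first by rewrite mulrDl -scalerAl.
by rewrite mulrDr -scalerAr.
Qed.

Lemma hdot_inj (R : realType) (H : preHilbert R) (y z : H) :
  (forall x, hdot x y = hdot x z) -> y = z.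
Proof.
move=> yz; apply/eqP; rewrite -subr_eq0; apply/negPn/negP => /neq0_dnorm_gt0.
by move/(_ _ hdot); rewrite linearBr /= yz subrr ltxx.
Qed.

Lemma starP (R : realType) (A : vnAlgebra R) (c : R[i]) (a b : A) :
  star (c *: a + b) = Num.conj c *: star a + star b.
Proof.
apply: vn_rep_inj; apply/funext => y; apply: hdot_inj => x.
rewrite -vn_rep_star !vn_rep_linear linearPl linearDr linearZr /=.
by rewrite !vn_rep_star conjCK.
Qed.

Lemma tdot_tens (R : realType) (A : tracialVN R) (a b c d : A) :
  tdot (tens a b) (tens c d) = phi (star c * a) * phi (b * star d).
Proof.
pose g (p : A * A) (c d : A) : R[i]^o :=
  Num.conj (phi (star c * p.1) * phi (p.2 * star d)).
have bg p : bilinear_for *:%R *:%R (g p).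
  split=> [v k x y|u k x y]; rewrite /g starP ?(mulrDl, mulrDr) -?scalerAl.
    rewrite linearP mulrDl rmorphD /= -mulrA rmorphM /=.
    by congr (_ * _ + _); exact: conjCK.
  rewrite -scalerAr linearP mulrDr rmorphD /= mulrCA rmorphM /=.
  by congr (_ * _ + _); exact: conjCK.
have -> : tdot (tens a b) (tens c d) =
    \sum_(p <- tsum (tens a b)) phi (star c * p.1) * phi (p.2 * star d).
  apply: eq_bigr => p _; apply: (can_inj conjCK).
  transitivity (formal_eval (g p) (tsum (tens c d))).
    by rewrite rmorph_sum.
  by rewrite eval_tsum// [LHS]big_seq1.
pose h (a b : A) : R[i]^o := phi (star c * a) * phi (b * star d).
have bh : bilinear_for *:%R *:%R h.
  split=> [v k x y|u k x y]; rewrite /h ?(mulrDl, mulrDr).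
    by rewrite -scalerAr linearP mulrDl -mulrA.
  by rewrite -scalerAl linearP mulrDr mulrCA.
exact: (tlift_tens a b bh).
Qed.

(** * Free independence and distributions *)

(* [j 0], ..., [j n] is the word of indices, consecutive ones being distinct. *)
Definition freely_independent (R : realType) (A : tracialVN R) (J : Type)
    (B : J -> set A) : Prop :=
  forall (n : nat) (j : nat -> J) (a : nat -> A),
    (forall k, (k <= n)%N ->
      smallest (@star_subalg R A) (B (j k)) (a k) /\ phi (a k) = 0) ->
    (forall k, (k < n)%N -> j k <> j k.+1) ->
    phi (\prod_(k < n.+1) a k) = 0.

Definition compactly_supported (R : realType)
    (mu : probability (measurableTypeR R) R) : Prop :=
  exists K : R, mu `[- K, K]%classic = 1%E.

Definition moment (R : realType) (mu : probability (measurableTypeR R) R)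
    (n : nat) : R :=
  Rintegral mu setT (fun x : measurableTypeR R => (x : R) ^+ n).

(* A compactly supported measure is determined by its moments. *)
Definition has_distribution (R : realType) (A : tracialVN R) (a : A)
    (mu : probability (measurableTypeR R) R) : Prop :=
  [/\ selfadjoint a, compactly_supported mu &
      forall n, phi (a ^+ n) = (moment mu n)%:C].

Definition noncrossing n (P : {set {set 'I_n}}) : bool :=
  finset.partition P [set: 'I_n]%SET &&
  [forall B in P, forall C in P,
     forall a in B, forall b in C, forall c in B, forall d in C,
       [&& (a < b)%N, (b < c)%N & (c < d)%N] ==> (B == C)].

(* The moment-cumulant formula; it determines [r n] for [n >= 1], and [r 0]
   plays no role. *)
Definition free_cumulants (R : realType)
    (mu : probability (measurableTypeR R) R) (r : nat -> R) : Prop :=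
  forall n, moment mu n =
    \sum_(P : {set {set 'I_n}} | noncrossing P) \prod_(B in P) r #|B|.

(* For every n >= 1, mu is the n-fold free additive convolution of some nu. *)
Definition freely_infinitely_divisible (R : realType)
    (mu : probability (measurableTypeR R) R) : Prop :=
  forall n, (0 < n)%N ->
    exists (nu : probability (measurableTypeR R) R) (A : tracialVN R)
           (x : 'I_n -> A),
      [/\ forall k, has_distribution (x k) nu,
          freely_independent (fun k => [set x k]) &
          has_distribution (\sum_k x k) mu].

Definition free_convolution_semigroup (R : realType) (r : nat -> R)
    (mu_ : R -> probability (measurableTypeR R) R) : Prop :=
  forall t, 0 <= t ->
    compactly_supported (mu_ t) /\ free_cumulants (mu_ t) (fun k => t * r k).

(** * Free stochastic measures and their diagonal measures *)

Definition filtration (R : realType) (A : tracialVN R) (At : R -> set A) :=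
  (forall t, 0 <= t -> vn_subalg (At t)) /\
  (forall s t, 0 <= s -> s <= t -> At s `<=` At t).

Definition half_open (R : realType) (I : set R) : Prop :=
  exists a b, [/\ 0 <= a, a <= b & I = `[a, b[%classic].

Record free_stochastic_measure (R : realType) (A : tracialVN R)
    (At : R -> set A) (mu_ : R -> probability (measurableTypeR R) R)
    (X : set R -> A) : Prop := FreeStochasticMeasure {
  fsm_additive : forall I1 I2, half_open I1 -> half_open I2 ->
    I1 `&` I2 = set0 -> half_open (I1 `|` I2) ->
    X I1 + X I2 = X (I1 `|` I2);
  fsm_selfadjoint : forall I, half_open I -> selfadjoint (X I);
  fsm_distribution : forall a b, 0 <= a -> a <= b ->
    has_distribution (X `[a, b[%classic) (mu_ (b - a));
  fsm_free_increments : forall n (I : 'I_n -> set R),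
    (forall k, half_open (I k)) ->
    (forall j k, j != k -> I j `&` I k = set0) ->
    freely_independent (fun k => [set X (I k)]);
  fsm_adapted : forall I t, half_open I -> 0 <= t ->
    I `<=` `[0, t[%classic -> At t (X I);
  fsm_free_past : forall I t, half_open I -> 0 <= t ->
    I `&` `[0, t[%classic = set0 ->
    freely_independent (fun b : bool => if b then [set X I] else At t) }.

Definition diagonal_sum (R : realType) (A : tracialVN R) (X : set R -> A)
    (k : nat) (a b : R) (N : nat) : A :=
  \sum_(i < N) X `[a + i%:R / N%:R * (b - a),
                   a + i.+1%:R / N%:R * (b - a)[%classic ^+ k.

(* [Delta k I] is the operator-norm limit Delta_k(I); part of the assumption is
   that these limits exist. *)
Definition diagonal_measures (R : realType) (A : tracialVN R) (X : set R -> A)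
    (Delta : nat -> set R -> A) : Prop :=
  forall k a b, (0 < k)%N -> 0 <= a -> a <= b ->
    opnorm (diagonal_sum X k a b N - Delta k `[a, b[%classic)
      @[N --> \oo] --> (0 : R).

(** * Biprocesses and stochastic integrals *)

(* A biprocess is a function on [0, oo); values at negative times are never
   used, except that simple biprocesses vanish there. *)
Definition biprocess (R : realType) (A : tracialVN R) := R -> tensor A A.

(* The data of the elementary biprocess S (x) T 1_[a, b). *)
Record elementary (R : realType) (A : tracialVN R) := Elementary {
  el_left : R; el_right : R; el_S : A; el_T : A }.

Definition el_adapted (R : realType) (A : tracialVN R) (At : R -> set A)
    (c : elementary A) : Prop :=
  [/\ 0 <= el_left c, el_left c <= el_right c,
      At (el_left c) (el_S c) & At (el_left c) (el_T c)].

Definition el_biprocess (R : realType) (A : tracialVN R) (c : elementary A) :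
    biprocess A :=
  fun t => if el_left c <= t < el_right c then tens (el_S c) (el_T c) else 0.

(* S (D(b) - D(a)) T, for a process D. *)
Definition el_integral (R : realType) (A : tracialVN R) (D : R -> A)
    (c : elementary A) : A :=
  el_S c * (D (el_right c) - D (el_left c)) * el_T c.

Definition represents (R : realType) (A : tracialVN R) (At : R -> set A) n
    (c : 'I_n -> elementary A) (U : biprocess A) : Prop :=
  (forall k, el_adapted At (c k)) /\
  U = (fun t => \sum_k el_biprocess (c k) t).

(* The space of simple adapted biprocesses. *)
Definition simple_adapted (R : realType) (A : tracialVN R) (At : R -> set A) :
    set (biprocess A) :=
  [set U | exists n (c : 'I_n -> elementary A), represents At c U].

(* The integral of a simple adapted biprocess, computed on some representation
   as a sum of elementary biprocesses; it is 0 if there is none. *)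
Definition simple_integral (R : realType) (A : tracialVN R) (At : R -> set A)
    (D : R -> A) (U : biprocess A) : A :=
  xget 0 [set y | exists n (c : 'I_n -> elementary A),
    represents At c U /\ y = \sum_k el_integral D (c k)].

Definition restrict_to (R : realType) (A : tracialVN R) (t1 t2 : R)
    (U : biprocess A) : biprocess A :=
  fun s => if t1 <= s < t2 then U s else 0.

Definition adapted (R : realType) (A : tracialVN R) (At : R -> set A)
    (W : biprocess A) : Prop :=
  forall t, 0 <= t -> exists n (S T : 'I_n -> A),
    (forall k, At t (S k) /\ At t (T k)) /\ W t = \sum_k tens (S k) (T k).

Definition half_line (R : realType) : set (measurableTypeR R) :=
  `[(0 : R), +oo[%classic.
Arguments half_line : clear implicits.

(* [z] is the weak integral over [0, oo) of the Hilbert-space valued map [f]. *)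
Definition is_hintegral (R : realType) (H : hilbert R) (f : R -> H) (z : H) :
    Prop :=
  forall y : H,
    (@lebesgue_measure R).-integrable (half_line R)
      (fun s => (complex.Re (hdot (f s) y))%:E) /\
    complex.Re (hdot z y) =
      Rintegral (@lebesgue_measure R) (half_line R)
        (fun s => complex.Re (hdot (f s) y)).

(* [W_ n] is in the space of simple adapted biprocesses, and
   int ||W_ n - W||_2^2 ds and || int m (W_ n - W) ds ||_2 tend to 0. *)
Definition approximates (R : realType) (A : tracialVN R) (L2 : L2_space A)
    (At : R -> set A) (W_ : nat -> biprocess A) (W : biprocess A) : Prop :=
  [/\ forall n, simple_adapted At (W_ n),
      forall n, measurable_fun (half_line R)
        ((fun s => tnorm (W_ n s - W s)) : measurableTypeR R -> R),
      (\int[@lebesgue_measure R]_(s in (half_line R))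
        (tnorm (W_ n s - W s) ^+ 2)%:E)%E @[n --> \oo] --> 0%E &
      exists z : nat -> L2,
        (forall n, is_hintegral (fun s => toL2 L2 (tmul (W_ n s - W s))) (z n))
        /\ hnorm (z n) @[n --> \oo] --> (0 : R)].

(* [Y] is the integral of [W]: [W] can be approximated, and the integrals of
   all approximating sequences converge to [Y] in L^2. *)
Definition is_integral (R : realType) (A : tracialVN R) (L2 : L2_space A)
    (At : R -> set A) (D : R -> A) (W : biprocess A) (Y : L2) : Prop :=
  [/\ adapted At W,
      exists W_, approximates L2 At W_ W &
      forall W_, approximates L2 At W_ W ->
        hnorm (toL2 L2 (simple_integral At D (W_ n)) - Y)
          @[n --> \oo] --> (0 : R)].

Definition integrable_biprocess (R : realType) (A : tracialVN R)
    (L2 : L2_space A) (At : R -> set A) (D : R -> A) (W : biprocess A) : Prop :=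
  exists Y : L2, is_integral At D W Y.

(* The value 0 is used when [W] is not integrable. *)
Definition stochastic_integral (R : realType) (A : tracialVN R)
    (L2 : L2_space A) (At : R -> set A) (D : R -> A) (W : biprocess A) : L2 :=
  xget 0 [set Y | is_integral At D W Y].

Definition diagonal_process (R : realType) (A : tracialVN R)
    (Delta : nat -> set R -> A) (k : nat) : R -> A :=
  fun t => Delta k `[0, t[%classic.

(* Main.v *)
From HB Require Import structures.
Require Import Defs.
From mathcomp Require Import all_boot all_order all_algebra.
From mathcomp Require Import complex.
From mathcomp Require Import all_classical all_reals all_analysis.
From mathcomp Require Import measurable_realfun.
From mathcomp Require Import ring lra zify.

(** The formula is the limit of a summation by parts.  On a grid
    t_0 <= t_1 <= ... containing the end points of all the intervals that occur
    in the simple biprocesses, N is the sum over the cells of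
    a_l = sum_i V_i(t_l) # (D_i(t_(l+1)) - D_i(t_l)), and M is the sum of the
    b_l defined in the same way from the U_j, so that
      NM = sum_l (a_0 + ... + a_(l-1)) b_l + sum_l a_l (b_0 + ... + b_(l-1))
           + sum_l a_l b_l.
    The partial sums are N(t_l) and M(t_l): the first two terms are the
    integrals of the biprocesses (N(t) (x) 1) # U_j and (1 (x) M(t)) # V_i,
    sampled on the grid.  The last term is an approximation of the integrals
    of V_i (x)_2 U_j against D_(i+j).  Both facts are proved from the
    properties of the processes D_k collected in [ito_family]: with d_k the
    increment of D_k over an interval of length h and u, v, a in the past,
    phi (u d_k) = c_k h phi (u),
    phi (u d_i v d_j) = c_(i+j) h phi (u) phi (v) + c_i c_j h^2 phi (u v), and
    d_i a d_j - phi (a) d_(i+j) has L^2 norm O(h).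

    For the diagonal term, the error in one cell has norm O(h), and its scalar
    product with any element u of the past is O(h^2) ||u||_2
    ([diagonal_cell]).  Errors of different cells are thus almost orthogonal,
    and the sum of their squares, not the sum of their norms, bounds the total:
    it is O(sqrt mesh) ([almost_orthogonal_sum], [elementary_defect]).

    For the other two terms, the second formula is an Ito isometry for the
    integral minus its drift ([ito_isometry]), so all approximations of a
    biprocess have the same limit ([approximates_close]).  Since N(t) and M(t)
    are 1/2-Hoelder in L^2 norm, the two biprocesses are Hoelder between the
    end points, hence they are approximated by their samples on grids
    ([holder_approximates]), and their integrals are the limits of the sums
    above ([holder_integral]).

    It remains to show that the diagonal measures have these properties
    ([diagonal_process_ito]).  By the moment-cumulant formula the moments of
    X over an interval of length h are polynomials in h without constant term,
    and c_k is the coefficient of h in the k-th one ([moment_linear]).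
    Freeness expresses phi (u x^i v x^j) by these moments when u and v are in
    the past of x ([free_word4]), which gives the properties for the sums over
    uniform partitions, and then for their limits.  The remaining point is that
    D_k(t) - D_k(s) is the diagonal measure of [s, t).  Uniform partitions of
    adjacent intervals do not fit together, so additivity is derived from the
    covariance phi (Delta_k(I) Delta_k(J)) = c_2k |I cap J| + c_k^2 |I| |J|
    ([phi_diagonal_cov]), by which Delta_k([a, b)) + Delta_k([b, c)) -
    Delta_k([a, c)) has L^2 norm 0.  For the covariance, the powers of X over
    two overlapping intervals are expanded in words in free letters, and a word
    is bounded by the product of the lengths of the distinct letters in it
    ([word_bound], [powers_of_sums]). *)

Set Implicit Arguments.
Unset Strict Implicit.
Unset Printing Implicit Defensive.

Import Order.TTheory GRing.Theory Num.Theory.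
Import numFieldNormedType.Exports.

Local Open Scope classical_set_scope.
Local Open Scope ring_scope.
Local Open Scope complex_scope.

(** * Moduli and Hilbert norms *)

(** Norms are real numbers here, whereas [`|z|] lives in [R[i]]. *)
Definition cabs (R : realType) (z : R[i]) : R := complex.Re `|z|.

Section Cabs.
Context (R : realType).
Implicit Types z w : R[i].

Lemma cabsE z : `|z| = (cabs z)%:C.
Proof. by rewrite /cabs normc_def. Qed.

Lemma cabs_ge0 z : 0 <= cabs z.
Proof. by rewrite /cabs normc_def sqrtr_ge0. Qed.

Lemma cabsD z w : cabs (z + w) <= cabs z + cabs w.
Proof. by rewrite -lecR rmorphD /= -!cabsE ler_normD. Qed.

Lemma cabsM z w : cabs (z * w) = cabs z * cabs w.
Proof. by apply: (@complexI R); rewrite rmorphM /= -!cabsE normrM. Qed.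

Lemma cabsN z : cabs (- z) = cabs z.
Proof. by rewrite /cabs normrN. Qed.

Lemma cabs0 : cabs (0 : R[i]) = 0.
Proof. by rewrite /cabs normr0. Qed.

Lemma cabs1 : cabs (1 : R[i]) = 1.
Proof. by rewrite /cabs normr1. Qed.

Lemma cabs0_eq0 z : cabs z <= 0 -> z = 0.
Proof.
move=> z0; apply/normr0_eq0; rewrite cabsE.
by have -> : cabs z = 0 by apply/eqP; rewrite eq_le z0 cabs_ge0.
Qed.

Lemma cabs_real (x : R) : cabs x%:C = `|x|.
Proof. by rewrite /cabs normc_def /= expr0n /= addr0 sqrtr_sqr. Qed.

Lemma cabs_conj z : cabs (Num.conj z) = cabs z.
Proof. by rewrite /cabs norm_conjC. Qed.

Lemma ler_Re_cabs z : `|complex.Re z| <= cabs z.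
Proof. by rewrite -lecR -cabsE normc_ge_Re. Qed.

Lemma Re_le_cabs z : complex.Re z <= cabs z.
Proof. by rewrite (le_trans (ler_norm _)) ?ler_Re_cabs. Qed.

Lemma cabs_sum (I : Type) (s : seq I) (P : pred I) (F : I -> R[i]) :
  cabs (\sum_(i <- s | P i) F i) <= \sum_(i <- s | P i) cabs (F i).
Proof.
elim/big_rec2: _ => [|i y x _ xy]; first by rewrite cabs0.
by rewrite (le_trans (cabsD _ _)) ?lerD2l.
Qed.

Lemma cReM_real (x : R) z : complex.Re (x%:C * z) = x * complex.Re z.
Proof. by case: z => a b /=; rewrite mul0r subr0. Qed.

Lemma cReD z w : complex.Re (z + w) = complex.Re z + complex.Re w.
Proof. by case: z w => [a b] [c d]. Qed.

Lemma cReN z : complex.Re (- z) = - complex.Re z.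
Proof. by case: z. Qed.

Lemma cReB z w : complex.Re (z - w) = complex.Re z - complex.Re w.
Proof. by rewrite cReD cReN. Qed.

Lemma cRe_sum (I : Type) (s : seq I) (P : pred I) (F : I -> R[i]) :
  complex.Re (\sum_(i <- s | P i) F i) = \sum_(i <- s | P i) complex.Re (F i).
Proof. by elim/big_rec2: _ => // i y x _ <-; rewrite cReD. Qed.

Lemma cRe_conj z : complex.Re (Num.conj z) = complex.Re z.
Proof. by case: z. Qed.

Lemma sqr_cabs z : (cabs z ^+ 2)%:C = z * Num.conj z.
Proof. by rewrite rmorphXn /= -cabsE normCK. Qed.

Lemma conj_real (x : R) : Num.conj x%:C = x%:C.
Proof. exact: conjc_real. Qed.

End Cabs.

Section HilbertNorm.
Context (R : realType) (H : preHilbert R).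
Implicit Types x y z : H.

Lemma hdotC x y : hdot x y = Num.conj (hdot y x).
Proof. by rewrite (hermC hdot) /= expr0 mul1r. Qed.

Lemma hdot_ge0 x : 0 <= hdot x x.
Proof.
have [->|x0] := eqVneq x 0; first by rewrite linear0l.
by rewrite ltW // (dnorm_gt0 hdot).
Qed.

Lemma hnorm_ge0 x : 0 <= hnorm x.
Proof. exact: sqrtr_ge0. Qed.

Lemma hnorm_sqr x : hnorm x ^+ 2 = complex.Re (hdot x x).
Proof. by rewrite sqr_sqrtr //; have := hdot_ge0 x; rewrite lecE => /andP[]. Qed.

Lemma hdotxx x : hdot x x = (hnorm x ^+ 2)%:C.
Proof. by rewrite hnorm_sqr RRe_real// ger0_real ?hdot_ge0. Qed.

Lemma hnorm0 : hnorm (0 : H) = 0.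
Proof. by rewrite /hnorm linear0l /= sqrtr0. Qed.

Lemma hnorm_eq0 x : hnorm x = 0 -> x = 0.
Proof.
by move=> x0; apply/eqP; rewrite -(dnorm_eq0 hdot) hdotxx x0 expr0n.
Qed.

Lemma hnormZ (c : R[i]) x : hnorm (c *: x) = cabs c * hnorm x.
Proof.
apply/eqP; rewrite -(@eqrXn2 _ 2)// ?mulr_ge0 ?hnorm_ge0 ?cabs_ge0//.
apply/eqP/(@complexI R); rewrite -hdotxx linearZl_LR linearZr_LR /= hdotxx.
by rewrite mulrA -sqr_cabs -rmorphM exprMn.
Qed.

Lemma hnorm_opp x : hnorm (- x) = hnorm x.
Proof. by rewrite -scaleN1r hnormZ cabsN cabs1 mul1r. Qed.

Lemma hnormD_sqr x y : hnorm (x + y) ^+ 2 =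
  hnorm x ^+ 2 + hnorm y ^+ 2 + 2 * complex.Re (hdot x y).
Proof.
rewrite !hnorm_sqr linearDl /= !linearDr /= !cReD (hdotC y x) cRe_conj; ring.
Qed.

(** Cauchy-Schwarz, from the positivity of the squared norm of
    ||y||^2 x - <x, y> y. *)
Lemma hdot_le x y : cabs (hdot x y) <= hnorm x * hnorm y.
Proof.
have [y0|y0] := eqVneq (hnorm y) 0.
  by rewrite y0 (hnorm_eq0 y0) linear0r cabs0 mulr0.
rewrite -(@ler_pXn2r _ 2)// ?nnegrE ?mulr_ge0 ?hnorm_ge0 ?cabs_ge0//.
rewrite exprMn.
have y2 : 0 < hnorm y ^+ 2 by rewrite exprn_gt0// lt_neqAle eq_sym y0 hnorm_ge0.
have y2C : 0 < (hnorm y ^+ 2)%:C by rewrite ltcE /= eqxx.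
rewrite -lecR sqr_cabs.
pose d := hdot x y; pose z := (hnorm y ^+ 2)%:C *: x - d *: y.
have K := hdot_ge0 z.
rewrite /z linearBl /= !linearBr /= !linearZl_LR !linearZr_LR /= in K.
rewrite (hdotC y x) -/d !hdotxx !conj_real in K.
move: K; rewrite [X in 0 <= X](_ : _ =
   (hnorm y ^+ 2)%:C * ((hnorm x ^+ 2 * hnorm y ^+ 2)%:C - d * Num.conj d)).
  by rewrite pmulr_rge0 ?subr_ge0.
rewrite [(hnorm x ^+ 2 * hnorm y ^+ 2)%:C]rmorphM /=.
by rewrite /GRing.scale /=; ring.
Qed.

Lemma hnorm_triangle x y : hnorm (x + y) <= hnorm x + hnorm y.
Proof.
rewrite -(@ler_pXn2r _ 2)// ?nnegrE ?addr_ge0 ?hnorm_ge0//.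
rewrite hnormD_sqr.
have := le_trans (Re_le_cabs _) (hdot_le x y); lra.
Qed.

Lemma hnorm_sum (I : Type) (s : seq I) (P : pred I) (F : I -> H) :
  hnorm (\sum_(i <- s | P i) F i) <= \sum_(i <- s | P i) hnorm (F i).
Proof.
elim/big_rec2: _ => [|i y x _ xy]; first by rewrite hnorm0.
by rewrite (le_trans (hnorm_triangle _ _)) ?lerD2l.
Qed.

Lemma hnormD_sqr_le x y : hnorm (x + y) ^+ 2 <= 2 * hnorm x ^+ 2 + 2 * hnorm y ^+ 2.
Proof.
have : hnorm (x + y) ^+ 2 <= (hnorm x + hnorm y) ^+ 2.
  by rewrite ler_pXn2r ?nnegrE ?addr_ge0 ?hnorm_ge0 ?hnorm_triangle.
have := sqr_ge0 (hnorm x - hnorm y); lra.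
Qed.

Lemma hnorm_triangleB x y : hnorm (x - y) <= hnorm x + hnorm y.
Proof. by rewrite (le_trans (hnorm_triangle _ _))// hnorm_opp. Qed.

Lemma hnorm_distrC x y : hnorm (x - y) = hnorm (y - x).
Proof. by rewrite -hnorm_opp opprB. Qed.

Lemma hnorm_dist_dist x y : `|hnorm x - hnorm y| <= hnorm (x - y).
Proof.
have := hnorm_triangle (x - y) y; have := hnorm_triangle (y - x) x.
rewrite !subrK (hnorm_distrC y x) ler_norml => h1 h2.
by apply/andP; split; lra.
Qed.

End HilbertNorm.

(** * The involution and the trace *)

Section VN.
Context (R : realType) (A : vnAlgebra R).
Implicit Types (a b : A).

Lemma rep_eq a b : (forall x y, hdot x (vn_rep a y) = hdot x (vn_rep b y)) -> a = b.
Proof.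
by move=> ab; apply: vn_rep_inj; apply/funext => y; apply: hdot_inj => x.
Qed.

Lemma starK a : star (star a) = a.
Proof.
apply: rep_eq => x y.
by rewrite -vn_rep_star hdotC -vn_rep_star -hdotC.
Qed.

Lemma star1 : star (1 : A) = 1.
Proof. by apply: rep_eq => x y; rewrite -vn_rep_star !vn_rep1. Qed.

Lemma starM a b : star (a * b) = star b * star a.
Proof. by apply: rep_eq => x y; rewrite -vn_rep_star !vn_repM !vn_rep_star. Qed.

Lemma starD a b : star (a + b) = star a + star b.
Proof. by have := starP 1 a b; rewrite !scale1r rmorph1 scale1r. Qed.

Lemma star0 : star (0 : A) = 0.
Proof. by apply: (addrI (star (0 : A))); rewrite -starD !addr0. Qed.

Lemma starZ (c : R[i]) a : star (c *: a) = Num.conj c *: star a.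
Proof. by have := starP c a 0; rewrite star0 !addr0. Qed.

Lemma starN a : star (- a) = - star a.
Proof. by rewrite -scaleN1r starZ rmorphN rmorph1 scaleN1r. Qed.

Lemma starB a b : star (a - b) = star a - star b.
Proof. by rewrite starD starN. Qed.

Lemma star_sum (I : Type) (s : seq I) (P : pred I) (F : I -> A) :
  star (\sum_(i <- s | P i) F i) = \sum_(i <- s | P i) star (F i).
Proof.
by elim/big_rec2: _ => [|i y x _ <-]; rewrite ?star0 ?starD.
Qed.

Lemma starX a n : star (a ^+ n) = star a ^+ n.
Proof. by elim: n => [|n IH]; rewrite ?expr0 ?star1// exprS starM IH exprSr. Qed.

Lemma vn_repB a b x : vn_rep (a - b) x = vn_rep a x - vn_rep b x.
Proof. by rewrite addrC -(scaleN1r b) vn_rep_linear scaleN1r addrC. Qed.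

Lemma vn_rep0 x : vn_rep (0 : A) x = 0.
Proof. by rewrite -(subrr (0 : A)) vn_repB subrr. Qed.

Lemma vn_repZ (c : R[i]) a x : vn_rep (c *: a) x = c *: vn_rep a x.
Proof. by have := vn_rep_linear c a 0 x; rewrite vn_rep0 !addr0. Qed.

Lemma rep_bounded a : exists2 M : R, 0 <= M &
  forall x, hnorm (vn_rep a x) <= M * hnorm x.
Proof.
have [_ [M aM]] := vn_rep_bounded a; exists (Num.max M 0).
  by rewrite le_max lexx orbT.
by move=> x; rewrite (le_trans (aM x))// ler_wpM2r ?hnorm_ge0// le_max lexx.
Qed.

Lemma opnorm_ge0 a : 0 <= opnorm a.
Proof.
have [M M0 aM] := rep_bounded a.
apply: ub_le_sup.
  exists M => _ [x /= x1 <-]; rewrite (le_trans (aM x))//.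
  by rewrite -[leRHS]mulr1 ler_wpM2l.
exists 0; rewrite /= ?hnorm0 //.
have [lin _] := vn_rep_bounded a.
have := lin (-1) 0 0; rewrite scaler0 addr0 scaleN1r addNr => ->.
by rewrite hnorm0.
Qed.

Lemma opnormP a x : hnorm (vn_rep a x) <= opnorm a * hnorm x.
Proof.
have [M M0 aM] := rep_bounded a.
have [lin _] := vn_rep_bounded a.
have a0 : vn_rep a 0 = 0.
  by have := lin (-1) 0 0; rewrite scaler0 addr0 scaleN1r addNr.
have linZ c y : vn_rep a (c *: y) = c *: vn_rep a y.
  by have := lin c y 0; rewrite a0 !addr0.
have [x0|x0] := eqVneq (hnorm x) 0.
  by rewrite (hnorm_eq0 x0) a0 !hnorm0 mulr0.
have x1 : 0 < hnorm x by rewrite lt_neqAle eq_sym x0 hnorm_ge0.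
rewrite -ler_pdivrMr//; apply: ub_le_sup.
  exists M => _ [y /= y1 <-]; rewrite (le_trans (aM y))//.
  by rewrite -[leRHS]mulr1 ler_wpM2l.
exists ((hnorm x)^-1%:C *: x) => /=.
  by rewrite hnormZ cabs_real gtr0_norm ?invr_gt0// mulVf ?lexx.
by rewrite linZ hnormZ cabs_real gtr0_norm ?invr_gt0// mulrC.
Qed.

End VN.

Section Trace.
Context (R : realType) (A : tracialVN R).
Implicit Types (a b : A).

(** Positivity of the trace is known on the elements [star a * a]; it extends
    to all positive operators by normality, applied to the directed set with
    the two elements 0 and [b], whose supremum is [b]. *)
Lemma phi_op_ge0 b : selfadjoint b -> op_le 0 b -> 0 <= complex.Re (phi b).
Proof.
move=> sb b0; pose D := [set a : A | a = 0 \/ a = b].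
have lexx' (a : A) : op_le a a.
  by move=> x; rewrite subrr vn_rep0 linear0l.
have -> : complex.Re (phi b) = sup [set complex.Re (phi a) | a in D].
  apply: phi_normal => //.
  - by exists 0; left.
  - by move=> _ [->|->//]; exact: star0.
  - move=> x y; exists b; split; first by right.
      by case: H => ->.
    by case: H0 => ->.
  - split => //; first by move=> _ [->|->].
    by move=> c _; apply; right.
apply: ub_le_sup; last by exists 0; [left|rewrite linear0].
exists (Num.max 0 (complex.Re (phi b))) => _ [a [->|->] <-]; rewrite le_max.
  by rewrite linear0 lexx.
by rewrite lexx orbT.
Qed.

(** By polarisation: [phi (star b * b)] is real for b = 1 + a and for
    b = 1 + i a. *)
Lemma phi_star a : phi (star a) = Num.conj (phi a).
Proof.
have Im0 b : complex.Im (phi (star b * b)) = 0 by exact/ger0_Im/phi_ge0.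
have im b : complex.Im (phi b) + complex.Im (phi (star b)) = 0.
  have := Im0 (1 + b); rewrite starD star1 mulrDl !mulrDr !mul1r mulr1.
  rewrite !linearD /= phi1; move: (Im0 b).
  case: (phi b) => ? ?; case: (phi (star b)) => ? ?.
  by case: (phi (star b * b)) => ? ? /=; lra.
have := im a; have := im ('i *: a); rewrite starZ !linearZ /=.
by case: (phi a) => p q; case: (phi _) => r s /= h1 h2; congr Complex; lra.
Qed.

Section L2.
Context (L2 : L2_space A).
Local Notation n2 a := (hnorm (toL2 L2 a)).

Lemma n2_sqr a : (n2 a ^+ 2)%:C = phi (star a * a).
Proof. by rewrite -hdotxx toL2_dot. Qed.

Lemma n2_star a : n2 (star a) = n2 a.
Proof.
apply/eqP; rewrite -(@eqrXn2 _ 2)// ?hnorm_ge0//; apply/eqP/(@complexI R).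
by rewrite !n2_sqr starK phi_trace.
Qed.

Lemma n2_1 : n2 1 = 1.
Proof.
apply/eqP; rewrite -(@eqrXn2 _ 2)// ?hnorm_ge0//; apply/eqP/(@complexI R).
by rewrite n2_sqr star1 mul1r phi1 expr1n.
Qed.

Lemma phi_le a b : cabs (phi (a * b)) <= n2 a * n2 b.
Proof. by rewrite -(n2_star a) mulrC -{1}[a]starK -(toL2_dot L2) hdot_le. Qed.

Lemma phi_le1 a : cabs (phi a) <= n2 a.
Proof. by have := phi_le 1 a; rewrite mul1r n2_1 mul1r. Qed.

Lemma n2_eq0 a : n2 a = 0 -> a = 0.
Proof. by move=> a0; apply: phi_faithful; rewrite -n2_sqr a0 expr0n. Qed.

(** With M the norm of [a], the operator [star b * (M^2 - star a * a) * b] is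
    positive, and so is its trace. *)
Lemma n2_mulr_le (M : R) a b : 0 <= M ->
  (forall x, hnorm (vn_rep a x) <= M * hnorm x) -> n2 (a * b) <= M * n2 b.
Proof.
move=> M0 aM; pose p : A := (M ^+ 2)%:C *: 1 - star a * a.
have sp : star p = p.
  by rewrite starB starZ star1 starM starK conj_real.
have: 0 <= complex.Re (phi (star b * p * b)).
  apply: phi_op_ge0; first by rewrite /selfadjoint /= !starM starK sp mulrA.
  move=> x; rewrite subr0 !vn_repM hdotC -vn_rep_star -hdotC; set y := vn_rep b x.
  rewrite /p vn_repB vn_repZ vn_rep1 vn_repM linearBl /= linearZl_LR /=.
  rewrite [X in _ - X]hdotC -vn_rep_star -hdotC !hdotxx -rmorphM -rmorphB /=.
  rewrite ler0c subr_ge0 -exprMn ler_pXn2r ?nnegrE ?mulr_ge0 ?hnorm_ge0//.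
rewrite mulrBr mulrBl -scalerAr mulr1 -scalerAl linearB linearZ /= !mulrA.
rewrite -starM -[_ * a * b]mulrA -!n2_sqr /= mul0r subr0 subr_ge0 -exprMn.
by rewrite ler_pXn2r ?nnegrE ?mulr_ge0 ?hnorm_ge0.
Qed.

Lemma n2_le_opnorm a : n2 a <= opnorm a.
Proof.
have := @n2_mulr_le (opnorm a) a 1 (opnorm_ge0 a) (opnormP a).
by rewrite mulr1 n2_1 mulr1.
Qed.

Lemma mul_boundedl a : exists2 M : R, 0 <= M & forall b, n2 (a * b) <= M * n2 b.
Proof.
by have [M M0 aM] := rep_bounded a; exists M => // b; exact: n2_mulr_le.
Qed.

Lemma mul_bounded a b : exists2 M : R, 0 <= M &
  forall x, n2 (a * x * b) <= M * n2 x.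
Proof.
have [M M0 aM] := mul_boundedl a.
have [M' M'0 bM] := mul_boundedl (star b).
exists (M * M'); first exact: mulr_ge0.
move=> x; rewrite -mulrA (le_trans (aM _))// -mulrA ler_wpM2l//.
by rewrite -n2_star starM (le_trans (bM _))// n2_star.
Qed.

End L2.
End Trace.

(** * Convergence *)

Definition ccvg (R : realType) (a : nat -> R[i]) (z : R[i]) : Prop :=
  cabs (a n - z) @[n --> \oo] --> (0 : R).

Definition hcvg (R : realType) (H : preHilbert R) (u : nat -> H) (l : H) : Prop :=
  hnorm (u n - l) @[n --> \oo] --> (0 : R).

Lemma cvg0_le (R : realType) (f g : nat -> R) : (forall n, 0 <= f n <= g n) ->
  g n @[n --> \oo] --> (0 : R) -> f n @[n --> \oo] --> (0 : R).
Proof.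
move=> fg g0; apply: (squeeze_cvgr _ (cvg_cst 0) g0).
by near=> n; exact: fg.
Unshelve. all: by end_near. Qed.

Lemma cvg_le_cst (R : realType) (f : nat -> R) (l B : R) :
  f n @[n --> \oo] --> l -> (forall n, f n <= B) -> l <= B.
Proof.
move=> fl fB; have <- := cvg_lim (@Rhausdorff R) fl.
by apply: limr_le; [apply/cvg_ex; exists l | near=> n; exact: fB].
Unshelve. all: by end_near. Qed.

Lemma cvg0_eq (R : realType) (c : R) (f : nat -> R) :
  (forall n, c <= f n) -> f n @[n --> \oo] --> (0 : R) -> c <= 0.
Proof.
move=> cf f0; have := @cvg_le_cst R (fun n => - f n) 0 (- c).
rewrite lerNr oppr0; apply; last by move=> n; rewrite lerN2.
by rewrite -oppr0; exact: cvgN.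
Qed.

Section ComplexLimits.
Context (R : realType).
Implicit Types (a b : nat -> R[i]) (z w : R[i]).

Lemma ccvg_unique a z w : ccvg a z -> ccvg a w -> z = w.
Proof.
move=> az aw; apply/subr0_eq/cabs0_eq0.
apply: (cvg0_eq (f := fun n => cabs (a n - z) + cabs (a n - w))).
  move=> n; rewrite -(cabsN (a n - z)) opprB.
  have -> : z - w = (z - a n) + (a n - w) by rewrite addrA subrK.
  exact: cabsD.
by rewrite -[0]addr0; exact: cvgD.
Qed.

Lemma ccvgD a b z w : ccvg a z -> ccvg b w -> ccvg (fun n => a n + b n) (z + w).
Proof.
move=> az bw; apply: (cvg0_le (g := fun n => cabs (a n - z) + cabs (b n - w))).
  by move=> n; rewrite cabs_ge0 /= opprD addrACA cabsD.
by rewrite -[0]addr0; exact: cvgD.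
Qed.

Lemma ccvg_real (r : nat -> R) (x : R) w :
  r n @[n --> \oo] --> x -> ccvg (fun n => (r n)%:C * w) (x%:C * w).
Proof.
move=> rx; rewrite /ccvg; under eq_fun do rewrite -mulrBl cabsM -rmorphB cabs_real.
rewrite -[0](mul0r (cabs w)); apply: cvgMr_tmp.
by apply/norm_cvg0P; apply/subr_cvg0.
Qed.

End ComplexLimits.

Section HilbertLimits.
Context (R : realType) (H : preHilbert R).
Implicit Types (u v : nat -> H) (x y : H).

Lemma hcvg_unique u x y : hcvg u x -> hcvg u y -> x = y.
Proof.
move=> ux uy; apply/subr0_eq/hnorm_eq0/eqP; rewrite eq_le hnorm_ge0 andbT.
apply: (cvg0_eq (f := fun n => hnorm (u n - x) + hnorm (u n - y))).
  move=> n; have -> : x - y = (u n - y) - (u n - x).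
    by rewrite opprB [RHS]addrC addrA subrK.
  by rewrite [leRHS]addrC hnorm_triangleB.
by rewrite -[0]addr0; exact: cvgD.
Qed.

Lemma hcvg_cst x : hcvg (fun=> x) x.
Proof. by rewrite /hcvg; under eq_fun do rewrite subrr hnorm0; exact: cvg_cst. Qed.

Lemma hcvgD u v x y : hcvg u x -> hcvg v y -> hcvg (fun n => u n + v n) (x + y).
Proof.
move=> ux vy; apply: (cvg0_le (g := fun n => hnorm (u n - x) + hnorm (v n - y))).
  by move=> n; rewrite hnorm_ge0 /= opprD addrACA hnorm_triangle.
by rewrite -[0]addr0; exact: cvgD.
Qed.

Lemma hcvgZ (c : R[i]) u x : hcvg u x -> hcvg (fun n => c *: u n) (c *: x).
Proof.
move=> ux; rewrite /hcvg; under eq_fun do rewrite -scalerBr hnormZ.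
by rewrite -[0](mulr0 (cabs c)); exact: cvgMl_tmp.
Qed.

Lemma hcvgB u v x y : hcvg u x -> hcvg v y -> hcvg (fun n => u n - v n) (x - y).
Proof.
move=> ux vy; have := hcvgD ux (hcvgZ (-1) vy); rewrite scaleN1r.
by under eq_fun do rewrite scaleN1r.
Qed.

Lemma hcvg_sum (I : eqType) (s : seq I) (u : I -> nat -> H) (x : I -> H) :
  (forall i, i \in s -> hcvg (u i) (x i)) ->
  hcvg (fun n => \sum_(i <- s) u i n) (\sum_(i <- s) x i).
Proof.
elim: s => [_|i s IH ux].
  by under eq_fun do rewrite big_nil; rewrite big_nil; exact: hcvg_cst.
under eq_fun do rewrite big_cons; rewrite big_cons; apply: hcvgD.
  by apply: ux; rewrite mem_head.
by apply: IH => j js; apply: ux; rewrite inE js orbT.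
Qed.

Lemma hcvg_norm u x : hcvg u x -> hnorm (u n) @[n --> \oo] --> hnorm x.
Proof.
move=> ux; apply/subr_cvg0/norm_cvg0P.
apply: (cvg0_le (g := fun n => hnorm (u n - x))) => // n.
by rewrite normr_ge0 hnorm_dist_dist.
Qed.

Lemma hcvg_le u x (B : R) : hcvg u x -> (forall n, hnorm (u n) <= B) -> hnorm x <= B.
Proof. by move=> /hcvg_norm ux; exact: cvg_le_cst. Qed.

Lemma hcvg_dot u v x y : hcvg u x -> hcvg v y ->
  ccvg (fun n => hdot (u n) (v n)) (hdot x y).
Proof.
move=> ux vy; apply: (cvg0_le
  (g := fun n => hnorm (u n - x) * hnorm (v n) + hnorm x * hnorm (v n - y))).
  move=> n; rewrite cabs_ge0 /=.
  have -> : hdot (u n) (v n) - hdot x y =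
      hdot (u n - x) (v n) + hdot x (v n - y).
    by rewrite linearBl linearBr /= addrA subrK.
  by rewrite (le_trans (cabsD _ _))// lerD// hdot_le.
rewrite -[0](addr0) -{1}[0](mul0r (hnorm y)) -{2}[0](mulr0 (hnorm x)).
apply: cvgD; last exact: cvgMl_tmp.
by apply: cvgM => //; exact: hcvg_norm.
Qed.

Lemma hcvg_near u v x : hcvg u x -> hnorm (v n - u n) @[n --> \oo] --> (0 : R) ->
  hcvg v x.
Proof.
move=> ux uv; apply: (cvg0_le (g := fun n => hnorm (v n - u n) + hnorm (u n - x))).
  move=> n; rewrite hnorm_ge0 /=.
  have -> : v n - x = (v n - u n) + (u n - x) by rewrite addrA subrK.
  exact: hnorm_triangle.
by rewrite -[0]addr0; exact: cvgD.
Qed.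

End HilbertLimits.

Section TraceLimits.
Context (R : realType) (A : tracialVN R) (L2 : L2_space A).
Implicit Types (y : nat -> A).
Local Notation n2 a := (hnorm (toL2 L2 a)).
Local Notation cvg2 y a := (hcvg (fun n => toL2 L2 (y n)) (toL2 L2 a)).

Lemma cvg2_mul y (l a b : A) : cvg2 y l -> cvg2 (fun n => a * y n * b) (a * l * b).
Proof.
move=> yl; have [M M0 aMb] := mul_bounded L2 a b.
apply: (cvg0_le (g := fun n => M * hnorm (toL2 L2 (y n) - toL2 L2 l))).
  by move=> n; rewrite hnorm_ge0 /= -!linearB -mulrBl -mulrBr aMb.
by rewrite -[0](mulr0 M); exact: cvgMl_tmp.
Qed.

Lemma cvg2_star y (l : A) : cvg2 y l -> cvg2 (fun n => star (y n)) (star l).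
Proof.
move=> yl; rewrite /hcvg; under eq_fun do rewrite -linearB -starB n2_star linearB.
exact: yl.
Qed.

Lemma cvg2_phi y (l u v : A) (y' : nat -> A) (l' : A) :
  cvg2 y l -> cvg2 y' l' -> ccvg (fun n => phi (u * y n * v * y' n)) (phi (u * l * v * l')).
Proof.
move=> yl yl'; have := hcvg_dot yl' (cvg2_star (cvg2_mul u v yl)).
by under eq_fun do rewrite toL2_dot starK; rewrite toL2_dot starK.
Qed.

Lemma cvg2_phi1 y (l u : A) : cvg2 y l -> ccvg (fun n => phi (u * y n)) (phi (u * l)).
Proof.
move=> yl; have := cvg2_phi u 1 yl (hcvg_cst (toL2 L2 1)).
by under eq_fun do rewrite !mulr1; rewrite !mulr1.
Qed.

Lemma opnorm_cvg2 y (l : A) : opnorm (y n - l) @[n --> \oo] --> (0 : R) -> cvg2 y l.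
Proof.
move=> yl; apply: (cvg0_le (g := fun n => opnorm (y n - l))) => // n.
by rewrite hnorm_ge0 -linearB n2_le_opnorm.
Qed.

(** L^2 convergence of both factors would not suffice: the product is not
    continuous in L^2. *)
Lemma opnorm_cvg2M y y' (l l' c : A) : opnorm (y n - l) @[n --> \oo] --> (0 : R) ->
  cvg2 y' l' -> cvg2 (fun n => y n * c * y' n) (l * c * l').
Proof.
move=> yl y'l'; have y'c : cvg2 (fun n => c * y' n) (c * l').
  have := cvg2_mul c 1 y'l'; under eq_fun do rewrite mulr1; by rewrite mulr1.
have yc : cvg2 (fun n => l * c * y' n) (l * c * l').
  have := cvg2_mul (l * c) 1 y'l'; under eq_fun do rewrite mulr1; by rewrite mulr1.
apply: (hcvg_near yc).
apply: (cvg0_le (g := fun n => opnorm (y n - l) * n2 (c * y' n))).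
  move=> n; rewrite hnorm_ge0 /= -linearB -!mulrA -mulrBl.
  by apply: n2_mulr_le; [exact: opnorm_ge0|exact: opnormP].
rewrite -[0](mul0r (n2 (c * l'))).
by apply: cvgM => //; exact: hcvg_norm.
Qed.

End TraceLimits.

(** * Tensor calculus *)

Section TensorCalculus.
Context (K : comNzRingType) (U V : lmodType K).
Implicit Types (x y : tensor U V).

Lemma tliftD (W : lmodType K) (f : U -> V -> W) x y :
  bilinear_for *:%R *:%R f -> tlift f (x + y) = tlift f x + tlift f y.
Proof. by move=> bf; have := tlift_linear bf 1 x y; rewrite !scale1r. Qed.

Lemma tlift0 (W : lmodType K) (f : U -> V -> W) :
  bilinear_for *:%R *:%R f -> tlift f (0 : tensor U V) = 0.
Proof.
move=> bf; apply: (addrI (tlift f (0 : tensor U V))).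
by rewrite -tliftD// !addr0.
Qed.

Lemma tliftZ (W : lmodType K) (f : U -> V -> W) c x :
  bilinear_for *:%R *:%R f -> tlift f (c *: x) = c *: tlift f x.
Proof.
by move=> bf; have := tlift_linear bf c x 0; rewrite tlift0// !addr0.
Qed.

Lemma tlift_sum (W : lmodType K) (f : U -> V -> W) (I : Type) (s : seq I)
  (P : pred I) (F : I -> tensor U V) : bilinear_for *:%R *:%R f ->
  tlift f (\sum_(i <- s | P i) F i) = \sum_(i <- s | P i) tlift f (F i).
Proof.
by move=> bf; elim/big_rec2: _ => [|i y x _ <-]; rewrite ?tlift0 ?tliftD.
Qed.

Lemma tensor_sum_tens x : x = \sum_(p <- tsum x) tens p.1 p.2.
Proof.
rewrite -[LHS]tsumK -[RHS]tsumK; apply/tclassP => W f bf.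
rewrite -/(tlift f (\sum_(p <- tsum x) tens p.1 p.2)) tlift_sum//.
by apply: eq_bigr => p _; rewrite tlift_tens.
Qed.

Lemma tens0r (u : U) : tens u (0 : V) = 0.
Proof.
have /= := (tens_bilinear U V).2 u 1 0 0.
by rewrite !scale1r addr0 => /(congr1 (fun z => z - tens u 0)); rewrite addrK subrr.
Qed.

Lemma tens0l (v : V) : tens (0 : U) v = 0.
Proof.
have /= := (tens_bilinear U V).1 v 1 0 0.
by rewrite !scale1r addr0 => /(congr1 (fun z => z - tens 0 v)); rewrite addrK subrr.
Qed.

Lemma tensDl (u u' : U) (v : V) : tens (u + u') v = tens u v + tens u' v.
Proof. by have /= := (tens_bilinear U V).1 v 1 u u'; rewrite !scale1r. Qed.

Lemma tensDr (u : U) (v v' : V) : tens u (v + v') = tens u v + tens u v'.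
Proof. by have /= := (tens_bilinear U V).2 u 1 v v'; rewrite !scale1r. Qed.

Lemma tensZl c (u : U) (v : V) : tens (c *: u) v = c *: tens u v.
Proof. by have /= := (tens_bilinear U V).1 v c u 0; rewrite tens0l !addr0. Qed.

Lemma tensZr c (u : U) (v : V) : tens u (c *: v) = c *: tens u v.
Proof. by have /= := (tens_bilinear U V).2 u c v 0; rewrite tens0r !addr0. Qed.

Lemma tens_suml (I : Type) (s : seq I) (F : I -> U) (v : V) :
  tens (\sum_(i <- s) F i) v = \sum_(i <- s) tens (F i) v.
Proof. by elim/big_rec2: _ => [|i y x _ <-]; rewrite ?tens0l ?tensDl. Qed.

End TensorCalculus.

(** The action of the algebra A (x) A^op on A: (a (x) b) . d = a d b. *)
Definition tact (R : realType) (A : tracialVN R) (x : tensor A A) (d : A) : A :=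
  tlift (fun a b => a * d * b) x.

Section Action.
Context (R : realType) (A : tracialVN R).
Implicit Types (x y : tensor A A) (a b d n : A).

Lemma tact_bilinear d : bilinear_for *:%R *:%R (fun a b : A => a * d * b).
Proof.
split=> [v c x y|u c x y]; first by rewrite !mulrDl -!scalerAl.
by rewrite mulrDr -scalerAr.
Qed.

Lemma tact_tens a b d : tact (tens a b) d = a * d * b.
Proof. exact: (tlift_tens _ _ (tact_bilinear d)). Qed.

Lemma tactDl x y d : tact (x + y) d = tact x d + tact y d.
Proof. exact: tliftD (tact_bilinear d). Qed.

Lemma tact0l d : tact 0 d = 0.
Proof. exact: tlift0 (tact_bilinear d). Qed.

Lemma tactZl c x d : tact (c *: x) d = c *: tact x d.
Proof. exact: tliftZ (tact_bilinear d). Qed.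

Lemma tact_suml (I : Type) (s : seq I) (P : pred I) (F : I -> tensor A A) d :
  tact (\sum_(i <- s | P i) F i) d = \sum_(i <- s | P i) tact (F i) d.
Proof. exact: tlift_sum (tact_bilinear d). Qed.

Lemma tact_expand x d : tact x d = \sum_(p <- tsum x) p.1 * d * p.2.
Proof. by []. Qed.

Lemma tactBl x y d : tact (x - y) d = tact x d - tact y d.
Proof. by rewrite tactDl -scaleN1r tactZl scaleN1r. Qed.

Lemma tmulE x : tmul x = tact x 1.
Proof. by rewrite tact_expand; apply: eq_bigr => p _; rewrite mulr1. Qed.

End Action.

(* The products [sharp] and [tens2] lift a map of four arguments that is
   bilinear in the first two and in the last two. *)
Section TwoVariables.
Context (K : comNzRingType) (U V W : lmodType K) (g : U -> V -> U -> V -> W).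
Hypothesis bg1 : forall u v, bilinear_for *:%R *:%R (g u v).
Hypothesis bg2 : forall u v, bilinear_for *:%R *:%R (fun u' v' => g u' v' u v).

Let op (x y : tensor U V) : W := tlift (fun a b => tlift (g a b) y) x.

Lemma tlift2_bilinear (y : tensor U V) :
  bilinear_for *:%R *:%R (fun a b => tlift (g a b) y).
Proof.
split=> [v k x x'|u k x x']; apply: tlift_fun_linear => c d.
  exact: (bg2 c d).1.
exact: (bg2 c d).2.
Qed.

Lemma tlift2_suml (I : Type) (s : seq I) (P : pred I) (F : I -> tensor U V) y :
  op (\sum_(i <- s | P i) F i) y = \sum_(i <- s | P i) op (F i) y.
Proof. exact: tlift_sum (tlift2_bilinear y). Qed.

Lemma tlift2_sumr (I : Type) (s : seq I) (P : pred I) (F : I -> tensor U V) x :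
  op x (\sum_(i <- s | P i) F i) = \sum_(i <- s | P i) op x (F i).
Proof.
rewrite /op {1}/tlift {1}/formal_eval.
under eq_bigr do rewrite (tlift_sum _ _ _ (bg1 _ _)).
by rewrite exchange_big.
Qed.

End TwoVariables.

Section SharpTens2.
Context (R : realType) (A : tracialVN R).
Implicit Types (x y : tensor A A) (a b c d n : A).

Lemma sharp_bilinear1 a b : bilinear_for *:%R *:%R
  (fun c d : A => tens (a * c) (d * b) : tensor A A).
Proof.
split=> [v k x y|u k x y]; first by rewrite mulrDr -scalerAr tensDl tensZl.
by rewrite mulrDl -scalerAl tensDr tensZr.
Qed.

Lemma tens2_bilinear1 a b : bilinear_for *:%R *:%R
  (fun c d : A => phi (b * c) *: tens a d : tensor A A).
Proof.
split=> [v k x y|u k x y].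
  by rewrite mulrDr -scalerAr linearP scalerDl -scalerA.
by rewrite tensDr tensZr scalerDr !scalerA mulrC -scalerA.
Qed.

Lemma tens2_bilinear2 c d : bilinear_for *:%R *:%R
  (fun a b : A => phi (b * c) *: tens a d : tensor A A).
Proof.
split=> [v k x y|u k x y].
  by rewrite tensDl tensZl scalerDr !scalerA mulrC -scalerA.
by rewrite mulrDl -scalerAl linearP scalerDl -scalerA.
Qed.

Lemma sharp_sumr (I : Type) (s : seq I) (P : pred I) (F : I -> tensor A A) x :
  sharp x (\sum_(i <- s | P i) F i) = \sum_(i <- s | P i) sharp x (F i).
Proof. exact: tlift2_sumr sharp_bilinear1 _ _ _ _ _. Qed.

Lemma tens2_suml (I : Type) (s : seq I) (P : pred I) (F : I -> tensor A A) y :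
  tens2 (\sum_(i <- s | P i) F i) y = \sum_(i <- s | P i) tens2 (F i) y.
Proof. exact: tlift2_suml tens2_bilinear2 _ _ _ _ _. Qed.

Lemma tens2_sumr (I : Type) (s : seq I) (P : pred I) (F : I -> tensor A A) x :
  tens2 x (\sum_(i <- s | P i) F i) = \sum_(i <- s | P i) tens2 x (F i).
Proof. exact: tlift2_sumr tens2_bilinear1 _ _ _ _ _. Qed.

Lemma sharp0r x : sharp x 0 = 0.
Proof. by have := sharp_sumr (I := unit) [::] xpredT (fun=> 0) x; rewrite !big_nil. Qed.

Lemma tens20l y : tens2 0 y = 0.
Proof. by have := tens2_suml (I := unit) [::] xpredT (fun=> 0) y; rewrite !big_nil. Qed.

Lemma tens20r x : tens2 x 0 = 0.
Proof. by have := tens2_sumr (I := unit) [::] xpredT (fun=> 0) x; rewrite !big_nil. Qed.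

Lemma sharp_expandl n x : sharp (tens n 1) x = \sum_(p <- tsum x) tens (n * p.1) p.2.
Proof.
rewrite {1}(tensor_sum_tens x) sharp_sumr; apply: eq_bigr => p _.
by rewrite sharp_tens mulr1.
Qed.

Lemma sharp_expandr n x : sharp (tens 1 n) x = \sum_(p <- tsum x) tens p.1 (p.2 * n).
Proof.
rewrite {1}(tensor_sum_tens x) sharp_sumr; apply: eq_bigr => p _.
by rewrite sharp_tens mul1r.
Qed.

Lemma tact_sharpl n x d : tact (sharp (tens n 1) x) d = n * tact x d.
Proof.
rewrite sharp_expandl tact_suml tact_expand mulr_sumr; apply: eq_bigr => p _.
by rewrite tact_tens !mulrA.
Qed.

Lemma tact_sharpr n x d : tact (sharp (tens 1 n) x) d = tact x d * n.
Proof.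
rewrite sharp_expandr tact_suml tact_expand mulr_suml; apply: eq_bigr => p _.
by rewrite tact_tens !mulrA.
Qed.

End SharpTens2.

(** * The Hilbert norm on A (x) A^op *)

Section TensorDot.
Context (R : realType) (A : tracialVN R).
Implicit Types (x y : tensor A A) (a b c d n : A).

Lemma tdotC x y : tdot x y = Num.conj (tdot y x).
Proof.
rewrite /tdot rmorph_sum exchange_big /=; apply: eq_bigr => p _.
rewrite rmorph_sum /=; apply: eq_bigr => q _.
transitivity (phi (star (star q.1 * p.1)) * phi (star (p.2 * star q.2))).
  by rewrite !starM !starK.
by rewrite !phi_star rmorphM.
Qed.

Lemma tdot_bilinearl y : bilinear_for *:%R *:%R
  (fun a b => \sum_(q <- tsum y) phi (star q.1 * a) * phi (b * star q.2) : R[i]^o).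
Proof.
split=> [v k u u'|u k v v'] /=; rewrite scaler_sumr -big_split; apply: eq_bigr => q _ /=.
  by rewrite mulrDr -scalerAr linearP mulrDl -mulrA.
by rewrite mulrDl -scalerAl linearP mulrDr mulrCA.
Qed.

Lemma tdotPl (k : R[i]) x x' y : tdot (k *: x + x') y = k * tdot x y + tdot x' y.
Proof. exact: (tlift_linear (tdot_bilinearl y) k x x'). Qed.

Lemma tdotPr (k : R[i]) x y y' : tdot x (k *: y + y') = Num.conj k * tdot x y + tdot x y'.
Proof. by rewrite [LHS]tdotC tdotPl rmorphD rmorphM [tdot x y]tdotC [tdot x y']tdotC. Qed.

Lemma tdot_suml (I : Type) (s : seq I) (P : pred I) (F : I -> tensor A A) y :
  tdot (\sum_(i <- s | P i) F i) y = \sum_(i <- s | P i) tdot (F i) y.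
Proof. exact: (tlift_sum _ _ _ (tdot_bilinearl y)). Qed.

Lemma tdot_sumr (I : Type) (s : seq I) (P : pred I) (F : I -> tensor A A) y :
  tdot y (\sum_(i <- s | P i) F i) = \sum_(i <- s | P i) tdot y (F i).
Proof.
by rewrite tdotC tdot_suml rmorph_sum; apply: eq_bigr => i _; rewrite [RHS]tdotC.
Qed.

(** Gram-Schmidt on the left legs: a new leg is replaced by its component
    orthogonal to the previous ones, and the rest is absorbed by their right
    legs. *)
Lemma orthogonal_legs (s : seq (A * A)) : exists (n : nat) (e b : nat -> A),
  \sum_(p <- s) tens p.1 p.2 = \sum_(i < n) tens (e i) (b i) /\
  forall i j, (i < n)%N -> (j < n)%N -> i != j -> phi (star (e i) * e j) = 0.
Proof.
elim: s => [|[a b] s [n [e [b' [sE oe]]]]].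
  by exists 0%N, (fun=> 0), (fun=> 0); rewrite big_nil big_ord0.
pose c i := phi (star (e i) * a) / phi (star (e i) * e i).
pose a' := a - \sum_(i < n) c i *: e i.
exists n.+1, (fun i => if i == n then a' else e i),
  (fun i => if i == n then b else b' i + c i *: b).
have oa i : (i < n)%N -> phi (star (e i) * a') = 0.
  move=> ni; rewrite /a' mulrBr mulr_sumr linearB linear_sum /=.
  rewrite (bigD1 (Ordinal ni)) //= big1 => [|j /negP ji]; last first.
    rewrite -scalerAr linearZ /= oe ?mulr0//; apply/negP => /eqP ij.
    by apply: ji; apply/eqP/val_inj.
  rewrite addr0 -scalerAr linearZ /=; have [e0|e0] := eqVneq (phi (star (e i) * e i)) 0.
    by rewrite (phi_faithful e0) star0 !mul0r linear0 mulr0 subr0.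
  by rewrite divfK// subrr.
split.
  rewrite big_cons big_ord_recr /= eqxx sE.
  rewrite [X in _ = X + _](eq_bigr (fun i : 'I_n => tens (e i) (b' i) + tens (c i *: e i) b)).
    rewrite big_split /= -addrA -tens_suml -tensDl [_ + a']addrC subrK.
    by rewrite addrC.
  by move=> i _; rewrite (ltn_eqF (ltn_ord i)) tensDr tensZr tensZl.
move=> i j; rewrite !ltnS => ni nj ij.
have [i_n|i_n] := eqVneq i n; have [j_n|j_n] := eqVneq j n.
- by rewrite i_n j_n eqxx in ij.
- by rewrite -[star a' * _]starK starM starK phi_star oa ?rmorph0 ?ltn_neqAle ?j_n.
- by rewrite oa// ltn_neqAle i_n.
- by apply: oe; rewrite // ltn_neqAle ?i_n ?j_n.
Qed.

(** In a representation with orthogonal left legs the cross terms vanish, and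
    faithfulness of the trace concludes. *)
Lemma tdot_gt0 x : x != 0 -> 0 < tdot x x.
Proof.
move=> x0; have [n [e [b [xE oe]]]] := orthogonal_legs (tsum x).
rewrite -tensor_sum_tens in xE.
have bb i : 0 <= phi (b i * star (b i)) by rewrite phi_trace phi_ge0.
have E : tdot x x = \sum_(i < n) phi (star (e i) * e i) * phi (b i * star (b i)).
  rewrite xE tdot_suml; apply: eq_bigr => i _; rewrite tdot_sumr (bigD1 i)//=.
  rewrite tdot_tens big1 ?addr0// => j ji; rewrite tdot_tens oe ?mul0r//.
have x_ge0 : 0 <= tdot x x.
  by rewrite E sumr_ge0// => i _; rewrite mulr_ge0 ?phi_ge0.
rewrite lt_neqAle x_ge0 andbT; apply/negP => /eqP/esym; rewrite E => /psumr_eq0P h.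
case/negP: x0; rewrite xE big1// => i _.
have /h/(_ i isT)/eqP : forall i : 'I_n, true ->
    0 <= phi (star (e i) * e i) * phi (b i * star (b i)).
  by move=> j _; rewrite mulr_ge0 ?phi_ge0.
rewrite mulf_eq0 => /orP[/eqP/phi_faithful ->|]; first by rewrite tens0l.
rewrite -{1}[b i]starK => /eqP/phi_faithful/(congr1 star); rewrite starK star0 => ->.
by rewrite tens0r.
Qed.

End TensorDot.

Lemma tdot_bilinear_for (R : realType) (A : tracialVN R) :
  bilinear_for (GRing.Scale.Law.clone _ _ ( *%R ) _)
    (GRing.Scale.Law.clone _ _ (@Num.conj R[i] \; *%R ) _) (@tdot R A).
Proof. by split=> [u'|u] a x y /=; [exact: tdotPl|exact: tdotPr]. Qed.

HB.instance Definition _ (R : realType) (A : tracialVN R) :=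
  bilinear_isBilinear.Build R[i] (tensor A A) (tensor A A) _
    (GRing.Scale.Law.clone _ _ ( *%R ) _)
    (GRing.Scale.Law.clone _ _ (@Num.conj R[i] \; *%R ) _) (@tdot R A)
    (@tdot_bilinear_for R A).

Lemma tdot_hermitian (R : realType) (A : tracialVN R) (x y : tensor A A) :
  tdot x y = (-1) ^+ false * Num.conj (tdot y x).
Proof. by rewrite expr0 mul1r -tdotC. Qed.

HB.instance Definition _ (R : realType) (A : tracialVN R) :=
  isHermitianSesquilinear.Build R[i] (tensor A A) false (@Num.conj R[i]) (@tdot R A)
    (@tdot_hermitian R A).

HB.instance Definition _ (R : realType) (A : tracialVN R) :=
  isDotProduct.Build R[i] (tensor A A) (@tdot R A) (@tdot_gt0 R A).

(** The norm of this space is [tnorm], to which the lemmas on Hilbert norms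
    thus apply. *)
Definition tensorH (R : realType) (A : tracialVN R) : preHilbert R :=
  @PreHilbert R (tensor A A) (@tdot R A).

Lemma tnormE (R : realType) (A : tracialVN R) (x : tensor A A) :
  tnorm x = hnorm (x : tensorH A).
Proof. by []. Qed.

(** * Moments of the convolution semigroup *)

Section Moments.
Context (R : realType) (r : nat -> R) (mu_ : R -> probability (measurableTypeR R) R).
Hypothesis mu_semigroup : free_convolution_semigroup r mu_.

(** This is [r n]: the only partition with one block is [set: 'I_n]. *)
Definition linear_coef (n : nat) : R :=
  \sum_(P : {set {set 'I_n}} | noncrossing P && (#|P| == 1)%N) \prod_(B in P) r #|B|.

(** A partition with m blocks contributes a multiple of t^m to the moment of
    order n; the term with m = 1 is linear and the others are O(t^2). *)
Lemma moment_linear (n : nat) (H : R) : (0 < n)%N -> 0 <= H ->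
  exists2 C : R, 0 <= C & forall t, 0 <= t <= H ->
    `|moment (mu_ t) n - t * linear_coef n| <= C * t ^+ 2.
Proof.
move=> n0 H0.
exists (\sum_(P : {set {set 'I_n}}) H ^+ (#|P| - 2) * `|\prod_(B in P) r #|B| |).
  by apply: sumr_ge0 => P _; rewrite mulr_ge0 ?exprn_ge0.
move=> t /andP[t0 tH]; have [_ /(_ n) ->] := mu_semigroup t0.
have E (P : {set {set 'I_n}}) : \prod_(B in P) (t * r #|B|) =
    t ^+ #|P| * \prod_(B in P) r #|B|.
  by rewrite big_split /= prodr_const.
rewrite (bigID (fun P : {set {set 'I_n}} => #|P| == 1)%N) /=.
rewrite [X in X + _ - _](_ : _ = t * linear_coef n); last first.
  by rewrite mulr_sumr; apply: eq_bigr => P /andP[_ /eqP P1]; rewrite E P1 expr1.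
rewrite addrAC subrr add0r mulr_suml (le_trans (ler_norm_sum _ _ _))//.
rewrite [leLHS]big_mkcond /=; apply: ler_sum => P _.
case: ifPn => [/andP[/andP[Pp _] P1]|_]; last first.
  by rewrite mulr_ge0 ?sqr_ge0// mulr_ge0 ?exprn_ge0.
have P2 : (2 <= #|P|)%N.
  rewrite ltn_neqAle eq_sym P1 /= card_gt0; apply/eqP => P0.
  have := finset.cover_partition Pp; rewrite P0 /finset.cover big_set0 => /setP/(_ (Ordinal n0)).
  by rewrite finset.inE finset.in_setT.
rewrite E normrM mulrAC; apply: ler_wpM2r => //.
rewrite -{1}(subnK P2) exprD normrM !ger0_norm ?exprn_ge0// ler_wpM2r ?exprn_ge0//.
by rewrite lerXn2r ?nnegrE.
Qed.

End Moments.

(** * Free independence *)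

Section StarSubalg.
Context (R : realType) (A : vnAlgebra R) (B : set A).
Hypothesis sB : star_subalg B.

Lemma subalg1 : B 1. Proof. by case: sB. Qed.
Lemma subalgM a b : B a -> B b -> B (a * b). Proof. by case: sB => _ _ + _; apply. Qed.
Lemma subalg_star a : B a -> B (star a). Proof. by case: sB => _ _ _; apply. Qed.
Lemma subalgP (c : R[i]) a b : B a -> B b -> B (c *: a + b).
Proof. by case: sB => _ + _ _; apply. Qed.
Lemma subalg0 : B 0.
Proof. by have := subalgP (-1) subalg1 subalg1; rewrite scaleN1r addNr. Qed.
Lemma subalgD a b : B a -> B b -> B (a + b).
Proof. by move=> Ba Bb; rewrite -[a]scale1r; exact: subalgP. Qed.
Lemma subalgZ (c : R[i]) a : B a -> B (c *: a).
Proof. by move=> Ba; rewrite -[c *: a]addr0; apply: subalgP => //; exact: subalg0. Qed.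
Lemma subalgB a b : B a -> B b -> B (a - b).
Proof. by move=> Ba Bb; rewrite addrC -scaleN1r; exact: subalgP. Qed.
Lemma subalgX a n : B a -> B (a ^+ n).
Proof.
move=> Ba; elim: n => [|n IH]; first by rewrite expr0; exact: subalg1.
by rewrite exprS; exact: subalgM.
Qed.
Lemma subalg_sum (I : Type) (s : seq I) (P : pred I) (F : I -> A) :
  (forall i, P i -> B (F i)) -> B (\sum_(i <- s | P i) F i).
Proof.
by move=> BF; elim/big_ind: _ => //; [exact: subalg0|exact: subalgD].
Qed.

End StarSubalg.

Section Generated.
Context (R : realType) (A : vnAlgebra R).

Lemma star_subalg_generated (G : set A) : star_subalg (smallest (@star_subalg R A) G).
Proof.
split.
- by move=> M [sM _]; exact: subalg1.
- by move=> c a b Ba Bb M GM; apply: (subalgP GM.1); [exact: Ba|exact: Bb].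
- by move=> a b Ba Bb M GM; apply: (subalgM GM.1); [exact: Ba|exact: Bb].
- by move=> a Ba M GM; apply: (subalg_star GM.1); exact: Ba.
Qed.

Lemma generated_mem (G : set A) a : G a -> smallest (@star_subalg R A) G a.
Proof. by move=> Ga M [_]; exact. Qed.

End Generated.

Section Freeness.
Context (R : realType) (A : tracialVN R).
Implicit Types (a b p q u v x : A).

Definition centered a : A := a - phi a *: 1.

Lemma phi_centered a : phi (centered a) = 0.
Proof. by rewrite /centered linearB linearZ /= phi1 mulr1 subrr. Qed.

Lemma centeredE a : a = centered a + phi a *: 1.
Proof. by rewrite /centered subrK. Qed.

Lemma subalg_centered (B : set A) a : star_subalg B -> B a -> B (centered a).
Proof. by move=> sB Ba; apply: subalgB => //; apply: subalgZ => //; exact: subalg1. Qed.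

Section Pair.
Context (B : set A) (x : A).
Hypothesis sB : star_subalg B.
Hypothesis free : freely_independent (fun b : bool => if b then [set x] else B).
Local Notation alg := (smallest (@star_subalg R A) [set x]).

Lemma free_word2 u p : B u -> alg p -> phi (u * p) = phi u * phi p.
Proof.
move=> Bu Ap.
have /(_ 1%N odd (fun k => if odd k then centered p else centered u)) := free.
rewrite big_ord_recl big_ord1 /= => h.
have {h} : phi (centered u * centered p) = 0.
  apply: h => [[|[|k]]//= _|[|k]//]; split; rewrite ?phi_centered//.
    by apply: generated_mem; exact: subalg_centered.
  exact: (subalg_centered (star_subalg_generated _) Ap).
rewrite {1}/centered mulrBl linearB -scalerAl mul1r linearZ /= phi_centered mulr0 subr0.
rewrite /centered mulrBr linearB -scalerAr mulr1 linearZ /= => /subr0_eq ->.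
by rewrite mulrC.
Qed.

(** The four letters are replaced one at a time, from the right, by their
    centered parts; the fully centered word has trace 0 by freeness, and every
    word with a scalar in place of a letter reduces to [free_word2]. *)
Lemma free_word4 u p v q : B u -> alg p -> B v -> alg q ->
  phi (u * p * v * q) = phi u * phi v * phi (q * p) +
    phi p * phi q * (phi (u * v) - phi u * phi v).
Proof.
move=> Bu Ap Bv Aq.
have sA := star_subalg_generated [set x].
have Bu' := subalg_centered sB Bu; have Bv' := subalg_centered sB Bv.
have Ap' := subalg_centered sA Ap; have Aq' := subalg_centered sA Aq.
have h0 : phi (centered u * centered p * centered v * centered q) = 0.
  have /(_ 3%N odd (fun k => nth 0 [:: centered u; centered p; centered v; centered q] k)) := free.
  rewrite !big_ord_recl big_ord0 /= mulr1 !mulrA; apply => [[|[|[|[|k]]]]//= _|[|[|[|k]]]//];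
    split; rewrite ?phi_centered//; exact: generated_mem.
have {h0} h1 : phi (centered u * centered p * centered v * q) = 0.
  rewrite (centeredE q) mulrDr linearD h0 /= add0r -scalerAr mulr1 linearZ /=.
  rewrite phi_trace mulrA free_word2 //; last exact: (subalgM sB Bv' Bu').
  by rewrite phi_centered !mulr0.
have {h1} h2 : phi (centered u * centered p * v * q) = 0.
  rewrite {1}(centeredE v) mulrDr mulrDl linearD h1 /= add0r -scalerAr mulr1.
  rewrite -scalerAl linearZ /= -mulrA free_word2 //; last exact: (subalgM sA Ap' Aq).
  by rewrite phi_centered mul0r mulr0.
have h3 : phi (centered u * p * v * q) = phi p * phi q * (phi (u * v) - phi u * phi v).
  rewrite {1}(centeredE p) mulrDr [(_ + _) * v]mulrDl [(_ + _) * q]mulrDl linearD h2 /= add0r -scalerAr mulr1.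
  rewrite -!scalerAl linearZ /= (@free_word2 (centered u * v) q) //; last exact: (subalgM sB Bu' Bv).
  rewrite /centered mulrBl linearB -scalerAl mul1r linearZ /= /GRing.scale /=; ring.
rewrite {1}(centeredE u) [(_ + _) * p]mulrDl [(_ + _) * v]mulrDl [(_ + _) * q]mulrDl linearD h3 /= addrC; congr (_ + _).
rewrite -!scalerAl mul1r linearZ /= -[_ * v * q]mulrA phi_trace -mulrA (@free_word2 v (q * p)) //; last exact: (subalgM sA Aq Ap).
Qed.

End Pair.

(** ** Words in free letters *)

Section Words.
Context (J : finType) (z : J -> A) (eps : J -> R) (M : R) (n : nat).
Hypothesis free : freely_independent (fun j => [set z j]).
Hypothesis eps01 : forall j, 0 <= eps j <= 1.
Hypothesis M0 : 0 <= M.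
Hypothesis zM : forall j e, (0 < e <= n)%N -> cabs (phi (z j ^+ e)) <= M * eps j.

(* Words are lists of powers of letters, [(j, e)] standing for [z j ^+ e]. *)
Implicit Type L : seq (J * nat).
Let pw (c : J * nat) : A := z c.1 ^+ c.2.
Let raw L : A := \prod_(c <- L) pw c.
Let cen L : A := \prod_(c <- L) centered (pw c).
Let wt L : R := \prod_(j | j \in unzip1 L) eps j.
Let ok L := all (fun c => 0 < c.2)%N L && (sumn (unzip2 L) <= n)%N.

(* The factor at [m] counts the at most [m] letters to be centered, and the
   word left after merging. *)
Fixpoint word_cst (m : nat) : R :=
  if m is m'.+1 then (1 + m%:R * M) * word_cst m' else 1.

Lemma word_cst_ge0 m : 0 <= word_cst m.
Proof. by elim: m => //= m IH; rewrite mulr_ge0// addr_ge0// mulr_ge0. Qed.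

Let wt_ge0 L : 0 <= wt L.
Proof. by apply: prodr_ge0 => j _; have /andP[] := eps01 j. Qed.

(* Inserting a letter multiplies the weight by its [eps] if it is new; otherwise
   the weight is unchanged, which is larger since [eps <= 1]. *)
Let wt_insert c L1 L2 : eps c.1 * wt (L1 ++ L2) <= wt (L1 ++ c :: L2).
Proof.
have e0 j : 0 <= eps j by have /andP[] := eps01 j.
have e1 j : eps j <= 1 by have /andP[] := eps01 j.
have [bL|bL] := boolP (c.1 \in unzip1 (L1 ++ L2)).
  rewrite [leRHS](eq_bigl (fun j => j \in unzip1 (L1 ++ L2))).
    by rewrite ler_piMl.
  move=> j; rewrite /unzip1 !map_cat /= !mem_cat inE.
  move: bL; rewrite /unzip1 map_cat mem_cat.
  by have [->|] := eqVneq j c.1; rewrite ?orbT//= => ->.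
rewrite le_eqVlt; apply/orP; left; apply/eqP.
rewrite [RHS](bigD1 c.1) /=; last first.
  by rewrite /unzip1 map_cat mem_cat /= inE eqxx orbT.
congr (_ * _); apply: eq_bigl => j.
rewrite /unzip1 !map_cat /= !mem_cat inE.
have [->|] := eqVneq j c.1; last by rewrite andbT.
by move: bL; rewrite /unzip1 map_cat mem_cat => /negbTE ->; rewrite andbF.
Qed.

Let ok_remove c L1 L2 : ok (L1 ++ c :: L2) ->
  ok (L1 ++ L2) && (0 < c.2 <= n)%N.
Proof.
rewrite /ok !all_cat /= /unzip2 !map_cat /= !sumn_cat /= => /andP[/and3P[-> -> ->]] /=.
move: (sumn _) (sumn _) => x y; lia.
Qed.

Let not_sortedP L : ~~ sorted (fun i j => i != j) (unzip1 L) ->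
  exists L1 L2 j e e', L = L1 ++ (j, e) :: (j, e') :: L2.
Proof.
elim: L => [|[j e] [|[j' e'] L] IH] //=.
rewrite negb_and negbK => /orP[/eqP <-|/IH].
  by exists [::], L, j, e, e'.
by move=> [L1 [L2 [i [k [k' ->]]]]]; exists ((j, e) :: L1), L2, i, k, k'.
Qed.

Let free_cen L : (0 < size L)%N -> sorted (fun i j => i != j) (unzip1 L) ->
  phi (cen L) = 0.
Proof.
case: L => // c0 L _ sL.
have := @free (size L) (fun k => nth c0.1 (unzip1 (c0 :: L)) k)
  (fun k => centered (pw (nth c0 (c0 :: L) k))).
rewrite /cen (big_nth c0) big_mkord; apply => k kL.
  split; rewrite ?phi_centered//.
  have E : nth c0.1 (unzip1 (c0 :: L)) k = (nth c0 (c0 :: L) k).1.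
    by rewrite (nth_map c0).
  rewrite E; have sA := star_subalg_generated [set z (nth c0 (c0 :: L) k).1].
  apply: (subalg_centered sA); apply: (subalgX sA); apply: generated_mem.
  by [].
apply/eqP; have /(sortedP c0.1) := sL; apply.
by rewrite size_map.
Qed.

(** Centering a letter of the word costs the trace of this letter times a
    shorter word, which the induction hypothesis bounds.  So the first letters
    may be centered at will: either all of them are, and the trace is 0 because
    consecutive letters differ, or none, and two equal consecutive letters
    merge into one. *)
Lemma word_bound_aux m L1 L2 : size (L1 ++ L2) = m -> ok (L1 ++ L2) ->
  cabs (phi (cen L1 * raw L2)) <= word_cst m * wt (L1 ++ L2).
Proof.
elim: m L1 L2 => [|m IH] L1 L2 sL okL.
  case: L1 L2 sL okL => // -[] // _ _.
  by rewrite /cen /raw /wt !big_nil mulr1 phi1 cabs1 big_pred0 ?mulr1.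
set L := L1 ++ L2 in sL okL *.
pose G k := phi (cen (take k L) * raw (drop k L)).
have step k : (k < m.+1)%N -> cabs (G k - G k.+1) <= M * word_cst m * wt L.
  move=> km; case: L sL okL @G km => // c0 L' sL okL G km.
  set L0 := c0 :: L' in sL okL G *.
  pose c := nth c0 L0 k; have kL : (k < size L0)%N by rewrite sL.
  have EL : L0 = take k L0 ++ c :: drop k.+1 L0 by rewrite -drop_nth ?cat_take_drop.
  have -> : G k - G k.+1 = phi (pw c) * phi (cen (take k L0) * raw (drop k.+1 L0)).
    rewrite /G (drop_nth c0)// (take_nth c0)// -/c /raw big_cons -/(raw _).
    rewrite /cen -cats1 big_cat big_seq1 /= -linearB /= -mulrA -mulrBr -mulrBl.
    by rewrite /centered opprB addrC subrK -scalerAl mul1r -scalerAr linearZ.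
  have := okL; rewrite {1}EL => /ok_remove/andP[ok' b2].
  rewrite cabsM [leRHS](_ : _ = M * (word_cst m * wt L0)); last by rewrite mulrA.
  apply: (@le_trans _ _ ((M * eps c.1) * (word_cst m * wt (take k L0 ++ drop k.+1 L0)))).
    rewrite ler_pM ?cabs_ge0 ?zM// IH//.
    rewrite size_cat size_takel ?size_drop ?sL//; last by rewrite ltnW.
    by rewrite subSS subnKC.
  rewrite -mulrA ler_wpM2l// mulrCA ler_wpM2l ?word_cst_ge0//.
  by rewrite [X in _ <= wt X]EL wt_insert.
have upto k l : (k <= l)%N -> (l <= m.+1)%N ->
    cabs (G k - G l) <= (l - k)%:R * (M * word_cst m * wt L).
  elim: l => [|l IHl]; first by rewrite leqn0 => /eqP ->; rewrite subrr cabs0 mul0r.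
  rewrite leq_eqVlt => /orP[/eqP ->|kl] lm; first by rewrite subrr cabs0 subnn mul0r.
  rewrite subSn// -natr1 mulrDl mul1r.
  have -> : G k - G l.+1 = (G k - G l) + (G l - G l.+1) by rewrite addrA subrK.
  by rewrite (le_trans (cabsD _ _))// lerD ?step ?IHl// ltnW.
have C0 : 0 <= M * word_cst m * wt L by rewrite !mulr_ge0// word_cst_ge0.
have G1 : G (size L1) = phi (cen L1 * raw L2) by rewrite /G take_size_cat// drop_size_cat.
have sL1 : (size L1 <= m.+1)%N by rewrite -sL size_cat leq_addr.
rewrite -G1 /= mulrDl mul1r mulrDl.
have [sorted_L|/not_sortedP[La [Lb [j [e [e' EL]]]]]] :=
    boolP (sorted (fun i j => i != j) (unzip1 L)).
  have := upto _ _ sL1 (leqnn _).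
  have -> : G m.+1 = 0.
    by rewrite /G -sL take_size drop_size /raw big_nil mulr1 free_cen// sL.
  rewrite subr0 => /le_trans; apply.
  rewrite -[leLHS]add0r lerD ?mulr_ge0 ?word_cst_ge0//.
  rewrite -!mulrA ler_wpM2r ?ler_nat ?leq_subr// ?mulr_ge0 ?word_cst_ge0//.
have G0 : cabs (G 0) <= word_cst m * wt L.
  have sL' : size ([::] ++ (La ++ (j, e + e')%N :: Lb)) = m.
    by apply/eqP; rewrite -eqSS -sL EL !size_cat /= !addnS.
  have := IH [::] (La ++ (j, (e + e')%N) :: Lb) sL'.
  have -> : wt ([::] ++ (La ++ (j, e + e')%N :: Lb)) = wt L.
    apply: eq_bigl => i; rewrite EL /= /unzip1 !map_cat !mem_cat /= !inE.
    by case: (i == j); rewrite ?orbT /=.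
  rewrite /G take0 drop0 EL /cen /raw !big_nil !mul1r !big_cat !big_cons /= !mulrA.
  have -> : pw (j, (e + e')%N) = pw (j, e) * pw (j, e') by rewrite /pw exprD.
  rewrite !mulrA; apply.
  move: okL; rewrite EL /ok /unzip2 !all_cat !map_cat !sumn_cat /=.
  by move: (sumn _) (sumn _) => ? ?; move: (all _ _) (all _ _) => [] [] //=; lia.
have := upto _ _ (leq0n (size L1)) sL1; rewrite subn0 => h.
have -> : G (size L1) = G 0 - (G 0 - G (size L1)) by rewrite opprB addrC subrK.
rewrite (le_trans (cabsD _ _))// cabsN lerD// (le_trans h)//.
by rewrite -!mulrA ler_wpM2r ?ler_nat// ?mulr_ge0 ?word_cst_ge0.
Qed.

(** A word is small of the order of the product of the sizes of the distinct
    letters in it. *)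
Lemma word_bound (w : seq J) : (size w <= n)%N ->
  cabs (phi (\prod_(j <- w) z j)) <= word_cst (size w) * \prod_(j | j \in w) eps j.
Proof.
move=> wn; have := @word_bound_aux (size w) [::] [seq (j, 1%N) | j <- w].
rewrite /= size_map /cen big_nil mul1r /raw big_map /wt /unzip1 -map_comp map_id_in//.
under eq_bigr do rewrite /pw /= expr1.
apply => //; rewrite /ok all_map; apply/andP; split; first exact/allP.
rewrite /unzip2 -map_comp sumnE big_map big_const_seq count_predT iter_addn_0.
by rewrite /= mul1n.
Qed.

End Words.
End Freeness.

(** * Filtrations and almost orthogonal sums *)

Section Filtered.
Context (R : realType) (A : tracialVN R) (L2 : L2_space A) (At : R -> set A).
Hypothesis fil : filtration At.
Local Notation n2 a := (hnorm (toL2 L2 a)).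

Lemma filtration_sub t : 0 <= t -> star_subalg (At t).
Proof. by case: fil => + _ t0 => /(_ _ t0) []. Qed.

Lemma filtration_le s t a : 0 <= s -> s <= t -> At s a -> At t a.
Proof. by case: fil => _ h s0 st; exact: (h _ _ s0 st). Qed.

Lemma n2D_sqr (a b : A) :
  n2 (a + b) ^+ 2 = n2 a ^+ 2 + n2 b ^+ 2 + 2 * complex.Re (phi (star a * b)).
Proof. by rewrite linearD hnormD_sqr hdotC toL2_dot cRe_conj. Qed.

(** Each term is nearly orthogonal to the algebra at the beginning of its cell,
    hence to the sum of the earlier terms.  The cross terms of the squared norm
    involve the norms of the partial sums, for which the bound is proved at the
    same time. *)
Lemma almost_orthogonal_sum (t : nat -> R) (w : nat -> A) (k s : nat -> R) (n : nat) :
  0 <= t 0%N -> {homo t : i j / (i <= j)%N >-> i <= j} ->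
  (forall q, (q < n)%N -> At (t q.+1) (w q)) ->
  (forall q u, (q < n)%N -> At (t q) u -> cabs (phi (star u * w q)) <= k q * n2 u) ->
  (forall q, (q < n)%N -> n2 (w q) ^+ 2 <= s q) ->
  (forall q, (q < n)%N -> 0 <= k q) ->
  n2 (\sum_(q < n) w q) <= 2 * \sum_(q < n) k q + Num.sqrt (\sum_(q < n) s q).
Proof.
move=> t0 mono wA kP sP k0.
set K := \sum_(q < n) k q; set S := \sum_(q < n) s q.
have s0 q : (q < n)%N -> 0 <= s q by move=> qn; rewrite (le_trans _ (sP _ qn))// sqr_ge0.
have K0 : 0 <= K by apply: sumr_ge0 => q _; rewrite k0.
have S0 : 0 <= S by apply: sumr_ge0 => q _; rewrite s0.
pose D := 2 * K + Num.sqrt S; have D0 : 0 <= D by rewrite addr_ge0 ?mulr_ge0 ?sqrtr_ge0.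
have sumA q : (q <= n)%N -> At (t q) (\sum_(l < q) w l).
  move=> qn; have tq : 0 <= t q by rewrite (le_trans t0) ?mono.
  apply: (subalg_sum (filtration_sub tq)) => l _.
  apply: (@filtration_le (t l.+1)); last by apply: wA; exact: leq_trans (ltn_ord l) qn.
    by rewrite (le_trans t0) ?mono.
  by rewrite mono.
have key q : (q <= n)%N -> n2 (\sum_(l < q) w l) <= D /\
    n2 (\sum_(l < q) w l) ^+ 2 <= \sum_(l < q) s l + 2 * D * \sum_(l < q) k l.
  elim: q => [_|q IH qn]; first by rewrite !big_ord0 linear0 hnorm0 expr0n mulr0 addr0.
  have [IH1 IH2] := IH (ltnW qn).
  have h : n2 (\sum_(l < q.+1) w l) ^+ 2 <=
      \sum_(l < q.+1) s l + 2 * D * \sum_(l < q.+1) k l.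
    rewrite !big_ord_recr /= n2D_sqr mulrDr.
    have h1 := le_trans (Re_le_cabs _) (kP _ _ qn (sumA _ (ltnW qn))).
    have h2 := sP _ qn; have h3 : k q * n2 (\sum_(l < q) w l) <= k q * D.
      by rewrite ler_wpM2l ?k0.
    lra.
  split=> //.
  rewrite -(@ler_pXn2r _ 2) ?nnegrE ?hnorm_ge0//; apply: (le_trans h).
  have le_sum (f : nat -> R) : (forall l, (l < n)%N -> 0 <= f l) ->
      \sum_(l < q.+1) f l <= \sum_(l < n) f l.
    move=> f0; rewrite -(subnKC qn) big_split_ord /= lerDl sumr_ge0// => l _.
    by rewrite f0// -[X in (_ < X)%N](subnKC qn) ltn_add2l.
  have hs := le_sum s s0; have hk := le_sum k k0.
  have hk' : 2 * D * \sum_(l < q.+1) k l <= 2 * D * K by rewrite ler_wpM2l ?mulr_ge0.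
  apply: (@le_trans _ _ (S + 2 * D * K)); first exact: lerD.
  have := sqr_sqrtr S0; rewrite /D; have := sqrtr_ge0 S; move: (Num.sqrt S) => g.
  move: K0 => K0 g0 <-; have := mulr_ge0 K0 g0; have := sqr_ge0 K; nra.
by have [] := key n (leqnn n).
Qed.

(** A von Neumann subalgebra is its own bicommutant, and commuting with a given
    operator is preserved by norm limits. *)
Lemma vn_subalg_closed (B : set A) (y : nat -> A) (l : A) : vn_subalg B ->
  (forall n, B (y n)) -> opnorm (y n - l) @[n --> \oo] --> (0 : R) -> B l.
Proof.
move=> [_ bB] By yl.
suff: (vn_rep @` B) (vn_rep l) by case=> b Bb /vn_rep_inj <-.
rewrite -bB; split; first exact: vn_rep_bounded.
move=> T [[linT [M TM]] Tc]; apply/funext => x /=.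
apply/subr0_eq/hnorm_eq0/eqP; rewrite eq_le hnorm_ge0 andbT.
have T_B u v : T (u - v) = T u - T v.
  have T0 : T 0 = 0 by have := linT (-1) 0 0; rewrite scaler0 addr0 scaleN1r addNr.
  by have := linT (-1) v u; rewrite !scaleN1r [- v + u]addrC => ->; rewrite addrC.
pose e n := opnorm (y n - l).
apply: (cvg0_eq (f := fun n => e n * hnorm (T x) + `|M| * (e n * hnorm x))); last first.
  rewrite -[0]addr0; apply: cvgD.
    by rewrite -[0](mul0r (hnorm (T x))); exact: cvgMr_tmp.
  rewrite -[0](mulr0 `|M|); apply: cvgMl_tmp.
  by rewrite -[0](mul0r (hnorm x)); exact: cvgMr_tmp.
move=> n.
have Tyn : vn_rep (y n) (T x) = T (vn_rep (y n) x).
  have /(_ (vn_rep (y n))) := Tc; move=> /(_ _)/(congr1 (fun f => f x)) /= <- //.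
  by exists (y n).
have -> : vn_rep l (T x) - T (vn_rep l x) =
    T (vn_rep (y n - l) x) - vn_rep (y n - l) (T x).
  by rewrite !vn_repB T_B Tyn opprB [RHS]addrC addrA subrK.
rewrite (le_trans (hnorm_triangleB _ _))// addrC lerD//; first exact: opnormP.
rewrite (le_trans (TM _))//; apply: (@le_trans _ _ (`|M| * hnorm (vn_rep (y n - l) x))).
  by rewrite ler_wpM2r ?hnorm_ge0 ?ler_norm.
by rewrite ler_wpM2l// opnormP.
Qed.

End Filtered.

(** * Powers of sums of free elements *)

Lemma ler_sum_const (R : realType) (I : eqType) (S : seq I) (F : I -> R) (C : R) :
  (forall i, i \in S -> F i <= C) -> \sum_(i <- S) F i <= (size S)%:R * C.
Proof.
move=> FC; rewrite big_seq (le_trans (ler_sum _ FC))// -big_seq.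
by rewrite big_const_seq count_predT iter_addr_0 mulr_natl.
Qed.

Section PowersOfSums.
Context (R : realType) (A : tracialVN R).
Context (J : finType) (z : J -> A).

Fixpoint words (s : seq J) (k : nat) : seq (seq J) :=
  if k is k'.+1 then [seq j :: w | j <- s, w <- words s k'] else [:: [::]].

Lemma size_words s k : size (words s k) = (size s ^ k)%N.
Proof. by elim: k => //= k IH; rewrite size_allpairs IH expnS. Qed.

Lemma words_size s k w : w \in words s k -> size w = k.
Proof.
elim: k w => [|k IH] w /=; first by rewrite inE => /eqP ->.
by case/allpairsP => -[j w'] /= [_ /IH <- ->].
Qed.

Lemma sum_powX (s : seq J) (P : pred J) k :
  (\sum_(j <- s | P j) z j) ^+ k =
  \sum_(w <- words s k | all P w) \prod_(j <- w) z j.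
Proof.
elim: k => [|k IH]; first by rewrite expr0 big_cons /= !big_nil addr0.
rewrite exprS IH mulr_suml /= [RHS]big_mkcond big_allpairs_dep /= big_mkcond /=.
apply: eq_bigr => j _; case: ifP => Pj; last by rewrite big1.
rewrite mulr_sumr big_mkcond /=; apply: eq_bigr => w _.
by rewrite big_cons.
Qed.

Context (eps : J -> R) (M : R) (k : nat).
Hypothesis free : freely_independent (fun j => [set z j]).
Hypothesis eps01 : forall j, 0 <= eps j <= 1.
Hypothesis M0 : 0 <= M.
Hypothesis zM : forall j e, (0 < e <= k + k)%N -> cabs (phi (z j ^+ e)) <= M * eps j.

(** Words without [v] and powers of [v] cancel, so only the words containing [v]
    together with another letter remain, and these are bounded by
    [word_bound]. *)
Lemma powers_of_sums (s t : seq J) (v : J) (d : R) : (0 < k)%N ->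
  (forall j, eps j <= d) ->
  cabs (phi ((\sum_(j <- s) z j) ^+ k * (\sum_(j <- t) z j) ^+ k)
    - phi ((\sum_(j <- s | j != v) z j) ^+ k * (\sum_(j <- t | j != v) z j) ^+ k)
    - phi ((\sum_(j <- s | j == v) z j) ^+ k * (\sum_(j <- t | j == v) z j) ^+ k))
  <= (size s ^ k * size t ^ k)%:R * (word_cst M (k + k) * (eps v * d)).
Proof.
move=> k0 epsd.
have d0 : 0 <= d by have /andP[e0 _] := eps01 v; exact: le_trans (epsd v).
pose f w w' := phi (\prod_(j <- w ++ w') z j).
have E (P : pred J) :
    phi ((\sum_(j <- s | P j) z j) ^+ k * (\sum_(j <- t | P j) z j) ^+ k) =
    \sum_(w <- words s k) \sum_(w' <- words t k) (all P (w ++ w'))%:R * f w w'.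
  rewrite !sum_powX mulr_suml linear_sum big_mkcond /=; apply: eq_bigr => w _.
  case: ifP => Pw; last first.
    by rewrite big1// => w' _; rewrite all_cat Pw mul0r.
  rewrite mulr_sumr linear_sum big_mkcond /=; apply: eq_bigr => w' _.
  by rewrite all_cat Pw /f big_cat /=; case: ifP; rewrite ?mul1r ?mul0r.
rewrite (E xpredT) (E (fun j => j != v)) (E (fun j => j == v)) -!sumrB.
under eq_bigr do rewrite -!sumrB.
set K := word_cst M (k + k) * (eps v * d).
have K0 : 0 <= K.
  by rewrite mulr_ge0 ?word_cst_ge0// mulr_ge0//; have /andP[] := eps01 v.
have term w w' : w \in words s k -> w' \in words t k ->
    cabs ((all xpredT (w ++ w'))%:R * f w w' - (all (fun j => j != v) (w ++ w'))%:R * f w w'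
     - (all (fun j => j == v) (w ++ w'))%:R * f w w') <= K.
  move=> /words_size ws /words_size ws'.
  have sW : size (w ++ w') = (k + k)%N by rewrite size_cat ws ws'.
  set W := w ++ w' in sW *.
  have W0 : W != [::] by rewrite -size_eq0 sW addn_eq0 negb_and -lt0n k0.
  rewrite all_predT mul1r.
  have [h1|/allPn[j1 j1W /negPn/eqP j1v]] := boolP (all (fun j => j != v) W).
    have -> : all (fun j => j == v) W = false.
      by case: {sW} W W0 h1 => //= j W _ /andP[/negbTE -> _].
    by rewrite mul1r mul0r subr0 subrr cabs0.
  have [h2|/allPn[j2 j2W j2v]] := boolP (all (fun j => j == v) W).
    by rewrite mul1r mul0r subr0 subrr cabs0.
  rewrite !mul0r !subr0.
  have := @word_bound R A J z eps M (k + k) free eps01 M0 zM W.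
  rewrite sW leqnn => /(_ isT)/le_trans; apply.
  rewrite ler_wpM2l ?word_cst_ge0// (bigD1 v) /=; last by rewrite -j1v.
  have e0 j : 0 <= eps j by have /andP[] := eps01 j.
  rewrite ler_wpM2l// (bigD1 j2) /=; last by rewrite j2W.
  rewrite -[leRHS]mulr1 ler_pM//; first by apply: prodr_ge0.
  by apply: prodr_ile1 => j _.
rewrite (le_trans (cabs_sum _ _ _))//.
rewrite natrM -!size_words -mulrA; apply: ler_sum_const => w ws.
rewrite (le_trans (cabs_sum _ _ _))//; apply: ler_sum_const => w' ws'.
exact: term.
Qed.

End PowersOfSums.

(** * Free stochastic measures and their diagonals *)

(** For sums over the cells of a partition the diagonal and the two triangles of
    the double sum are of different nature: powers of one increment, and products
    of a past element and an increment. *)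
Lemma product_of_sums (A : pzRingType) (x y : nat -> A) (c : A) (N : nat) :
  (\sum_(q < N) x q) * c * (\sum_(q < N) y q) =
  \sum_(q < N) x q * c * y q + \sum_(q < N) (\sum_(l < q) x l) * c * y q +
  \sum_(q < N) x q * c * (\sum_(l < q) y l).
Proof.
elim: N => [|N IH]; first by rewrite !big_ord0 !mul0r !addr0.
rewrite !big_ord_recr /= !mulrDl !mulrDr IH.
have regroup (D E F a b d : A) : D + E + F + a + (b + d) = D + d + (E + a) + (F + b).
  rewrite (addrACA D d E a) (addrACA (D + E) (d + a) F b) -[LHS]addrA.
  by congr (_ + _); rewrite [LHS]addrA [LHS]addrC addrA.
exact: regroup.
Qed.

Section StochasticMeasure.
Context (R : realType) (A : tracialVN R) (L2 : L2_space A) (At : R -> set A).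
Context (mu_ : R -> probability (measurableTypeR R) R).
Context (X : set R -> A) (mom : nat -> R -> R) (c_ : nat -> R).
Hypothesis fil : filtration At.
Hypothesis fsmX : free_stochastic_measure At mu_ X.
Local Notation n2 a := (hnorm (toL2 L2 a)).
Local Notation incr a b := (X `[a, b[%classic).
(* [mom k h] is the k-th moment of the increments over intervals of length [h],
   and [c_ k] its derivative at 0. *)
Hypothesis phi_incrX : forall a b k, 0 <= a -> a <= b ->
  phi (incr a b ^+ k) = (mom k (b - a))%:C.
Hypothesis mom_linear : forall (k : nat) (H : R), (0 < k)%N -> 0 <= H ->
  exists2 C : R, 0 <= C & forall t, 0 <= t <= H ->
    `|mom k t - t * c_ k| <= C * t ^+ 2.

Lemma half_open_itv (a b : R) : 0 <= a -> a <= b -> half_open `[a, b[%classic.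
Proof. by move=> a0 ab; exists a, b. Qed.

Lemma incrD a b c : 0 <= a -> a <= b -> b <= c -> incr a b + incr b c = incr a c.
Proof.
move=> a0 ab bc.
have E : `[a, b[%classic `|` `[b, c[%classic = `[a, c[%classic.
  apply/seteqP; split => x /=; rewrite !in_itv /=.
    by case=> /andP[h1 h2]; apply/andP; split; lra.
  by move=> /andP[h1 h2]; have [xb|xb] := ltP x b; [left|right]; rewrite ?h1 ?h2.
rewrite -E; apply: (fsm_additive fsmX).
- exact: half_open_itv.
- by apply: half_open_itv => //; exact: le_trans ab.
- apply/seteqP; split => x //=; rewrite !in_itv /= => -[/andP[h1 h2] /andP[h3 h4]].
  by move: (lt_le_trans h2 h3); rewrite ltxx.
- by rewrite E; apply: half_open_itv => //; exact: le_trans bc.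
Qed.

Lemma incr_star a b : 0 <= a -> a <= b -> star (incr a b) = incr a b.
Proof. by move=> a0 ab; apply: (fsm_selfadjoint fsmX); exact: half_open_itv. Qed.

Lemma incr_adapted a b t : 0 <= a -> a <= b -> b <= t -> At t (incr a b).
Proof.
move=> a0 ab bt; apply: (fsm_adapted fsmX); first exact: half_open_itv.
  by rewrite (le_trans a0)// (le_trans ab).
by move=> x /=; rewrite !in_itv /= => /andP[h1 h2]; apply/andP; split; lra.
Qed.

Lemma incr_free a b t : 0 <= t -> t <= a -> a <= b ->
  freely_independent (fun c : bool => if c then [set incr a b] else At t).
Proof.
move=> t0 ta ab; apply: (fsm_free_past fsmX) => //.
  by apply: half_open_itv => //; exact: le_trans ta.
apply/seteqP; split => x //=; rewrite !in_itv /= => -[/andP[h1 h2] /andP[h3 h4]].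
by have := lt_le_trans h4 (le_trans ta h1); rewrite ltxx.
Qed.

Let alg_incrX a b k : smallest (@star_subalg R A) [set incr a b] (incr a b ^+ k).
Proof.
apply: (subalgX (star_subalg_generated _)).
exact: generated_mem.
Qed.

Lemma phi_past_incrX t a b k u : 0 <= t -> t <= a -> a <= b -> At t u ->
  phi (u * incr a b ^+ k) = (mom k (b - a))%:C * phi u.
Proof.
move=> t0 ta ab Au; rewrite (free_word2 (filtration_sub fil t0) (incr_free t0 ta ab))//.
by rewrite phi_incrX ?(le_trans t0)//; exact: mulrC.
Qed.

(** Summed over the cells of a partition this becomes [ito_covariance] in the
    limit. *)
Lemma phi_past_incrX2 t a b i j u v : 0 <= t -> t <= a -> a <= b ->
  At t u -> At t v ->
  phi (u * incr a b ^+ i * v * incr a b ^+ j) =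
    (mom (i + j) (b - a))%:C * (phi u * phi v) +
    (mom i (b - a) * mom j (b - a))%:C * (phi (u * v) - phi u * phi v).
Proof.
move=> t0 ta ab Au Av.
rewrite (free_word4 (filtration_sub fil t0) (incr_free t0 ta ab))//.
by rewrite -exprD !phi_incrX ?(le_trans t0)// addnC rmorphM /= mulrC.
Qed.

(** ** Uniform partitions *)

Definition upt (a b : R) (N l : nat) : R := a + l%:R / N%:R * (b - a).

Lemma upt_mono a b N : a <= b -> {homo upt a b N : i j / (i <= j)%N >-> i <= j}.
Proof.
move=> ab i j ij; rewrite lerD2l ler_wpM2r ?subr_ge0// ler_wpM2r ?invr_ge0//.
by rewrite ler_nat.
Qed.

Lemma upt0 a b N : upt a b N 0 = a.
Proof. by rewrite /upt !mul0r addr0. Qed.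

Lemma uptN a b N : upt a b N.+1 N.+1 = b.
Proof. by rewrite /upt divff// mul1r addrC subrK. Qed.

Lemma upt_ge a b N l : a <= b -> a <= upt a b N l.
Proof. by move=> ab; rewrite -{1}(upt0 a b N) upt_mono. Qed.

Lemma uptS a b N l : upt a b N l.+1 - upt a b N l = (b - a) / N%:R.
Proof. rewrite /upt -natr1; ring. Qed.

Lemma upt_step a b N l : a <= b -> upt a b N l <= upt a b N l.+1.
Proof. by move=> ab; exact: upt_mono. Qed.

Local Notation x_ a b N l := (incr (upt a b N l) (upt a b N l.+1)).

Lemma diagonal_sumE k a b N :
  diagonal_sum X k a b N = \sum_(l < N) x_ a b N l ^+ k.
Proof. by []. Qed.

Lemma mom_bound (n : nat) (H : R) : 0 <= H -> exists2 B : R, 0 <= B &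
  forall k h, (0 < k <= n)%N -> 0 <= h <= H -> `|mom k h| <= B * h.
Proof.
move=> H0; elim: n => [|n [B B0 IH]].
  by exists 0 => // -[|k] h /andP[].
have [C C0 hC] := mom_linear (ltn0Sn n) H0.
exists (B + `|c_ n.+1| + C * H); first by rewrite !addr_ge0// mulr_ge0.
move=> k h /andP[k0]; rewrite leq_eqVlt => /orP[/eqP ->|kn] hH; last first.
  rewrite (le_trans (IH k h _ hH)) ?k0//; have /andP[h0 _] := hH.
  by rewrite ler_wpM2r// -addrA lerDl addr_ge0// mulr_ge0.
have /andP[h0 h1] := hH; have := hC h hH => h2.
have -> : mom n.+1 h = h * c_ n.+1 + (mom n.+1 h - h * c_ n.+1) by rewrite addrC subrK.
rewrite (le_trans (ler_normD _ _))// normrM (ger0_norm h0).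
have : C * h ^+ 2 <= C * H * h by rewrite expr2 mulrA ler_wpM2r// ler_wpM2l.
have := mulr_ge0 B0 h0; move: (mom n.+1 h - _) h2 => z; lra.
Qed.

Lemma mom_limit k (L : R) : (0 < k)%N -> 0 <= L ->
  N.+1%:R * mom k (L / N.+1%:R) @[N --> \oo] --> c_ k * L.
Proof.
move=> k0 L0; have [C C0 hC] := mom_linear k0 L0.
apply/subr_cvg0/norm_cvg0P.
apply: (cvg0_le (g := fun N => C * L ^+ 2 * N.+1%:R^-1)) => [N|]; last first.
  rewrite -[0](mulr0 (C * L ^+ 2)); apply: cvgMl_tmp; exact: cvg_harmonic.
rewrite normr_ge0 /=.
have h : 0 <= L / N.+1%:R <= L.
  by rewrite mulr_ge0//= ler_pdivrMr// ler_peMr// ler1n.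
have := hC _ h; set m := mom _ _ => hm.
have -> : N.+1%:R * m - c_ k * L = N.+1%:R * (m - L / N.+1%:R * c_ k).
  by rewrite mulrBr mulrA [_ * (L / _)]mulrC divfK// [L * _]mulrC.
rewrite normrM ger0_norm// (le_trans (ler_wpM2l _ hm))//.
by rewrite expr_div_n expr2 [_%:R ^+ 2]expr2 invfM !mulrA; rewrite le_eqVlt; apply/orP; left;
  apply/eqP; field.
Qed.

Lemma upt_pos a b N l : 0 <= a -> a <= b -> 0 <= upt a b N l.
Proof. by move=> a0 ab; rewrite (le_trans a0)// upt_ge. Qed.

Lemma cell_adapted a b N l l' k : 0 <= a -> a <= b -> (l < l')%N ->
  At (upt a b N l') (x_ a b N l ^+ k).
Proof.
move=> a0 ab ll'; apply: (subalgX (filtration_sub fil (upt_pos _ _ a0 ab))).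
by apply: incr_adapted; [exact: upt_pos|exact: upt_step|exact: upt_mono].
Qed.

Lemma phi_past_cell a b N l k u : 0 <= a -> a <= b -> At (upt a b N l) u ->
  phi (u * x_ a b N l ^+ k) = (mom k ((b - a) / N%:R))%:C * phi u.
Proof.
move=> a0 ab Au; rewrite (phi_past_incrX _ _ _ _ Au) ?uptS ?upt_pos//.
exact: upt_step.
Qed.

Lemma past_le a b N l u : 0 <= a -> a <= b -> At a u -> At (upt a b N l) u.
Proof. by move=> a0 ab; apply: filtration_le => //; exact: upt_ge. Qed.

(* The later cell is free from everything else, then the earlier one is. *)
Let phi_cells_lt a b N l l' i j u v : 0 <= a -> a <= b -> At a u -> At a v ->
  (l < l')%N -> phi (u * x_ a b N l ^+ i * v * x_ a b N l' ^+ j) =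
  (mom i ((b - a) / N%:R) * mom j ((b - a) / N%:R))%:C * phi (u * v).
Proof.
move=> a0 ab Au Av ll'.
have sB := filtration_sub fil (upt_pos N l' a0 ab).
rewrite phi_past_cell//; last first.
  apply: (subalgM sB); last exact: past_le.
  by apply: (subalgM sB); [exact: past_le|exact: cell_adapted].
rewrite phi_trace mulrA phi_past_cell//; last first.
  by apply: past_le => //; exact: (subalgM (filtration_sub fil a0)).
by rewrite [phi (v * u)]phi_trace mulrA -rmorphM mulrC [X in X%:C]mulrC mulrC.
Qed.

Lemma phi_cells a b N l l' i j u v : 0 <= a -> a <= b -> At a u -> At a v ->
  phi (u * x_ a b N l ^+ i * v * x_ a b N l' ^+ j) =
  (mom i ((b - a) / N%:R) * mom j ((b - a) / N%:R))%:C * phi (u * v) +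
  (l == l')%:R * ((mom (i + j) ((b - a) / N%:R) -
     mom i ((b - a) / N%:R) * mom j ((b - a) / N%:R))%:C * (phi u * phi v)).
Proof.
move=> a0 ab Au Av; have [ll'|l'l|<-] := ltngtP l l'.
- by rewrite mul0r addr0 phi_cells_lt.
- rewrite mul0r addr0 -mulrA phi_trace mulrA phi_cells_lt//.
  by rewrite phi_trace [X in X%:C]mulrC.
- rewrite (@phi_past_incrX2 (upt a b N l)) ?upt_pos ?upt_step//.
  + by rewrite uptS mul1r rmorphB /=; ring.
  + exact: past_le.
  + exact: past_le.
Qed.

Lemma phi_diagonal_sum a b N k u : 0 <= a -> a <= b -> At a u ->
  phi (u * diagonal_sum X k a b N) = (N%:R * mom k ((b - a) / N%:R))%:C * phi u.
Proof.
move=> a0 ab Au; rewrite diagonal_sumE mulr_sumr linear_sum /=.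
under eq_bigr do rewrite (phi_past_cell _ _ _ (past_le _ _ a0 ab Au))//.
by rewrite sumr_const card_ord -[LHS]mulr_natl mulrA rmorphM /= rmorph_nat.
Qed.

Lemma phi_diagonal_sum2 a b N i j u v : 0 <= a -> a <= b -> At a u -> At a v ->
  let h := (b - a) / N%:R in
  phi (u * diagonal_sum X i a b N * v * diagonal_sum X j a b N) =
  (N%:R * mom i h * (N%:R * mom j h))%:C * phi (u * v) +
  (N%:R * mom (i + j) h - N%:R * mom i h * mom j h)%:C * (phi u * phi v).
Proof.
move=> a0 ab Au Av h; rewrite !diagonal_sumE.
have -> : u * (\sum_(l < N) x_ a b N l ^+ i) * v * (\sum_(l < N) x_ a b N l ^+ j) =
    \sum_(l < N) \sum_(l' < N) u * x_ a b N l ^+ i * v * x_ a b N l' ^+ j.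
  rewrite [u * _]mulr_sumr !mulr_suml; apply: eq_bigr => l _.
  by rewrite mulr_sumr.
rewrite linear_sum /=.
under eq_bigr do rewrite linear_sum /=.
under eq_bigr => l _ do under eq_bigr => l' _ do rewrite phi_cells// -/h.
have E (z w : R[i]) : \sum_(l < N) \sum_(l' < N) (z + (l == l' :> nat)%:R * w) =
    N%:R * N%:R * z + N%:R * w.
  have E1 (l : 'I_N) : \sum_(l' < N) (z + (l == l' :> nat)%:R * w) = N%:R * z + w.
    rewrite big_split /= sumr_const card_ord -[z *+ N]mulr_natl; congr (_ + _).
    rewrite (bigD1 l) //= eqxx mul1r big1 ?addr0// => l' /negbTE.
    by rewrite -val_eqE eq_sym => ->; rewrite mul0r.
  under eq_bigr do rewrite E1.
  by rewrite sumr_const card_ord -[LHS]mulr_natl mulrDr mulrA.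
rewrite E; set m1 := mom i h; set m2 := mom j h; set m3 := mom (i + j) h.
rewrite !(rmorphM, rmorphB, rmorph_nat) /=; ring.
Qed.

(** ** Powers of increments over two intervals *)

Definition overlap (a b c d : R) : R := Num.max 0 (Num.min b d - Num.max a c).

Lemma overlapC a b c d : overlap a b c d = overlap c d a b.
Proof. by rewrite /overlap [Num.min b d]minC [Num.max a c]maxC. Qed.

(** The overlap with [c, d) is the increment of the projection onto [c, d], so
    it is additive in [a, b). *)
Lemma overlap_clamp a b c d : a <= b -> c <= d ->
  overlap a b c d = Num.min (Num.max b c) d - Num.min (Num.max a c) d.
Proof.
move=> ab cd; rewrite /overlap.
by case: (leP a c) => h1; case: (leP b d) => h2; case: (leP b c) => h3;
  rewrite /Num.max /Num.min /Order.max /Order.min;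
  repeat (case: ifP => /idP; [|move/negP; rewrite -leNgt]); move=> *; lra.
Qed.

Lemma sum_overlap (t : nat -> R) n c d : (forall l, t l <= t l.+1) -> c <= d ->
  \sum_(l < n) overlap (t l) (t l.+1) c d = overlap (t 0%N) (t n) c d.
Proof.
move=> tS cd; pose g x := Num.min (Num.max x c) d.
have mono : {homo t : i j / (i <= j)%N >-> i <= j}.
  by apply: homo_leq => //; exact: le_trans.
rewrite overlap_clamp ?mono//.
under eq_bigr do rewrite overlap_clamp//.
by rewrite -(big_mkord xpredT (fun l => g (t l.+1) - g (t l))) telescope_sumr.
Qed.

(** [powers_of_sums] for the increments over three consecutive intervals of
    total length at most [H], with the lengths divided by [H] as sizes of the
    letters. *)
Lemma three_increments k (H : R) : (0 < k)%N -> 0 < H ->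
  exists2 K : R, 0 <= K & forall (p : nat -> R) (s t : seq 'I_3) (v : 'I_3) (d : R),
    let z (j : 'I_3) := incr (p j) (p j.+1) in
    0 <= p 0%N -> (forall l, p l <= p l.+1) -> p 3%N <= H ->
    (size s <= 3)%N -> (size t <= 3)%N -> (forall j : 'I_3, p j.+1 - p j <= d) ->
    cabs (phi ((\sum_(j <- s) z j) ^+ k * (\sum_(j <- t) z j) ^+ k)
      - phi ((\sum_(j <- s | j != v) z j) ^+ k * (\sum_(j <- t | j != v) z j) ^+ k)
      - phi ((\sum_(j <- s | j == v) z j) ^+ k * (\sum_(j <- t | j == v) z j) ^+ k))
    <= K * ((p v.+1 - p v) * d).
Proof.
move=> k0 H0; have [B B0 hB] := mom_bound (k + k) (ltW H0).
exists ((3 ^ k * 3 ^ k)%:R * word_cst (B * H) (k + k) / H ^+ 2).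
  by rewrite divr_ge0 ?sqr_ge0// mulr_ge0// word_cst_ge0// mulr_ge0// ltW.
move=> p s t v d z p0 pS p3 s3 t3 pd.
have mono : {homo p : i j / (i <= j)%N >-> i <= j}.
  by apply: homo_leq => //; exact: le_trans.
have pge i : 0 <= p i by rewrite (le_trans p0)// mono.
have len (j : 'I_3) : 0 <= p j.+1 - p j <= H.
  rewrite subr_ge0 pS /=; have := pge j; have := le_trans (mono _ _ (ltn_ord j)) p3; lra.
pose eps (j : 'I_3) := (p j.+1 - p j) / H.
have free : freely_independent (fun j => [set z j]).
  apply: (fsm_free_increments fsmX) => [j|i j ij]; first exact: half_open_itv.
  apply/seteqP; split => x //=; rewrite !in_itv /= => -[/andP[h1 h2] /andP[h3 h4]].
  have [ij'|ji'|/val_inj e] := ltngtP i j; last by rewrite e eqxx in ij.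
    by have := mono _ _ ij'; have := lt_le_trans h2 (le_trans (mono _ _ ij') h3); rewrite ltxx.
  by have := lt_le_trans h4 (le_trans (mono _ _ ji') h1); rewrite ltxx.
have eps01 j : 0 <= eps j <= 1.
  have /andP[h1 h2] := len j.
  by rewrite divr_ge0 ?(ltW H0)//= ler_pdivrMr// mul1r.
have zM (j : 'I_3) e : (0 < e <= k + k)%N -> cabs (phi (z j ^+ e)) <= B * H * eps j.
  move=> he; rewrite phi_incrX ?pge// cabs_real (le_trans (hB _ _ he (len j)))//.
  by rewrite /eps -mulrA [H * _]mulrC divfK ?gt_eqF.
have BH0 : 0 <= B * H := mulr_ge0 B0 (ltW H0).
have epsd j : eps j <= d / H by rewrite ler_wpM2r ?invr_ge0 ?(ltW H0)// pd.
have h := powers_of_sums free eps01 BH0 zM s t v k0 epsd.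
apply: (le_trans h).
have d0 : 0 <= d by have /andP[h1 _] := len v; exact: le_trans h1 (pd v).
have -> : (3 ^ k * 3 ^ k)%:R * word_cst (B * H) (k + k) / H ^+ 2 * ((p v.+1 - p v) * d) =
    (3 ^ k * 3 ^ k)%:R * (word_cst (B * H) (k + k) * (eps v * (d / H))).
  by rewrite /eps; field; rewrite gt_eqF.
apply: ler_wpM2r.
  rewrite mulr_ge0 ?word_cst_ge0// mulr_ge0//; first by have /andP[] := eps01 v.
  by rewrite divr_ge0 ?(ltW H0).
by rewrite ler_nat leq_mul// leq_exp2r.
Qed.

(* [u], [v], [w] are the lengths of the three consecutive pieces of two
   overlapping intervals, of lengths [u + v] and [v + w]. *)
Lemma overlap_estimates (u v w : R) : 0 <= u -> 0 <= v -> 0 <= w ->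
  [/\ 0 <= (u + v) * (v + w) - w * u,
      (u + v) * (v + w) - w * u <= v * ((u + v) + (v + w)),
      w * u * (w + u) <= (u + v) * (v + w) * ((u + v) + (v + w)) &
      v ^+ 2 <= v * ((u + v) + (v + w))].
Proof.
move=> u0 v0 w0.
have uv := mulr_ge0 u0 v0; have vw := mulr_ge0 v0 w0; have uw := mulr_ge0 u0 w0.
have vv := mulr_ge0 v0 v0.
split; [lra|lra| |lra].
apply: ler_pM; rewrite ?mulr_ge0 ?addr_ge0//; lra.
Qed.

Lemma gaps_le (a d x y z : R) : a <= x -> x <= y -> y <= z ->
  (y - a) + (z - x) <= d -> [/\ x - a <= d, y - x <= d & z - y <= d].
Proof. by move=> *; split; lra. Qed.

Lemma le_combination (C3 C2 K q X0 Y0 w1 w2 : R) :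
  0 <= C3 -> 0 <= C2 -> 0 <= K -> 0 <= q -> 0 <= X0 -> 0 <= Y0 ->
  w1 <= K * X0 -> w2 <= C3 * Y0 + C2 * X0 + q * X0 ->
  w1 + w2 <= (C3 + C2 + K + q) * (X0 + Y0).
Proof.
move=> c3 c2 k0 q0 x0 y0 h1 h2.
have := mulr_ge0 c3 x0; have := mulr_ge0 c2 y0; have := mulr_ge0 k0 y0.
have := mulr_ge0 q0 y0; lra.
Qed.

(** The union of two overlapping intervals is cut into the overlap and the
    pieces before and after it.  In the expansion of the two powers in words of
    the increments over the three pieces, the main terms are the word in the
    overlap alone, of trace about c_2k times its length, and the words without
    it, of trace about c_k^2 times the product of the two other lengths. *)
Lemma phi_powers_overlap k (H : R) : (0 < k)%N -> 0 < H ->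
  exists2 C : R, 0 <= C & forall a b c d, 0 <= a -> a <= b -> b <= H ->
    0 <= c -> c <= d -> d <= H ->
    cabs (phi (incr a b ^+ k * incr c d ^+ k) -
      (c_ (k + k) * overlap a b c d + c_ k ^+ 2 * ((b - a) * (d - c)))%:C)
    <= C * ((overlap a b c d + (b - a) * (d - c)) * ((b - a) + (d - c))).
Proof.
move=> k0 H0; have H0' := ltW H0.
have splitC (z : R[i]) (x y e : R) :
    z - (x + y - e)%:C = z - x%:C - y%:C + e%:C.
  by rewrite rmorphB rmorphD /=; ring.
have [K K0 hK] := three_increments k0 H0.
have [B B0 hB] := mom_bound k H0'.
have [C1 C10 hC1] := mom_linear k0 H0'.
have kk0 : (0 < k + k)%N by rewrite addn_gt0 k0.
have [C2 C20 hC2] := mom_linear kk0 H0'.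
pose C3 := C1 * (B + `|c_ k|).
have C30 : 0 <= C3 by rewrite mulr_ge0// addr_ge0.
have prod_bound s t : 0 <= s <= H -> 0 <= t <= H ->
    `|mom k s * mom k t - c_ k ^+ 2 * (s * t)| <= C3 * (s * t) * (s + t).
  move=> sH tH; have /andP[s0 _] := sH; have /andP[t0 _] := tH.
  have -> : mom k s * mom k t - c_ k ^+ 2 * (s * t) =
      (mom k s - s * c_ k) * mom k t + s * c_ k * (mom k t - t * c_ k) by ring.
  rewrite (le_trans (ler_normD _ _))// !normrM (ger0_norm s0).
  have h1 : `|mom k s - s * c_ k| * `|mom k t| <= (C1 * s ^+ 2) * (B * t).
    by rewrite ler_pM// ?hC1// hB// k0 leqnn.
  have h2 : s * `|c_ k| * `|mom k t - t * c_ k| <= s * `|c_ k| * (C1 * t ^+ 2).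
    by rewrite ler_wpM2l ?mulr_ge0// hC1.
  apply: (le_trans (lerD h1 h2)); rewrite /C3.
  have g1 : 0 <= C1 * B * s * t ^+ 2 by rewrite !mulr_ge0// sqr_ge0.
  have g2 : 0 <= C1 * `|c_ k| * t * s ^+ 2 by rewrite !mulr_ge0// sqr_ge0.
  move: g1 g2; lra.
exists (C3 + C2 + K + c_ k ^+ 2); first by rewrite !addr_ge0 ?sqr_ge0.
move=> a b c d.
wlog ac : a b c d / a <= c.
  move=> th a0 ab bH c0 cd dH; have [ac|/ltW ca] := leP a c; first exact: th.
  have := th _ _ _ _ ca c0 cd dH a0 ab bH.
  by rewrite phi_trace overlapC [(d - c) * _]mulrC [d - c + _]addrC.
move=> a0 ab bH c0 cd dH.
set s := b - a; set t := d - c; set o := overlap a b c d.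
have s0 : 0 <= s by rewrite subr_ge0.
have t0 : 0 <= t by rewrite subr_ge0.
have o0 : 0 <= o by rewrite /o /overlap le_max lexx.
have sH : 0 <= s <= H by rewrite s0 /= /s; lra.
have tH : 0 <= t <= H by rewrite t0 /= /t; lra.
have ck2 : 0 <= c_ k ^+ 2 := sqr_ge0 _.
have st0 : 0 <= s * t by rewrite mulr_ge0.
have pos1 : 0 <= s * t * (s + t) := mulr_ge0 st0 (addr_ge0 s0 t0).
have pos2 : 0 <= o * (s + t) := mulr_ge0 o0 (addr_ge0 s0 t0).
(* The intervals are disjoint. *)
have [bc|cb] := leP b c.
  have oE : o = 0.
    apply/eqP; rewrite eq_le o0 andbT /o /overlap ge_max lexx /= subr_le0.
    by rewrite (le_trans (_ : _ <= b)) ?ge_min ?lexx// le_max bc orbT.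
  rewrite (@phi_past_incrX c)//; last first.
    apply: (subalgX (filtration_sub fil c0)); exact: incr_adapted.
  rewrite phi_incrX// -rmorphM -rmorphB cabs_real oE mulr0 !add0r [mom k _ * _]mulrC.
  apply: (le_trans (prod_bound _ _ sH tH)); rewrite -[leLHS]mulrA.
  by rewrite ler_wpM2r// -!addrA lerDl !addr_ge0.
pose o0' : 'I_3 := ord0; pose o1' : 'I_3 := Ordinal (isT : (1 < 3)%N).
pose o2' : 'I_3 := ord_max.
have phi_v x y : 0 <= x -> x <= y -> y <= H ->
    `|mom (k + k) (y - x) - (y - x) * c_ (k + k)| <= C2 * (y - x) ^+ 2.
  by move=> x0 xy yH; apply: hC2; rewrite subr_ge0 xy (le_trans _ yH)// gerBl.
have cH : c <= H := le_trans cd dH.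
have sE : s = b - a by []. have tE : t = d - c by [].
(* The pieces are [a, c), [c, b), [b, d). *)
have [bd|db] := leP b d.
  have oE : o = b - c.
    by rewrite /o overlap_clamp // (max_l (ltW cb)) (min_l bd) (max_r ac) min_l.
  pose p l : R := nth d [:: a; c; b] l.
  have pS l : p l <= p l.+1.
    by case: l => [|[|[|[]]]] //=; exact: ltW.
  have pd (j : 'I_3) : p j.+1 - p j <= s + t.
    have [g1 g2 g3] := gaps_le ac (ltW cb) bd (lexx (s + t)).
    by case: j => [[|[|[|]]]].
  have main := hK p [:: o0'; o1'] [:: o1'; o2'] o1' (s + t) a0 pS dH isT isT pd.
  rewrite !big_cons !big_nil /= !addr0 /p /= in main.
  rewrite (incrD a0 ac (ltW cb)) (incrD c0 (ltW cb) bd) -exprD in main.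
  rewrite phi_incrX ?(ltW cb)// in main.
  rewrite (@phi_past_incrX b b d k (incr a c ^+ k)) ?(le_trans a0 ab)// in main; last first.
    apply: (subalgX (filtration_sub fil (le_trans a0 ab))).
    exact: (incr_adapted a0 ac (ltW cb)).
  rewrite (phi_incrX _ a0 ac) -rmorphM in main.
  have h1 := phi_v c b c0 (ltW cb) bH.
  have u0 : 0 <= c - a by rewrite subr_ge0.
  have v0 : 0 <= b - c by rewrite subr_ge0 ltW.
  have w0 : 0 <= d - b by rewrite subr_ge0.
  have uH : 0 <= c - a <= H by rewrite u0 (le_trans _ cH)// gerBl.
  have wH : 0 <= d - b <= H by rewrite w0 (le_trans _ dH)// gerBl (le_trans a0).
  have h2 := prod_bound _ _ wH uH.
  pose E := (mom k (d - b) * mom k (c - a) - c_ k ^+ 2 * ((d - b) * (c - a))) +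
      (mom (k + k) (b - c) - (b - c) * c_ (k + k)) +
      c_ k ^+ 2 * ((d - b) * (c - a) - s * t).
  have [] := overlap_estimates u0 v0 w0.
  have -> : (c - a) + (b - c) = s by rewrite sE addrC addrA subrK.
  have -> : (b - c) + (d - b) = t by rewrite tE addrC addrA subrK.
  move=> g0 g1 g2 g3.
  set Z := phi _ in main *.
  set y := mom k (d - b) * mom k (c - a) in main E *.
  set m := mom (k + k) (b - c) in main E *.
  have -> : c_ (k + k) * o + c_ k ^+ 2 * (s * t) = y + m - E by rewrite /E oE; ring.
  rewrite splitC (le_trans (cabsD _ _))// cabs_real oE [(_ + s * t) * _]mulrDl.
  apply: le_combination; rewrite -?oE//; first by rewrite oE; exact: main.
  have hE : `|E| <= C3 * ((d - b) * (c - a)) * ((d - b) + (c - a)) + C2 * (b - c) ^+ 2 +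
      c_ k ^+ 2 * (s * t - (d - b) * (c - a)).
    rewrite /E (le_trans (ler_normD _ _))// lerD//.
      by rewrite (le_trans (ler_normD _ _))// lerD.
    by rewrite normrM (ger0_norm ck2) ler_wpM2l// distrC ger0_norm.
  rewrite (le_trans hE)// lerD ?lerD//; last by rewrite oE ler_wpM2l.
    by rewrite -[leLHS]mulrA ler_wpM2l.
  by rewrite oE ler_wpM2l.
(* The pieces are [a, c), [c, d), [d, b), and every word contains the overlap. *)
have oE : o = d - c.
  by rewrite /o overlap_clamp // (max_l (ltW cb)) (min_r (ltW db)) (max_r ac) min_l.
pose p l : R := nth b [:: a; c; d] l.
have pS l : p l <= p l.+1.
  by case: l => [|[|[|[]]]] //=; exact: ltW.
have pd (j : 'I_3) : p j.+1 - p j <= s + t.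
  have st' : d - a + (b - c) <= s + t.
    by rewrite sE tE addrACA [X in _ <= X]addrACA [b + d]addrC.
  have [g1 g2 g3] := gaps_le ac cd (ltW db) st'.
  by case: j => [[|[|[|]]]].
have main := hK p [:: o0'; o1'; o2'] [:: o1'] o1' (s + t) a0 pS bH isT isT pd.
rewrite !big_cons !big_nil /= !addr0 /p /= in main.
rewrite addrA (incrD a0 ac cd) (incrD a0 (le_trans ac cd) (ltW db)) in main.
rewrite [0 ^+ k]expr0n (gtn_eqF k0) mulr0 linear0 subr0 -exprD phi_incrX// in main.
have h1 := phi_v c d c0 cd dH.
pose E := (mom (k + k) (d - c) - (d - c) * c_ (k + k)) - c_ k ^+ 2 * (s * t).
set Z := phi _ in main *.
set m := mom (k + k) (d - c) in main E *.
have -> : c_ (k + k) * o + c_ k ^+ 2 * (s * t) = 0 + m - E by rewrite /E oE; ring.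
rewrite splitC subr0 (le_trans (cabsD _ _))// cabs_real oE [(_ + s * t) * _]mulrDl.
apply: le_combination; rewrite -?oE//; first by rewrite oE; exact: main.
have hE : `|E| <= C2 * (d - c) ^+ 2 + c_ k ^+ 2 * (s * t).
  by rewrite (le_trans (ler_normB _ _))// lerD// ger0_norm// mulr_ge0.
have ot : o = t by rewrite oE.
have -> : C3 * (s * t * (s + t)) + C2 * (o * (s + t)) + c_ k ^+ 2 * (o * (s + t)) =
   C3 * (s * t * (s + t)) + (C2 * (o * (s + t)) + c_ k ^+ 2 * (o * (s + t))).
  by rewrite -[LHS]addrA.
apply: (le_trans hE); rewrite -[leLHS]add0r; apply: lerD; first exact: mulr_ge0.
apply: lerD; apply: ler_wpM2l => //.
  by rewrite -tE ot expr2 ler_wpM2l// lerDr.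
by rewrite ot mulrC ler_wpM2l// lerDl.
Qed.

(** ** Products of diagonal sums *)

Let sum_cells (h : R) (n N : nat) : 0 <= h -> (n <= N)%N -> n%:R * (h / N%:R) <= h.
Proof.
move=> h0; case: N => [|N] nN; first by rewrite invr0 mulr0 mulr0.
by rewrite mulrA ler_pdivrMr// mulrC ler_wpM2l// ler_nat.
Qed.

Let cell_len (a b H : R) N : 0 <= a -> a <= b -> b - a <= H ->
  0 <= (b - a) / N%:R <= H.
Proof.
move=> a0 ab abH; rewrite divr_ge0 ?subr_ge0//= (le_trans _ abH)//.
case: N => [|N]; first by rewrite invr0 mulr0 subr_ge0.
by rewrite ler_pdivrMr// ler_peMr ?subr_ge0// ler1n.
Qed.

Let n2_cell a b N l k : 0 <= a -> a <= b ->
  (n2 (x_ a b N l ^+ k) ^+ 2)%:C = (mom (k + k) ((b - a) / N%:R))%:C.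
Proof.
move=> a0 ab; rewrite n2_sqr starX incr_star ?upt_pos ?upt_step// -exprD.
by rewrite phi_incrX ?upt_pos ?upt_step// uptS.
Qed.

(** The drift of the sum is O(b - a) and its centered part has orthogonal terms,
    so that the norm is of order [Num.sqrt (b - a)] for all partitions. *)
Lemma sum_past_cells k (H : R) : (0 < k)%N -> 0 <= H ->
  exists2 C : R, 0 <= C & forall a b N n, 0 <= a -> a <= b -> b - a <= H ->
    (n <= N)%N -> n2 (\sum_(l < n) x_ a b N l ^+ k) <= C * Num.sqrt (b - a).
Proof.
move=> k0 H0; have [B B0 hB] := mom_bound (k + k) H0.
exists (2 * B * Num.sqrt H + Num.sqrt B).
  by rewrite addr_ge0 ?sqrtr_ge0// !mulr_ge0 ?sqrtr_ge0.
move=> a b N n a0 ab abH nN; set h := (b - a) / N%:R.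
have hH : 0 <= h <= H := cell_len N a0 ab abH.
have ba0 : 0 <= b - a by rewrite subr_ge0.
have hn := sum_cells ba0 nN.
have main := @almost_orthogonal_sum R A L2 At fil (upt a b N) (fun l => x_ a b N l ^+ k)
  (fun=> B * h) (fun=> B * h) n _ (@upt_mono a b N ab) _ _ _ _.
apply: (le_trans (main _ _ _ _ _)).
- by rewrite upt0.
- by move=> q _; exact: cell_adapted.
- move=> q u qn Au; rewrite phi_past_cell//; last first.
    exact: (subalg_star (filtration_sub fil (upt_pos N q a0 ab))).
  rewrite cabsM cabs_real phi_star cabs_conj ler_pM ?cabs_ge0//.
    by rewrite hB// k0 leq_addr.
  exact: phi_le1.
- move=> q qn; rewrite -lecR n2_cell// lecR (le_trans (ler_norm _))// hB//.
  by rewrite addn_gt0 k0 leqnn.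
- by move=> q _; have /andP[h0 _] := hH; rewrite mulr_ge0.
rewrite sumr_const card_ord -(mulr_natl (B * h)) [n%:R * _]mulrCA [leRHS]mulrDl lerD//.
  have -> : 2 * B * Num.sqrt H * Num.sqrt (b - a) = 2 * (B * (Num.sqrt H * Num.sqrt (b - a))).
    by rewrite !mulrA.
  rewrite ler_wpM2l// ler_wpM2l// (le_trans hn)//.
  rewrite -{1}(sqr_sqrtr ba0) expr2 ler_wpM2r ?sqrtr_ge0// ler_sqrt//.
by rewrite -sqrtrM// ler_wsqrtr// ler_wpM2l.
Qed.

Let n2_mul_cell a b N l k u : 0 <= a -> a <= b -> At (upt a b N l) u ->
  (n2 (u * x_ a b N l ^+ k) ^+ 2)%:C = (mom (k + k) ((b - a) / N%:R) * n2 u ^+ 2)%:C.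
Proof.
move=> a0 ab Au; have sB := filtration_sub fil (upt_pos N l a0 ab).
rewrite n2_sqr starM starX incr_star ?upt_pos ?upt_step//.
have -> : phi (x_ a b N l ^+ k * star u * (u * x_ a b N l ^+ k)) =
    phi (star u * u * x_ a b N l ^+ (k + k)).
  by rewrite -mulrA phi_trace exprD !mulrA.
rewrite phi_past_cell//; first by rewrite -(n2_sqr L2) [RHS]rmorphM.
by apply: (subalgM sB) => //; exact: (subalg_star sB).
Qed.

(** The products over two different cells: for fixed [q] the sum over the
    earlier cells is a past element of norm O(sqrt (b - a)), and it is multiplied
    by a new increment. *)
Lemma offdiagonal_bound i j (H : R) (c : A) : (0 < i)%N -> (0 < j)%N -> 0 <= H ->
  exists2 C : R, 0 <= C & forall a b N, 0 <= a -> a <= b -> b - a <= H -> At a c ->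
    n2 (\sum_(q < N) (\sum_(l < q) x_ a b N l ^+ i) * c * x_ a b N q ^+ j)
      <= C * (b - a).
Proof.
move=> i0 j0 H0; have [C C0 hC] := sum_past_cells i0 H0.
have [B B0 hB] := mom_bound (j + j) H0.
have [M M0 hM] := mul_bounded L2 1 c.
pose v := M * C.
have v0 : 0 <= v by rewrite mulr_ge0.
exists (2 * (B * (v * Num.sqrt H)) + Num.sqrt B * v).
  by rewrite addr_ge0 ?mulr_ge0 ?sqrtr_ge0.
move=> a b N a0 ab abH Ac; set h := (b - a) / N%:R.
have hH : 0 <= h <= H := cell_len N a0 ab abH.
have ba0 : 0 <= b - a by rewrite subr_ge0.
have hn := sum_cells ba0 (leqnn N).
pose n q := (\sum_(l < q) x_ a b N l ^+ i) * c.
have nv q : (q <= N)%N -> n2 (n q) <= v * Num.sqrt (b - a).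
  move=> qN; have := hM (\sum_(l < q) x_ a b N l ^+ i); rewrite mul1r => /le_trans; apply.
  by rewrite /v -mulrA ler_wpM2l// hC.
have An q : At (upt a b N q) (n q).
  have sB := filtration_sub fil (upt_pos N q a0 ab).
  apply: (subalgM sB); last exact: past_le.
  by apply: (subalg_sum sB) => l _; exact: cell_adapted.
pose s := v * Num.sqrt (b - a).
have s0 : 0 <= s by rewrite mulr_ge0 ?sqrtr_ge0.
have main := @almost_orthogonal_sum R A L2 At fil (upt a b N)
  (fun q => n q * x_ a b N q ^+ j) (fun=> B * h * s) (fun=> B * h * s ^+ 2) N _
  (@upt_mono a b N ab) _ _ _ _.
have /andP[h0 _] := hH; have Bh0 : 0 <= B * h by rewrite mulr_ge0.
apply: (le_trans (main _ _ _ _ _)).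
- by rewrite upt0.
- move=> q qN; have sB := filtration_sub fil (upt_pos N q.+1 a0 ab).
  apply: (subalgM sB); last exact: cell_adapted.
  by apply: (filtration_le fil _ _ (An q)); [exact: upt_pos|exact: upt_step].
- move=> q u qN Au; have sB := filtration_sub fil (upt_pos N q a0 ab).
  rewrite mulrA phi_past_cell//; last first.
    by apply: (subalgM sB); [exact: (subalg_star sB)|exact: An].
  rewrite cabsM cabs_real -mulrA ler_pM ?cabs_ge0//.
    by rewrite hB// j0 leq_addr.
  rewrite (le_trans (phi_le L2 _ _))// n2_star mulrC ler_wpM2r ?hnorm_ge0//.
  by rewrite nv// ltnW.
- move=> q qN; rewrite -lecR n2_mul_cell// lecR ler_pM ?sqr_ge0//.
  + by rewrite -lecR -(n2_cell N q j a0 ab) lecR sqr_ge0.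
  + by rewrite (le_trans (ler_norm _))// hB// addn_gt0 j0 leqnn.
  + by rewrite ler_pXn2r ?nnegrE ?hnorm_ge0// nv// ltnW.
- by move=> q _; rewrite mulr_ge0.
rewrite !sumr_const card_ord -!(mulr_natl (_ * _)) [leRHS]mulrDl.
have hN : N%:R * (B * h) <= B * (b - a) by rewrite mulrCA ler_wpM2l.
apply: lerD.
  rewrite -[leRHS]mulrA ler_wpM2l// mulrA (le_trans (ler_wpM2r s0 hN))//.
  rewrite (_ : B * _ * _ = B * (b - a) * (v * Num.sqrt H)); last by ring.
  apply: ler_wpM2l; first by rewrite mulr_ge0.
  by rewrite /s ler_wpM2l// ler_wsqrtr.
apply: (@le_trans _ _ (Num.sqrt (B * (b - a) * s ^+ 2))).
  by rewrite ler_wsqrtr// mulrA ler_wpM2r ?sqr_ge0.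
rewrite /s exprMn sqr_sqrtr// le_eqVlt; apply/orP; left; apply/eqP.
have -> : B * (b - a) * (v ^+ 2 * (b - a)) = B * (v * (b - a)) ^+ 2 by ring.
by rewrite sqrtrM// sqrtr_sqr ger0_norm ?mulrA// mulr_ge0.
Qed.

(* With [c] centered, each term is a centered element up to O(h^2), so the sum is
   almost orthogonal again. *)
Let diagonal_part_bound i j (H : R) (c : A) : (0 < i)%N -> (0 < j)%N -> 0 <= H ->
  phi c = 0 ->
  exists2 C : R, 0 <= C & forall a b N, 0 <= a -> a <= b -> b - a <= H -> At a c ->
    n2 (\sum_(q < N) x_ a b N q ^+ i * c * x_ a b N q ^+ j) <= C * (b - a).
Proof.
have le_i : (i <= i + i + (j + j))%N by lia.
have le_j : (j <= i + i + (j + j))%N by lia.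
have le_ii : (i + i <= i + i + (j + j))%N by lia.
have le_jj : (j + j <= i + i + (j + j))%N by lia.
move=> i0 j0 H0 c0; have [B B0 hB] := mom_bound (i + i + (j + j)) H0.
exists (2 * (B * (B * (H * n2 c))) + B * n2 c).
  by rewrite addr_ge0 ?mulr_ge0 ?hnorm_ge0.
move=> a b N a0 ab abH Ac; set h := (b - a) / N%:R.
have hH : 0 <= h <= H := cell_len N a0 ab abH.
have ba0 : 0 <= b - a by rewrite subr_ge0.
have hn := sum_cells ba0 (leqnn N).
have /andP[h0 h1] := hH; have Bh0 : 0 <= B * h by rewrite mulr_ge0.
have main := @almost_orthogonal_sum R A L2 At fil (upt a b N)
  (fun q => x_ a b N q ^+ i * c * x_ a b N q ^+ j)
  (fun=> B * h * (B * h) * n2 c) (fun=> B * h * (B * h) * n2 c ^+ 2) N _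
  (@upt_mono a b N ab) _ _ _ _.
have Acq q : At (upt a b N q) c by exact: past_le.
have m_le k : (0 < k)%N -> (k <= i + i + (j + j))%N -> `|mom k h| <= B * h.
  by move=> k0 kn; apply: hB; rewrite ?k0.
have nc0 : 0 <= n2 c := hnorm_ge0 _.
apply: (le_trans (main _ _ _ _ _)).
- by rewrite upt0.
- move=> q qN; have sB := filtration_sub fil (upt_pos N q.+1 a0 ab).
  by apply: (subalgM sB); [apply: (subalgM sB) => //|]; exact: cell_adapted.
- move=> q u qN Au; have sB := filtration_sub fil (upt_pos N q a0 ab).
  have Au' := subalg_star sB Au.
  rewrite [star u * (_ * _)]mulrA [star u * (_ * c)]mulrA (@phi_past_incrX2 (upt a b N q)) ?upt_pos ?upt_step//.
  rewrite uptS -/h c0 !mulr0 add0r subr0 cabsM cabs_real normrM -[leRHS]mulrA.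
  rewrite ler_pM ?mulr_ge0 ?normr_ge0 ?cabs_ge0//.
    by apply: ler_pM; rewrite ?normr_ge0// m_le.
  by rewrite (le_trans (phi_le L2 _ _))// n2_star mulrC.
- move=> q qN; have sB := filtration_sub fil (upt_pos N q a0 ab).
  have Ac' := subalg_star sB (Acq q).
  rewrite -lecR n2_sqr !starM !starX incr_star ?upt_pos ?upt_step//.
  have -> : phi (x_ a b N q ^+ j * (star c * x_ a b N q ^+ i) *
       (x_ a b N q ^+ i * c * x_ a b N q ^+ j)) =
     phi (star c * x_ a b N q ^+ (i + i) * c * x_ a b N q ^+ (j + j)).
    by rewrite -mulrA phi_trace !exprD !mulrA.
  rewrite (@phi_past_incrX2 (upt a b N q)) ?upt_pos ?upt_step// uptS -/h.
  rewrite c0 !mulr0 add0r subr0 -(n2_sqr L2) -rmorphM lecR ler_wpM2r ?sqr_ge0//.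
  rewrite (le_trans (ler_norm _))// normrM.
  by apply: ler_pM; rewrite ?normr_ge0// m_le// addn_gt0 ?i0 ?j0.
- by move=> q _; rewrite !mulr_ge0.
rewrite !sumr_const card_ord -!(mulr_natl (_ * _)) [leRHS]mulrDl.
have hN : N%:R * (B * h) <= B * (b - a) by rewrite mulrCA ler_wpM2l.
apply: lerD.
  rewrite -[leRHS]mulrA ler_wpM2l//.
  have -> : N%:R * (B * h * (B * h) * n2 c) = N%:R * (B * h) * (B * h * n2 c) by ring.
  apply: (@le_trans _ _ (B * (b - a) * (B * H * n2 c))).
    by rewrite ler_pM ?mulr_ge0// ler_wpM2r// ler_wpM2l.
  by rewrite le_eqVlt; apply/orP; left; apply/eqP; ring.
apply: (@le_trans _ _ (Num.sqrt ((B * (b - a) * n2 c) ^+ 2))).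
  rewrite ler_wsqrtr//.
  have -> : N%:R * (B * h * (B * h) * n2 c ^+ 2) = N%:R * (B * h) * (B * h) * n2 c ^+ 2 by ring.
  rewrite exprMn; apply: ler_wpM2r; rewrite ?sqr_ge0// expr2.
  have /andP[_ hba] := cell_len N a0 ab (lexx (b - a)).
  by apply: ler_pM; rewrite ?mulr_ge0//; apply: ler_wpM2l.
by rewrite sqrtr_sqr ger0_norm ?mulr_ge0// mulrAC.
Qed.

(** The terms on the diagonal of the double sum give phi (c) times the diagonal
    sum of order i + j, up to the centered part of [c]; the terms below the
    diagonal are those of [offdiagonal_bound], and the terms above are their
    adjoints. *)
Lemma diagonal_product_bound i j (H : R) (c : A) : (0 < i)%N -> (0 < j)%N -> 0 <= H ->
  exists2 C : R, 0 <= C & forall a b N, 0 <= a -> a <= b -> b - a <= H -> At a c ->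
    n2 (diagonal_sum X i a b N * c * diagonal_sum X j a b N -
        phi c *: diagonal_sum X (i + j) a b N) <= C * (b - a).
Proof.
move=> i0 j0 H0.
have [C1 C10 h1] := @diagonal_part_bound i j H (centered c) i0 j0 H0 (phi_centered c).
have [C2 C20 h2] := offdiagonal_bound c i0 j0 H0.
have [C3 C30 h3] := offdiagonal_bound (star c) j0 i0 H0.
exists (C1 + C2 + C3); first by rewrite !addr_ge0.
move=> a b N a0 ab abH Ac; rewrite !diagonal_sumE (product_of_sums (fun q => x_ a b N q ^+ i) (fun q => x_ a b N q ^+ j) c N).
have sB := filtration_sub fil a0.
set T2 := \sum_(q < N) (\sum_(l < q) _) * c * _.
set T3 := \sum_(q < N) _ * c * (\sum_(l < q) _).
rewrite addrAC [_ + T2 - _]addrAC.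
have -> : (\sum_(q < N) x_ a b N q ^+ i * c * x_ a b N q ^+ j) -
     phi c *: (\sum_(l < N) x_ a b N l ^+ (i + j)) =
   \sum_(q < N) x_ a b N q ^+ i * centered c * x_ a b N q ^+ j.
  rewrite scaler_sumr -sumrB; apply: eq_bigr => q _.
  by rewrite /centered mulrBr mulrBl -scalerAr mulr1 -scalerAl exprD.
rewrite !linearD (le_trans (hnorm_triangle _ _))// [leRHS]mulrDl lerD//.
  rewrite (le_trans (hnorm_triangle _ _))// [leRHS]mulrDl lerD//.
    by apply: h1 => //; exact: subalg_centered.
  exact: h2.
rewrite -n2_star /T3 star_sum.
under eq_bigr => q _.
  rewrite !starM star_sum starX incr_star ?upt_pos ?upt_step// mulrA.
  under eq_bigr do rewrite starX incr_star ?upt_pos ?upt_step//.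
  over.
by apply: h3 => //; exact: (subalg_star sB).
Qed.

Section Diagonal.
Context (Delta : nat -> set R -> A).
Hypothesis diagD : diagonal_measures X Delta.
Local Notation Dl k a b := (Delta k `[a, b[%classic).

Lemma diagonal_cvg_op k a b : (0 < k)%N -> 0 <= a -> a <= b ->
  opnorm (diagonal_sum X k a b N.+1 - Dl k a b) @[N --> \oo] --> (0 : R).
Proof. by move=> k0 a0 ab; have := diagD k0 a0 ab; rewrite -cvg_shiftS. Qed.

Lemma diagonal_cvg2 k a b : (0 < k)%N -> 0 <= a -> a <= b ->
  hcvg (fun N => toL2 L2 (diagonal_sum X k a b N.+1)) (toL2 L2 (Dl k a b)).
Proof.
by move=> k0 a0 ab; exact/opnorm_cvg2/diagonal_cvg_op.
Qed.

Lemma diagonal_adapted k a b : (0 < k)%N -> 0 <= a -> a <= b -> At b (Dl k a b).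
Proof.
move=> k0 a0 ab; have b0 := le_trans a0 ab.
have vB : vn_subalg (At b) by case: fil => /(_ b b0).
apply: (vn_subalg_closed vB _ (diagonal_cvg_op k0 a0 ab)) => N.
rewrite diagonal_sumE; apply: (subalg_sum vB.1) => l _.
have := @cell_adapted a b N.+1 l N.+1 k a0 ab (ltn_ord l).
by rewrite uptN.
Qed.

Lemma diagonal_star k a b : (0 < k)%N -> 0 <= a -> a <= b ->
  star (Dl k a b) = Dl k a b.
Proof.
move=> k0 a0 ab; have h := diagonal_cvg2 k0 a0 ab.
have h' := cvg2_star h.
have E : (fun N => toL2 L2 (star (diagonal_sum X k a b N.+1))) =
    (fun N => toL2 L2 (diagonal_sum X k a b N.+1)).
  apply/funext => N; rewrite diagonal_sumE star_sum; congr (toL2 _ _).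
  by apply: eq_bigr => l _; rewrite starX incr_star ?upt_pos ?upt_step.
rewrite E in h'; have /eqP := hcvg_unique h' h.
by rewrite -subr_eq0 -linearB => /eqP e; apply/subr0_eq/(@n2_eq0 _ _ L2); rewrite e hnorm0.
Qed.

Lemma phi_past_diagonal k a b u : (0 < k)%N -> 0 <= a -> a <= b -> At a u ->
  phi (u * Dl k a b) = (c_ k * (b - a))%:C * phi u.
Proof.
move=> k0 a0 ab Au; have h := cvg2_phi1 u (diagonal_cvg2 k0 a0 ab).
apply: (ccvg_unique h); under eq_fun do rewrite phi_diagonal_sum//.
by apply: ccvg_real; apply: mom_limit => //; rewrite subr_ge0.
Qed.

Lemma phi_past_diagonal2 i j a b u v : (0 < i)%N -> (0 < j)%N ->
  0 <= a -> a <= b -> At a u -> At a v ->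
  phi (u * Dl i a b * v * Dl j a b) =
  (c_ i * (b - a) * (c_ j * (b - a)))%:C * phi (u * v) +
  (c_ (i + j) * (b - a))%:C * (phi u * phi v).
Proof.
move=> i0 j0 a0 ab Au Av; have L0 : 0 <= b - a by rewrite subr_ge0.
have h := cvg2_phi u v (diagonal_cvg2 i0 a0 ab) (diagonal_cvg2 j0 a0 ab).
apply: (ccvg_unique h); under eq_fun do rewrite phi_diagonal_sum2//.
have mi := mom_limit i0 L0; have mj := mom_limit j0 L0.
apply: ccvgD; apply: ccvg_real; first exact: cvgM.
rewrite -[c_ (i + j) * _]subr0; apply: cvgB; first by apply: mom_limit; rewrite ?addn_gt0 ?i0.
rewrite -[0](mulr0 (c_ i * (b - a))); apply: cvgM => //.
have -> : (fun N => mom j ((b - a) / N.+1%:R)) =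
    (fun N => N.+1%:R^-1 * (N.+1%:R * mom j ((b - a) / N.+1%:R))).
  by apply/funext => N; rewrite mulKf.
by rewrite -[0](mul0r (c_ j * (b - a))); apply: cvgM => //; exact: cvg_harmonic.
Qed.

Lemma overlap_sub a b c d : a <= c -> c <= d -> d <= b -> overlap a b c d = d - c.
Proof.
move=> ac cd db; rewrite /overlap (min_r db) (max_r ac) max_r// subr_ge0//.
Qed.

Lemma overlap_disjoint a b c d : b <= c -> overlap a b c d = 0.
Proof.
move=> bc; rewrite /overlap max_l// subr_le0.
by apply: (@le_trans _ _ b); rewrite ?ge_min ?le_max ?lexx ?bc ?orbT.
Qed.

(** The errors of [phi_powers_overlap] are summed over all pairs of cells of the
    two partitions; the overlaps of the cells add up to the overlap of the
    intervals, and the factor [s + t] is O(1 / N). *)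
Lemma phi_diagonal_cov k a b c d : (0 < k)%N -> 0 <= a -> a <= b -> 0 <= c -> c <= d ->
  phi (Dl k a b * Dl k c d) =
  (c_ (k + k) * overlap a b c d + c_ k ^+ 2 * ((b - a) * (d - c)))%:C.
Proof.
move=> k0 a0 ab c0 cd.
have h := cvg2_phi 1 1 (diagonal_cvg2 k0 a0 ab) (diagonal_cvg2 k0 c0 cd).
rewrite mul1r mulr1 in h; apply: (ccvg_unique h).
pose H := b + d + 1; have d0 := le_trans c0 cd; have b0 := le_trans a0 ab.
have H0 : 0 < H by rewrite ltr_wpDl ?addr_ge0.
have [C C0 hC] := phi_powers_overlap k0 H0.
set s := b - a; set t := d - c; set o := overlap a b c d.
apply: (cvg0_le (g := fun N => C * ((o + s * t) * (s + t)) * N.+1%:R^-1)); last first.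
  rewrite -[0](mulr0 (C * ((o + s * t) * (s + t)))); apply: cvgMl_tmp; exact: cvg_harmonic.
move=> N; rewrite cabs_ge0 /= mul1r mulr1 !diagonal_sumE.
pose ta := upt a b N.+1; pose tc := upt c d N.+1.
pose ov l l' := overlap (ta l) (ta l.+1) (tc l') (tc l'.+1).
have taS l : ta l <= ta l.+1 by exact: upt_step.
have tcS l : tc l <= tc l.+1 by exact: upt_step.
have sum_ov : \sum_(l < N.+1) \sum_(l' < N.+1) ov l l' = o.
  rewrite exchange_big /=; under eq_bigr do rewrite sum_overlap//.
  rewrite /ta upt0 uptN; under eq_bigr do rewrite overlapC.
  by rewrite sum_overlap// /tc upt0 uptN overlapC.
have sum_cst x : \sum_(l < N.+1) \sum_(l' < N.+1) x = N.+1%:R * (N.+1%:R * x) :> R.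
  by rewrite !sumr_const !card_ord -[LHS]mulr_natl -[x *+ _]mulr_natl.
have N0 : N.+1%:R != 0 :> R by rewrite pnatr_eq0.
have -> : (c_ (k + k) * o + c_ k ^+ 2 * (s * t))%:C = \sum_(l < N.+1) \sum_(l' < N.+1)
    (c_ (k + k) * ov l l' + c_ k ^+ 2 * ((ta l.+1 - ta l) * (tc l'.+1 - tc l')))%:C.
  under eq_bigr do rewrite -rmorph_sum; rewrite -rmorph_sum; congr (_%:C).
  under eq_bigr do rewrite big_split /=; rewrite big_split /=.
  rewrite -{1}sum_ov mulr_sumr; congr (_ + _).
    by apply: eq_bigr => l _; rewrite mulr_sumr.
  under eq_bigr do under eq_bigr do rewrite !uptS.
  by rewrite sum_cst -/s -/t; field.
rewrite mulr_suml linear_sum -sumrB /=.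
apply: (@le_trans _ _ (\sum_(l < N.+1) \sum_(l' < N.+1)
    C * ((ov l l' + (s / N.+1%:R) * (t / N.+1%:R)) * (s / N.+1%:R + t / N.+1%:R)))).
  rewrite (le_trans (cabs_sum _ _ _))//; apply: ler_sum => l _.
  rewrite mulr_sumr linear_sum -sumrB (le_trans (cabs_sum _ _ _))//.
  apply: ler_sum => l' _.
  have ub x y M l1 : 0 <= x -> x <= y -> y <= H -> (l1 <= M.+1)%N -> upt x y M.+1 l1 <= H.
    by move=> x0 xy yH lM; rewrite (le_trans _ yH)// -{2}(uptN x y M) upt_mono.
  have bH : b <= H by rewrite /H -addrA lerDl addr_ge0.
  have dH : d <= H by rewrite /H addrC addrA lerDr addr_ge0.
  have := hC (ta l) (ta l.+1) (tc l') (tc l'.+1).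
  by rewrite !uptS; apply; rewrite ?upt_pos ?ub.
rewrite le_eqVlt; apply/orP; left; apply/eqP.
under eq_bigr do rewrite -mulr_sumr -mulr_suml big_split /=.
by rewrite -mulr_sumr -mulr_suml big_split /= sum_ov sum_cst; field.
Qed.

(** By the covariance formula the difference of the two sides has L^2 norm 0. *)
Lemma diagonal_additive k a b c : (0 < k)%N -> 0 <= a -> a <= b -> b <= c ->
  Dl k a b + Dl k b c = Dl k a c.
Proof.
move=> k0 a0 ab bc; have b0 := le_trans a0 ab; have ac := le_trans ab bc.
apply/eqP; rewrite -subr_eq0; apply/eqP/phi_faithful.
rewrite starB starD !diagonal_star// mulrBl mulrDl !mulrBr !mulrDr.
rewrite !(linearB, linearD) /=.
rewrite !phi_diagonal_cov//.
rewrite (overlapC b c a b) (overlapC b c a c) (overlapC a b a c).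
rewrite (overlap_disjoint a c (lexx b)) !overlap_sub// !mulr0 !add0r.
by rewrite !(rmorphD, rmorphB, rmorphM) /=; ring.
Qed.

Lemma diagonal_product_remainder i j (H : R) (c : A) : (0 < i)%N -> (0 < j)%N -> 0 <= H ->
  exists2 C : R, 0 <= C & forall a b, 0 <= a -> a <= b -> b - a <= H -> At a c ->
    n2 (Dl i a b * c * Dl j a b - phi c *: Dl (i + j) a b) <= C * (b - a).
Proof.
move=> i0 j0 H0; have [C C0 hC] := diagonal_product_bound c i0 j0 H0.
exists C => // a b a0 ab abH Ac.
have ij0 : (0 < i + j)%N by rewrite addn_gt0 i0.
have h1 := opnorm_cvg2M c (diagonal_cvg_op i0 a0 ab) (diagonal_cvg2 j0 a0 ab).
have h2 := hcvgB h1 (hcvgZ (phi c) (diagonal_cvg2 ij0 a0 ab)).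
rewrite linearB linearZ /=; apply: (hcvg_le h2) => N.
by rewrite -linearZ -linearB; exact: hC.
Qed.

End Diagonal.

End StochasticMeasure.

(** * Families of processes with an Ito product rule *)

(** All that the integration theory uses of the processes [D k].  For
    the diagonal measures [c k] is the free cumulant r_k. *)
Record ito_family (R : realType) (A : tracialVN R) (L2 : L2_space A)
    (At : R -> set A) (D : nat -> R -> A) (c : nat -> R) : Prop := ItoFamily {
  ito_adapted : forall k s t, (0 < k)%N -> 0 <= s -> s <= t -> At t (D k t - D k s);
  ito_star : forall k s t, (0 < k)%N -> 0 <= s -> s <= t ->
    star (D k t - D k s) = D k t - D k s;
  ito_mean : forall k s t u, (0 < k)%N -> 0 <= s -> s <= t -> At s u ->
    phi (u * (D k t - D k s)) = (c k * (t - s))%:C * phi u;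
  ito_covariance : forall i j s t u v, (0 < i)%N -> (0 < j)%N -> 0 <= s -> s <= t ->
    At s u -> At s v ->
    phi (u * (D i t - D i s) * v * (D j t - D j s)) =
    (c i * (t - s) * (c j * (t - s)))%:C * phi (u * v) +
    (c (i + j)%N * (t - s))%:C * (phi u * phi v);
  ito_product : forall i j (H : R) (a : A), (0 < i)%N -> (0 < j)%N -> 0 <= H ->
    exists2 C : R, 0 <= C & forall s t, 0 <= s -> s <= t -> t - s <= H -> At s a ->
      hnorm (toL2 L2 ((D i t - D i s) * a * (D j t - D j s) -
        phi a *: (D (i + j)%N t - D (i + j)%N s))) <= C * (t - s) }.

(** By additivity the increment of [diagonal_process Delta k] over [s, t) is
    [Delta k] of this interval, for which the properties have been proved. *)
Lemma diagonal_process_ito (R : realType) (A : tracialVN R) (L2 : L2_space A)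
    (At : R -> set A) (r : nat -> R) (mu_ : R -> probability (measurableTypeR R) R)
    (X : set R -> A) (Delta : nat -> set R -> A) :
  filtration At -> free_convolution_semigroup r mu_ ->
  free_stochastic_measure At mu_ X -> diagonal_measures X Delta ->
  ito_family L2 At (diagonal_process Delta) (linear_coef r).
Proof.
move=> fil mu_semi fsmX diagD.
have phiX a b k : 0 <= a -> a <= b ->
    phi (X `[a, b[%classic ^+ k) = (moment (mu_ (b - a)) k)%:C.
  by move=> a0 ab; have [_ _ ->] := fsm_distribution fsmX a0 ab.
have mom_lin k H (k0 : (0 < k)%N) (H0 : 0 <= H) := moment_linear mu_semi k0 H0.
have DE k s t : (0 < k)%N -> 0 <= s -> s <= t ->
    diagonal_process Delta k t - diagonal_process Delta k s = Delta k `[s, t[%classic.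
  move=> k0 s0 st; rewrite /diagonal_process.
  rewrite -(diagonal_additive L2 fil fsmX phiX mom_lin diagD k0 (lexx 0) s0 st).
  by rewrite addrC addKr.
split.
- by move=> k s t k0 s0 st; rewrite DE//; exact: (diagonal_adapted fil fsmX).
- by move=> k s t k0 s0 st; rewrite DE//; exact: (diagonal_star L2 fsmX).
- move=> k s t u k0 s0 st Au; rewrite DE//.
  exact: (phi_past_diagonal L2 fil fsmX phiX mom_lin).
- move=> i j s t u v i0 j0 s0 st Au Av; rewrite !DE//.
  exact: (phi_past_diagonal2 L2 fil fsmX phiX mom_lin).
- move=> i j H a i0 j0 H0.
  have [C C0 hC] := diagonal_product_remainder L2 fil fsmX phiX mom_lin diagD a i0 j0 H0.
  exists C => // s t s0 st stH Aa; rewrite !DE// ?addn_gt0 ?i0//.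
  exact: hC.
Qed.

(** * Grids and simple biprocesses *)

(** ** Adapted tensors *)

Section AdaptedTensors.
Context (R : realType) (A : tracialVN R).
Implicit Types (B : set A) (x y : tensor A A).

Definition tadapted B x : Prop := exists2 s : seq (A * A),
  forall p, p \in s -> B p.1 /\ B p.2 & x = \sum_(p <- s) tens p.1 p.2.

Lemma tadapted_ord B x : tadapted B x <-> exists n (S T : 'I_n -> A),
  (forall k, B (S k) /\ B (T k)) /\ x = \sum_k tens (S k) (T k).
Proof.
split=> [[s sB ->]|[n [S [T [ST ->]]]]].
  exists (size s), (fun k => (tnth (in_tuple s) k).1), (fun k => (tnth (in_tuple s) k).2).
  split; last by rewrite (big_tnth _ _ s).
  by move=> k; apply: sB; exact: mem_tnth.
exists [seq (S k, T k) | k <- enum 'I_n]; first by move=> p /mapP[k _ ->]; exact: ST.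
by rewrite big_map big_enum.
Qed.

Lemma tadapted_tens B a b : B a -> B b -> tadapted B (tens a b).
Proof.
move=> Ba Bb; exists [:: (a, b)]; last by rewrite big_seq1.
by move=> p; rewrite inE => /eqP ->.
Qed.

Lemma tadapted0 B : tadapted B 0.
Proof. by exists [::]; rewrite ?big_nil. Qed.

Lemma tadaptedD B x y : tadapted B x -> tadapted B y -> tadapted B (x + y).
Proof.
move=> [s sB ->] [s' sB' ->]; exists (s ++ s'); last by rewrite big_cat.
by move=> p; rewrite mem_cat => /orP[/sB|/sB'].
Qed.

Lemma tadapted_sum B (I : Type) (s : seq I) (P : pred I) (F : I -> tensor A A) :
  (forall i, P i -> tadapted B (F i)) -> tadapted B (\sum_(i <- s | P i) F i).
Proof.
by move=> FB; elim/big_ind: _ => //; [exact: tadapted0|exact: tadaptedD].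
Qed.

Lemma tadapted_incl B B' x : B `<=` B' -> tadapted B x -> tadapted B' x.
Proof.
move=> BB' [s sB ->]; exists s => // p /sB[h1 h2]; split; exact: BB'.
Qed.

Lemma tadaptedN B x : star_subalg B -> tadapted B x -> tadapted B (- x).
Proof.
move=> bB [s sB ->]; exists [seq (- p.1, p.2) | p <- s].
  move=> p /mapP[q /sB[h1 h2] ->] /=; split=> //.
  by rewrite -scaleN1r; exact: subalgZ.
by rewrite big_map -sumrN; apply: eq_bigr => p _; rewrite /= -(scaleN1r p.1) tensZl scaleN1r.
Qed.

Lemma tadaptedZ B (c : R[i]) x : star_subalg B -> tadapted B x -> tadapted B (c *: x).
Proof.
move=> bB [s sB ->]; exists [seq (c *: p.1, p.2) | p <- s].
  by move=> p /mapP[q /sB[h1 h2] ->] /=; split=> //; exact: subalgZ.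
by rewrite big_map scaler_sumr; apply: eq_bigr => p _; rewrite /= tensZl.
Qed.

Lemma tadaptedB B x y : star_subalg B -> tadapted B x -> tadapted B y ->
  tadapted B (x - y).
Proof. by move=> bB Bx By; apply: tadaptedD => //; exact: tadaptedN. Qed.

Lemma tadapted_sharpl B n x : star_subalg B -> B n -> tadapted B x ->
  tadapted B (sharp (tens n 1) x).
Proof.
move=> bB Bn [s sB ->]; rewrite sharp_sumr.
exists [seq (n * p.1, p.2) | p <- s]; last first.
  by rewrite big_map; apply: eq_bigr => p _; rewrite sharp_tens mulr1.
by move=> p /mapP[q /sB[h1 h2] ->] /=; split=> //; exact: subalgM.
Qed.

Lemma tadapted_sharpr B n x : star_subalg B -> B n -> tadapted B x ->
  tadapted B (sharp (tens 1 n) x).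
Proof.
move=> bB Bn [s sB ->]; rewrite sharp_sumr.
exists [seq (p.1, p.2 * n) | p <- s]; last first.
  by rewrite big_map; apply: eq_bigr => p _; rewrite sharp_tens mul1r.
by move=> p /mapP[q /sB[h1 h2] ->] /=; split=> //; exact: subalgM.
Qed.

Lemma tact_adapted B x d : star_subalg B -> tadapted B x -> B d -> B (tact x d).
Proof.
move=> bB [s sB ->] Bd; rewrite tact_suml big_seq; apply: subalg_sum => // p /sB[h1 h2].
by rewrite tact_tens; apply: (subalgM bB) => //; exact: subalgM.
Qed.

End AdaptedTensors.

(** ** Grids *)

Section Grids.
Context (R : realType).
Implicit Types (t : nat -> R) (P : seq R) (T s : R).

(** Grid points may be repeated, so cells may be empty. *)
Record is_grid t (K : nat) T P : Prop := IsGrid {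
  grid0 : t 0%N = 0;
  grid_mono : {homo t : i j / (i <= j)%N >-> i <= j};
  gridT : t K = T;
  grid_mem : forall x, x \in P -> exists2 l, (l <= K)%N & t l = x }.

Lemma grid_ge0 t K T P l : is_grid t K T P -> 0 <= t l.
Proof. by move=> g; rewrite -(grid0 g) (grid_mono g). Qed.

Lemma gridS t K T P l : is_grid t K T P -> t l <= t l.+1.
Proof. by move=> g; exact: (grid_mono g). Qed.

Lemma is_grid_sub t K T P P' : {subset P' <= P} -> is_grid t K T P -> is_grid t K T P'.
Proof. by move=> PP' [g0 gm gT gP]; split=> // x /PP'; exact: gP. Qed.

(** The grid lists in increasing order the points of [P] and those of a uniform
    partition. *)
Lemma grid_exists P T (d : R) : 0 <= T -> (forall x, x \in P -> 0 <= x <= T) -> 0 < d ->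
  exists K t, is_grid t K T P /\ forall l, t l.+1 - t l <= d.
Proof.
move=> T0 PT d0.
pose n := (Num.truncn (T / d)).+1.
have n0 : 0 < n%:R :> R by rewrite ltr0n.
have nd : T / n%:R <= d.
  rewrite ler_pdivrMr// mulrC -ler_pdivrMr//.
  by rewrite ltW// truncnS_gt.
pose pt k : R := T * k%:R / n%:R.
pose Q := sort <=%O (0 :: T :: P ++ [seq pt k | k <- iota 0 n.+1]).
have memQ x : (x \in Q) = (x \in 0 :: T :: P ++ [seq pt k | k <- iota 0 n.+1]).
  by rewrite mem_sort.
have QT x : x \in Q -> 0 <= x <= T.
  rewrite memQ !inE mem_cat => /or3P[/eqP ->|/eqP ->|/orP[/PT //|]].
  - by rewrite lexx.
  - by rewrite T0 lexx.
  move=> /mapP[k]; rewrite mem_iota /= add0n ltnS => kn ->.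
  rewrite /pt divr_ge0 ?mulr_ge0 ?ler0n//= ler_pdivrMr// ler_wpM2l// ler_nat//.
have sQ : sorted <=%O Q by apply: sort_sorted; exact: le_total.
have szQ : (0 < size Q)%N by rewrite size_sort.
pose t l := nth T Q l.
have tT l : 0 <= t l <= T.
  have [lQ|lQ] := ltnP l (size Q); first exact/QT/mem_nth.
  by rewrite /t nth_default// T0 lexx.
have tm : {homo t : i j / (i <= j)%N >-> i <= j}.
  move=> i j ij; have [jQ|jQ] := ltnP j (size Q); last first.
    by rewrite [t j]nth_default//; have /andP[] := tT i.
  by rewrite /t sorted_leq_nth// ?inE//; [exact: le_trans|exact: leq_ltn_trans jQ].
exists (size Q), t; split; first split=> //.
- have /(nthP T)[l lQ l0] : 0 \in Q by rewrite memQ inE eqxx.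
  apply/eqP; rewrite eq_le; have /andP[-> _] := tT 0%N; rewrite andbT.
  by rewrite -[leRHS]l0; exact: tm.
- by rewrite /t nth_default.
- move=> x xP; have /(nthP T)[l lQ lx] : x \in Q.
    by rewrite memQ !inE mem_cat xP !orbT.
  by exists l => //; exact: ltnW.
(* A gap larger than [d] contains a point of the uniform partition. *)
move=> l; rewrite leNgt; apply/negP => gap.
have /andP[tl0 _] := tT l; have /andP[_ tl1] := tT l.+1.
pose k := Num.truncn (t l * n%:R / T).
have T1 : 0 < T by lra.
have x0 : 0 <= t l * n%:R / T by rewrite !mulr_ge0 ?invr_ge0 ?ler0n// ltW.
have /andP[k1 k2] : k%:R <= t l * n%:R / T < k.+1%:R by exact: truncn_itv.
have p1 : t l < pt k.+1 by rewrite /pt ltr_pdivlMr// [T * _]mulrC -ltr_pdivrMr.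
have p2 : pt k.+1 < t l.+1.
  apply: le_lt_trans (_ : t l + d < _); last lra.
  rewrite /pt -natr1 mulrDr mulr1 mulrDl lerD//.
  by rewrite ler_pdivrMr// [T * _]mulrC -ler_pdivlMr.
have kn : (k.+1 <= n)%N.
  rewrite -(ler_nat R) -(ler_pM2l T1) -ler_pdivrMr//.
  by apply: ltW; apply: (lt_le_trans p2).
have /(nthP T)[m mQ mp] : pt k.+1 \in Q.
  rewrite memQ !inE mem_cat map_f ?orbT// mem_iota /= add0n ltnS//.
have [ml|lm] := leqP m l.
  by have := tm _ _ ml; rewrite /t mp leNgt p1.
by have := tm _ _ lm; rewrite [X in _ <= X]mp leNgt p2.
Qed.

Definition cells (V : nmodType) t K (F : nat -> V) : R -> V :=
  fun s => \sum_(l < K) if t l <= s < t l.+1 then F l else 0.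

Lemma cells_in (V : nmodType) t K (F : nat -> V) s l :
  {homo t : i j / (i <= j)%N >-> i <= j} ->
  (l < K)%N -> t l <= s < t l.+1 -> cells t K F s = F l.
Proof.
move=> tm lK sl; rewrite /cells (bigD1 (Ordinal lK))//= sl big1 ?addr0// => m ml.
case: ifP => // /andP[m1 m2]; have /andP[l1 l2] := sl.
have [ml'|lm|e] := ltngtP m l.
- by have := tm _ _ ml'; rewrite leNgt (le_lt_trans l1).
- by have := tm _ _ lm; rewrite leNgt (le_lt_trans m1).
- by move: ml; rewrite -val_eqE /= e eqxx.
Qed.

Lemma cells_out (V : nmodType) t K (F : nat -> V) s :
  (forall l, (l < K)%N -> ~~ (t l <= s < t l.+1)) -> cells t K F s = 0.
Proof. by move=> h; rewrite /cells big1// => l _; rewrite (negbTE (h _ _)). Qed.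

Lemma cells_cases t K s : (exists2 l, (l < K)%N & t l <= s < t l.+1) \/
  (forall l, (l < K)%N -> ~~ (t l <= s < t l.+1)).
Proof.
have [/existsP[l sl]|/existsPn h] := boolP [exists l : 'I_K, t l <= s < t l.+1].
  by left; exists l.
by right=> l lK; exact: (h (Ordinal lK)).
Qed.

Lemma in_some_cell t K s : t 0%N <= s < t K -> exists2 l, (l < K)%N & t l <= s < t l.+1.
Proof.
elim: K => [|K IH] /andP[s0 sK].
  by move: (le_lt_trans s0 sK); rewrite ltxx.
have [sK'|sK'] := ltP s (t K); last by exists K => //; rewrite sK'.
by have [|l lK ?] := IH; [rewrite s0|exists l => //; exact: ltnW].
Qed.

Lemma cells_map (V W : nmodType) t K (F : nat -> V) (g : V -> W) s :
  {homo t : i j / (i <= j)%N >-> i <= j} -> g 0 = 0 ->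
  g (cells t K F s) = cells t K (fun l => g (F l)) s.
Proof.
move=> tm g0; have [[l lK sl]|h] := cells_cases t K s.
  by rewrite !(cells_in _ tm lK sl).
by rewrite !cells_out.
Qed.

(** On a grid containing [a] and [b], no cell is cut by the interval [a, b). *)
Lemma grid_cell t K T P a b l s : is_grid t K T P -> a \in P -> b \in P ->
  t l <= s < t l.+1 -> (a <= s < b) = (a <= t l < b).
Proof.
move=> g /(grid_mem g)[la _ <-] /(grid_mem g)[lb _ <-] /andP[s1 s2].
have tm := grid_mono g; apply/andP/andP => -[h1 h2]; split.
- have [//|h] := leqP la l; first exact: tm.
  by have := tm _ _ h; rewrite leNgt (le_lt_trans h1).
- exact: le_lt_trans h2.
- exact: le_trans s1.
- have [h|h] := leqP lb l; first by have := tm _ _ h; rewrite leNgt h2.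
  exact: lt_le_trans (tm _ _ h).
Qed.

(** The cells whose left end lies in [a, b) are those contained in it. *)
Lemma grid_telescope (V : zmodType) t K T P a b (D : R -> V) : is_grid t K T P ->
  a \in P -> b \in P -> a <= b ->
  \sum_(l < K) (if a <= t l < b then D (t l.+1) - D (t l) else 0) = D b - D a.
Proof.
move=> g aP bP ab; have tm := grid_mono g.
have [la laK Ea] := grid_mem g aP; have [lb lbK Eb] := grid_mem g bP.
pose G x := D (Num.min (Num.max x a) b).
have E (l : 'I_K) : (if a <= t l < b then D (t l.+1) - D (t l) else 0) =
    G (t l.+1) - G (t l).
  rewrite /G; have [al|la'] := leP a (t l); rewrite /=.
    rewrite max_l ?(le_trans al (gridS l g))//.
    have [lb'|bl] := ltP (t l) b.
      rewrite min_l// -Eb; apply: tm; rewrite ltnNge; apply/negP => h.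
      by have := grid_mono g h; rewrite leNgt Eb lb'.
    by rewrite min_r ?(le_trans bl (gridS l g))// subrr.
  have h : t l.+1 <= a.
    rewrite -Ea; apply: (grid_mono g); rewrite ltnNge; apply/negP => h.
    by have := grid_mono g h; rewrite leNgt Ea la'.
  by rewrite max_r// min_l// subrr.
rewrite (eq_bigr _ (fun l _ => E l)) -(big_mkord xpredT (fun l => G (t l.+1) - G (t l))).
rewrite telescope_sumr//; congr (D _ - D _).
  by rewrite max_l ?min_r// -?Ea -?Eb; exact: tm.
by rewrite max_r ?min_l// -Ea; exact: tm.
Qed.

End Grids.

(** ** Integrals of simple biprocesses *)

Section SimpleIntegrals.
Context (R : realType) (A : tracialVN R) (At : R -> set A).
Hypothesis fil : filtration At.
Implicit Types (U : biprocess A) (D : R -> A).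

Definition endpoints n (c : 'I_n -> elementary A) : seq R :=
  [seq el_left (c k) | k <- enum 'I_n] ++ [seq el_right (c k) | k <- enum 'I_n].

Lemma endpoints_left n (c : 'I_n -> elementary A) k : el_left (c k) \in endpoints c.
Proof. by rewrite mem_cat map_f// mem_enum. Qed.

Lemma endpoints_right n (c : 'I_n -> elementary A) k : el_right (c k) \in endpoints c.
Proof. by rewrite mem_cat [X in _ || X]map_f ?orbT// mem_enum. Qed.

Lemma endpoints_ge0 n (c : 'I_n -> elementary A) U x : represents At c U ->
  x \in endpoints c -> 0 <= x.
Proof.
move=> [cA _]; rewrite mem_cat => /orP[] /mapP[k _ ->]; have [h0 h1 _ _] := cA k => //.
exact: le_trans h1.
Qed.

Lemma represents_cells n (c : 'I_n -> elementary A) U (t : nat -> R) K T :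
  represents At c U -> is_grid t K T (endpoints c) ->
  U = cells t K (fun l => U (t l)).
Proof.
move=> [cA ->] g; have tm := grid_mono g; apply/funext => s.
have [[l lK sl]|h] := cells_cases t K s.
  rewrite (cells_in _ tm lK sl); apply: eq_bigr => k _; rewrite /el_biprocess.
  by rewrite (grid_cell g (endpoints_left c k) (endpoints_right c k) sl).
rewrite cells_out// big1// => k _; rewrite /el_biprocess; case: ifP => // /andP[h1 h2].
have [a0 _ _ _] := cA k.
have [l lK sl] : exists2 l, (l < K)%N & t l <= s < t l.+1.
  apply: in_some_cell; rewrite (grid0 g) (le_trans a0 h1) /= (lt_le_trans h2)//.
  by have [m mK <-] := grid_mem g (endpoints_right c k); exact: tm.
by have := h l lK; rewrite sl.
Qed.

Lemma represents_adapted n (c : 'I_n -> elementary A) U s :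
  represents At c U -> 0 <= s -> tadapted (At s) (U s).
Proof.
move=> [cA ->] s0; apply: tadapted_sum => k _; rewrite /el_biprocess.
case: ifP => [/andP[h1 _]|_]; last exact: tadapted0.
by have [a0 _ hS hT] := cA k; apply: tadapted_tens; exact: (filtration_le fil a0 h1).
Qed.

(** The right-hand side does not depend on the representation, except through
    the condition on the grid, so two representations are compared on a common
    grid. *)
Lemma represents_integral n (c : 'I_n -> elementary A) U (t : nat -> R) K T D :
  represents At c U -> is_grid t K T (endpoints c) ->
  \sum_k el_integral D (c k) = \sum_(l < K) tact (U (t l)) (D (t l.+1) - D (t l)).
Proof.
move=> [cA UE] g.
rewrite [RHS](eq_bigr (fun l : 'I_K =>
    \sum_k tact (el_biprocess (c k) (t l)) (D (t l.+1) - D (t l)))); last first.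
  by move=> l _; rewrite UE tact_suml.
rewrite exchange_big /=; apply: eq_bigr => k _; have [_ ab _ _] := cA k.
rewrite /el_integral -(grid_telescope D g (endpoints_left c k) (endpoints_right c k) ab).
rewrite mulr_sumr mulr_suml; apply: eq_bigr => l _; rewrite /el_biprocess.
by case: ifP => _; rewrite ?tact_tens// tact0l mulr0 mul0r.
Qed.

Lemma seq_upper_bound (P : seq R) : exists2 T : R, 0 <= T & forall x, x \in P -> x <= T.
Proof.
elim: P => [|y P [T T0 IH]]; first by exists 0.
exists (Num.max y T); first by rewrite le_max T0 orbT.
by move=> x; rewrite inE le_max => /orP[/eqP ->|/IH ->]; rewrite ?lexx ?orbT.
Qed.

Lemma grid_of_points (P : seq R) (d : R) : (forall x, x \in P -> 0 <= x) -> 0 < d ->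
  exists K t T, is_grid t K T P /\ forall l, t l.+1 - t l <= d.
Proof.
move=> P0 d0; have [T T0 PT] := seq_upper_bound P.
have [|K [t h]] := grid_exists T0 _ d0 (P := P).
  by move=> x xP; rewrite P0// PT.
by exists K, t, T.
Qed.

Lemma represents_unique n (c : 'I_n -> elementary A) n' (c' : 'I_n' -> elementary A) U D :
  represents At c U -> represents At c' U ->
  \sum_k el_integral D (c k) = \sum_k el_integral D (c' k).
Proof.
move=> cU cU'.
have [|K [t [T [g _]]]] := @grid_of_points (endpoints c ++ endpoints c') 1 _ ltr01.
  by move=> x; rewrite mem_cat => /orP[h|h]; [exact: (endpoints_ge0 cU h)|exact: (endpoints_ge0 cU' h)].
rewrite (represents_integral D cU (t := t) (K := K) (T := T)); last first.
  by apply: is_grid_sub g => x xP; rewrite mem_cat xP.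
rewrite (represents_integral D cU' (t := t) (K := K) (T := T))//.
by apply: is_grid_sub g => x xP; rewrite mem_cat xP orbT.
Qed.

Lemma simple_integralE n (c : 'I_n -> elementary A) U D : represents At c U ->
  simple_integral At D U = \sum_k el_integral D (c k).
Proof.
move=> cU; apply: xget_subset1; first by exists n, c.
by move=> _ _ [n1 [c1 [r1 ->]]] [n2 [c2 [r2 ->]]]; exact: (represents_unique D r1 r2).
Qed.

Lemma represents_constant n (c : 'I_n -> elementary A) U s s' : represents At c U ->
  s <= s' -> (forall x, x \in endpoints c -> ~~ (s < x <= s')) -> U s = U s'.
Proof.
move=> [cA ->] ss' no; apply: eq_bigr => k _; rewrite /el_biprocess.
have mem x : x \in endpoints c -> (x <= s) = (x <= s').
  move=> /no; rewrite negb_and -!leNgt -ltNge => /orP[xs|sx].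
    by rewrite xs (le_trans xs ss').
  by rewrite leNgt (le_lt_trans ss' sx) leNgt sx.
by rewrite !ltNge (mem _ (endpoints_left c k)) (mem _ (endpoints_right c k)).
Qed.

(** The list [P] is that of the end points in some representation. *)
Lemma simple_on_grid U : simple_adapted At U -> exists P : seq R,
  [/\ forall x, x \in P -> 0 <= x,
      forall s s', s <= s' -> (forall x, x \in P -> ~~ (s < x <= s')) -> U s = U s' &
      forall (t : nat -> R) K T, is_grid t K T P ->
        U = cells t K (fun l => U (t l)) /\
        forall D, simple_integral At D U =
          \sum_(l < K) tact (U (t l)) (D (t l.+1) - D (t l))].
Proof.
move=> [n [c cU]]; exists (endpoints c); split.
- by move=> x h; exact: (endpoints_ge0 cU h).
- by move=> s s'; exact: represents_constant.
move=> t K T g; split; first exact: (represents_cells cU g).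
by move=> D; rewrite (simple_integralE D cU) (represents_integral D cU g).
Qed.

Lemma simple_tadapted U s : simple_adapted At U -> 0 <= s -> tadapted (At s) (U s).
Proof. by move=> [n [c cU]]; exact: (represents_adapted cU). Qed.

(** The integral is a function [y] of the integrator, so that the same
    computation serves for all the processes. *)
Definition simple_value U (y : (R -> A) -> A) : Prop :=
  simple_adapted At U /\ forall D, simple_integral At D U = y D.

Lemma simple_value0 : simple_value (fun=> 0) (fun=> 0).
Proof.
have r0 : represents At (fun k : 'I_0 => Elementary 0 0 0 0) (fun=> 0 : tensor A A).
  by split; [case|apply/funext => s; rewrite big_ord0].
split; first by exists 0%N, (fun k : 'I_0 => Elementary 0 0 0 0).
by move=> D; rewrite (simple_integralE D r0) big_ord0.
Qed.

Lemma simple_value_elementary (c : elementary A) : el_adapted At c ->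
  simple_value (el_biprocess c) (fun D => el_integral D c).
Proof.
move=> cA; have r1 : represents At (fun k : 'I_1 => c) (el_biprocess c).
  by split=> //; apply/funext => s; rewrite big_ord1.
split; first by exists 1%N, (fun k : 'I_1 => c).
by move=> D; rewrite (simple_integralE D r1) big_ord1.
Qed.

Lemma simple_valueD U U' y y' : simple_value U y -> simple_value U' y' ->
  simple_value (fun s => U s + U' s) (fun D => y D + y' D).
Proof.
move=> [[n [c cU]] yU] [[n' [c' cU']] yU'].
pose d k := match fintype.split k with inl i => c i | inr j => c' j end.
have dL i : d (lshift n' i) = c i.
  by rewrite /d -[lshift n' i]/(fintype.unsplit (inl i)) fintype.unsplitK.
have dR j : d (rshift n j) = c' j.
  by rewrite /d -[rshift n j]/(fintype.unsplit (inr j)) fintype.unsplitK.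
have r : represents At d (fun s => U s + U' s).
  split; first by move=> k; rewrite /d; case: (fintype.split k) => i; [apply cU.1|apply cU'.1].
  apply/funext => s; rewrite big_split_ord cU.2 cU'.2 /=.
  by congr (_ + _); apply: eq_bigr => i _; rewrite ?dL ?dR.
split; first by exists (n + n')%N, d.
move=> D; rewrite (simple_integralE D r) big_split_ord /= -yU -yU'.
rewrite (simple_integralE D cU) (simple_integralE D cU').
by congr (_ + _); apply: eq_bigr => i _; rewrite ?dL ?dR.
Qed.

Lemma simple_value_sum (I : eqType) (s : seq I) (U : I -> biprocess A) y :
  (forall i, i \in s -> simple_value (U i) (y i)) ->
  simple_value (fun r => \sum_(i <- s) U i r) (fun D => \sum_(i <- s) y i D).
Proof.
elim: s => [|i s IH] h.
  have -> : (fun r => \sum_(i <- [::]) U i r) = (fun=> 0).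
    by apply/funext => r; rewrite big_nil.
  have -> : (fun D => \sum_(i <- [::]) y i D) = (fun=> 0).
    by apply/funext => D; rewrite big_nil.
  exact: simple_value0.
have -> : (fun r => \sum_(j <- i :: s) U j r) = (fun r => U i r + \sum_(j <- s) U j r).
  by apply/funext => r; rewrite big_cons.
have -> : (fun D => \sum_(j <- i :: s) y j D) = (fun D => y i D + \sum_(j <- s) y j D).
  by apply/funext => D; rewrite big_cons.
apply: simple_valueD; first by apply: h; rewrite inE eqxx.
by apply: IH => j js; apply: h; rewrite inE js orbT.
Qed.

Lemma simple_value_tensor (a b : R) (x : tensor A A) : 0 <= a -> a <= b ->
  tadapted (At a) x ->
  simple_value (fun s => if a <= s < b then x else 0) (fun D => tact x (D b - D a)).
Proof.
move=> a0 ab [q qA ->].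
have -> : (fun s => if a <= s < b then \sum_(p <- q) tens p.1 p.2 else 0 : tensor A A) =
    (fun s => \sum_(p <- q) el_biprocess (Elementary a b p.1 p.2) s).
  by apply/funext => s; rewrite /el_biprocess /=; case: (a <= s < b) => //; rewrite big1.
have -> : (fun D => tact (\sum_(p <- q) tens p.1 p.2 : tensor A A) (D b - D a)) =
    (fun D => \sum_(p <- q) el_integral D (Elementary a b p.1 p.2)).
  by apply/funext => D; rewrite tact_suml; apply: eq_bigr => p _; rewrite tact_tens.
apply: (@simple_value_sum _ q (fun p => el_biprocess (Elementary a b p.1 p.2))
  (fun p D => el_integral D (Elementary a b p.1 p.2))) => p pq.
by apply: simple_value_elementary; have [? ?] := qA p pq.
Qed.

Lemma simple_value_cells (t : nat -> R) K (F : nat -> tensor A A) :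
  0 <= t 0%N -> {homo t : i j / (i <= j)%N >-> i <= j} ->
  (forall l, (l < K)%N -> tadapted (At (t l)) (F l)) ->
  simple_value (cells t K F) (fun D => \sum_(l < K) tact (F l) (D (t l.+1) - D (t l))).
Proof.
move=> t0 tm FA.
have E : (fun D => \sum_(l < K) tact (F l) (D (t l.+1) - D (t l))) =
    (fun D => \sum_(l <- index_enum 'I_K) tact (F l) (D (t l.+1) - D (t l))) by [].
rewrite E; apply: (@simple_value_sum _ (index_enum 'I_K)
  (fun (l : 'I_K) s => if t l <= s < t l.+1 then F l else 0)
  (fun (l : 'I_K) D => tact (F l) (D (t l.+1) - D (t l)))) => l _.
apply: simple_value_tensor; [|exact: tm|exact: FA].
exact: (le_trans t0 (tm _ _ (leq0n l))).
Qed.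

End SimpleIntegrals.

(** * Step functions and weak integrals *)

Section StepIntegrals.
Context (R : realType).
Implicit Types (t : nat -> R) (G : nat -> R).
Local Notation mu := (@lebesgue_measure R).
Local Notation HL := (half_line R).

Lemma measurable_half_line : measurable HL.
Proof. exact: measurable_itv. Qed.

Let indic_cell (a b : R) : 0 <= a -> a <= b ->
  mu.-integrable HL (EFin \o (\1_(`[a, b[%classic : set (measurableTypeR R)))) /\
  Rintegral mu HL (\1_(`[a, b[%classic : set (measurableTypeR R))) = b - a.
Proof.
move=> a0 ab; split.
  apply: (@integrableS _ _ _ mu setT) => //; first exact: measurable_half_line.
  exact: (integrable_indic_itv a b true true).
rewrite /Rintegral integral_indic; [|exact: measurable_half_line|exact: measurable_itv].
have -> : `[a, b[%classic `&` HL = `[a, b[%classic :> set R.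
  apply/seteqP; split => x /=; rewrite ?in_itv /=; first by case.
  by move=> /andP[h1 h2]; split; rewrite ?h1// /half_line /= in_itv /= andbT (le_trans a0).
have E : mu `[a, b[%classic = (if (a%:E < b%:E)%E then b%:E - a%:E else 0)%E.
  exact: lebesgue_measure_itv.
transitivity (fine (mu `[a, b[%classic)); first by [].
rewrite E lte_fin; case: ltP => // ba.
by apply/esym/eqP; rewrite subr_eq0 eq_le ba ab.
Qed.

Lemma cells_indic t K G (s : R) :
  cells t K G s = \sum_(l < K) G l * \1_(`[t l, t l.+1[%classic : set R) s.
Proof.
apply: eq_bigr => l _; rewrite indicE; case: ifPn => sl.
  by rewrite mem_set ?mulr1//= in_itv.
by rewrite memNset ?mulr0//= in_itv /=; exact/negP.
Qed.

Lemma step_integral t K G : 0 <= t 0%N -> {homo t : i j / (i <= j)%N >-> i <= j} ->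
  mu.-integrable HL (EFin \o (cells t K G : measurableTypeR R -> R)) /\
  Rintegral mu HL (cells t K G : measurableTypeR R -> R) =
    \sum_(l < K) (t l.+1 - t l) * G l.
Proof.
move=> t0 tm; pose f l : measurableTypeR R -> R := \1_(`[t l, t l.+1[%classic : set R).
have -> : (cells t K G : measurableTypeR R -> R) = fun s => \sum_(l < K) G l * f l s.
  by apply/funext => s; rewrite cells_indic.
have tl l : 0 <= t l by rewrite (le_trans t0)// tm.
have tS l : t l <= t l.+1 by exact: tm.
elim: K => [|K [IH1 IH2]].
  have -> : (fun s : measurableTypeR R => \sum_(l < 0) G l * f l s) = fun=> 0.
    by apply/funext => s; rewrite big_ord0.
  split; first exact: integrable0.
  by rewrite big_ord0 Rintegral_cst ?mul0r//; exact: measurable_half_line.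
have [i1 i2] := indic_cell (tl K) (tS K).
have -> : (fun s : measurableTypeR R => \sum_(l < K.+1) G l * f l s) =
    fun s => \sum_(l < K) G l * f l s + G K * f K s.
  by apply/funext => s; rewrite big_ord_recr.
have i3 : mu.-integrable HL (EFin \o (fun s => G K * f K s)).
  have := integrableZl measurable_half_line (G K) i1.
  by apply: eq_integrable => //; exact: measurable_half_line.
split.
  have := integrableD measurable_half_line IH1 i3.
  by apply: eq_integrable => //; exact: measurable_half_line.
rewrite RintegralD ?IH2//; last exact: measurable_half_line.
rewrite RintegralZl//; last exact: measurable_half_line.
by rewrite big_ord_recr /= i2 [G K * _]mulrC.
Qed.

Lemma step_measurable t K G : 0 <= t 0%N -> {homo t : i j / (i <= j)%N >-> i <= j} ->
  measurable_fun HL (cells t K G : measurableTypeR R -> R).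
Proof.
move=> t0 tm; have [/measurable_int h _] := step_integral K G t0 tm.
exact/measurable_EFinP.
Qed.

Lemma step_integral_ereal t K G : 0 <= t 0%N -> {homo t : i j / (i <= j)%N >-> i <= j} ->
  (\int[mu]_(s in HL) (cells t K G s)%:E)%E = (\sum_(l < K) (t l.+1 - t l) * G l)%:E.
Proof.
move=> t0 tm; have [h <-] := step_integral K G t0 tm.
by rewrite /Rintegral fineK// integrable_fin_num//; exact: measurable_half_line.
Qed.

End StepIntegrals.

Section WeakIntegrals.
Context (R : realType) (H : hilbert R).
Local Notation mu := (@lebesgue_measure R).
Local Notation HL := (half_line R).
Implicit Types (f g : R -> H) (z : H).
Let mH : measurable HL := @measurable_half_line R.

Lemma hintegral_unique f z z' : is_hintegral f z -> is_hintegral f z' -> z = z'.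
Proof.
move=> fz fz'; apply/eqP; rewrite -subr_eq0; apply/eqP/hnorm_eq0/eqP.
rewrite -sqrf_eq0 hnorm_sqr linearBl /= cReB.
by rewrite (fz (z - z')).2 (fz' (z - z')).2 subrr.
Qed.

Lemma hintegralB f g z z' : is_hintegral f z -> is_hintegral g z' ->
  is_hintegral (fun s => f s - g s) (z - z').
Proof.
move=> fz gz y; have [f1 f2] := fz y; have [g1 g2] := gz y.
have E : (fun s : measurableTypeR R => complex.Re (hdot (f s - g s) y)) =
    fun s => complex.Re (hdot (f s) y) - complex.Re (hdot (g s) y).
  by apply/funext => s; rewrite linearBl /= cReB.
split.
  have := integrableB mH f1 g1.
  by apply: eq_integrable => // s _; rewrite /= linearBl /= cReB EFinB.
rewrite E RintegralB//.
by rewrite linearBl /= cReB f2 g2.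
Qed.

Lemma hintegral_step (t : nat -> R) K (F : nat -> H) : 0 <= t 0%N ->
  {homo t : i j / (i <= j)%N >-> i <= j} ->
  is_hintegral (cells t K F) (\sum_(l < K) (t l.+1 - t l)%:C *: F l).
Proof.
move=> t0 tm y.
have E : (fun s => complex.Re (hdot (cells t K F s) y)) =
    cells t K (fun l => complex.Re (hdot (F l) y)).
  apply/funext => s; rewrite (@cells_map R H R t K F (fun v => complex.Re (hdot v y)) s tm)//.
  by rewrite linear0l.
have [h1 h2] := step_integral K (fun l => complex.Re (hdot (F l) y)) t0 tm.
rewrite -E in h1 h2; split; first exact: h1.
rewrite h2 linear_sumlz cRe_sum; apply: eq_bigr => l _.
by rewrite linearZl_LR /= cReM_real.
Qed.

Let itv0T (T : R) : 0 <= T ->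
  mu.-integrable HL (EFin \o (\1_(`[0, T[%classic : set (measurableTypeR R)))) /\
  Rintegral mu HL (\1_(`[0, T[%classic : set (measurableTypeR R))) = T.
Proof.
move=> T0; pose t (l : nat) : R := if l is 0%N then 0 else T.
have tm : {homo t : i j / (i <= j)%N >-> i <= j} by move=> [|i] [|j].
have [h1 h2] := @step_integral R t 1 (fun=> 1) (lexx 0) tm.
have E : (cells t 1 (fun=> 1) : measurableTypeR R -> R) =
    \1_(`[0, T[%classic : set (measurableTypeR R)).
  by apply/funext => s; rewrite cells_indic big_ord1 mul1r.
by rewrite E big_ord1 mulr1 subr0 in h1 h2.
Qed.

Lemma Rintegral_bound (T M : R) (g : measurableTypeR R -> R) : 0 <= T -> 0 <= M ->
  mu.-integrable HL (EFin \o g) ->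
  (forall s, `|g s| <= M * \1_(`[0, T[%classic : set (measurableTypeR R)) s) ->
  `|Rintegral mu HL g| <= T * M.
Proof.
move=> T0 M0 ig gM; have [i1 i2] := itv0T T0.
apply: (le_trans (le_normr_Rintegral mH ig)).
rewrite mulrC -{1}i2 -RintegralZl//; apply: le_Rintegral => //.
- exact: integrable_norm.
- have := integrableZl mH M i1.
  by apply: eq_integrable.
Qed.

Definition vanish_out (T : R) (V : nmodType) (f : R -> V) : Prop :=
  forall s, ~~ (0 <= s < T) -> f s = 0.

Let norm_indic T M (f : R -> H) (y : H) s : vanish_out T f -> 0 <= M ->
  (forall s, hnorm (f s) <= M) ->
  `|complex.Re (hdot (f s) y)| <=
     M * hnorm y * \1_(`[0, T[%classic : set (measurableTypeR R)) s.
Proof.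
move=> fT M0 fM; rewrite indicE; have [sT|sT] := boolP (0 <= s < T).
  rewrite mem_set ?mulr1 /= ?in_itv//.
  rewrite (le_trans (ler_Re_cabs _))// (le_trans (hdot_le _ _))//.
  by rewrite ler_wpM2r ?hnorm_ge0.
rewrite fT// linear0l normr0 mulr_ge0// ?mulr_ge0 ?hnorm_ge0//.
Qed.

(** The defining identity is tested on [z] itself. *)
Lemma hintegral_norm f z (T M : R) : 0 <= T -> 0 <= M -> is_hintegral f z ->
  vanish_out T f -> (forall s, hnorm (f s) <= M) -> hnorm z <= T * M.
Proof.
move=> T0 M0 fz fT fM; have [i1 i2] := fz z.
have [z0|z0] := eqVneq (hnorm z) 0; first by rewrite z0 mulr_ge0.
have z1 : 0 < hnorm z by rewrite lt_neqAle eq_sym z0 hnorm_ge0.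
rewrite -(ler_pM2r z1) -expr2 hnorm_sqr i2 -mulrA.
rewrite (le_trans (ler_norm _))//; apply: Rintegral_bound => //.
  by rewrite mulr_ge0 ?hnorm_ge0.
by move=> s; exact: norm_indic.
Qed.

(** On a bounded interval the integrals of a uniformly convergent sequence form a
    Cauchy sequence, whose limit is the weak integral of the limit. *)
Lemma hintegral_uniform_limit (T : R) (f : R -> H) (F : nat -> R -> H)
    (z : nat -> H) (e : nat -> R) : 0 <= T ->
  vanish_out T f -> (forall m, vanish_out T (F m)) ->
  (forall m, is_hintegral (F m) (z m)) ->
  (forall m s, hnorm (F m s - f s) <= e m) -> e n @[n --> \oo] --> (0 : R) ->
  exists l, is_hintegral f l.
Proof.
move=> T0 fT FT Fz Fe e0.
have ege0 m : 0 <= e m by rewrite (le_trans _ (Fe m 0))// hnorm_ge0.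
have dz m n : hnorm (z m - z n) <= T * (e m + e n).
  apply: (hintegral_norm T0 _ (hintegralB (Fz m) (Fz n))); first by rewrite addr_ge0.
    by move=> s sT; rewrite !FT// subrr.
  move=> s; have -> : F m s - F n s = (F m s - f s) - (F n s - f s).
    by rewrite opprB addrA subrK.
  by rewrite (le_trans (hnorm_triangleB _ _))// lerD.
have Te0 : T * e n @[n --> \oo] --> (0 : R).
  by rewrite -[0](mulr0 T); exact: cvgMl_tmp.
have [|l zl] := @hil_complete R H z.
  move=> d d0; have /cvgrPdist_lt/(_ (d / 2)) := Te0.
  rewrite divr_gt0// => /(_ isT)[n0 _ hn0]; exists n0 => m n m0 nn0.
  apply: (le_lt_trans (dz m n)); rewrite mulrDr.
  have := hn0 m m0; have := hn0 n nn0; rewrite /= !sub0r !normrN => h1 h2.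
  have := ler_norm (T * e m); have := ler_norm (T * e n); lra.
have measf y : measurable_fun HL
    ((fun s => complex.Re (hdot (f s) y)) : measurableTypeR R -> R).
  apply: (@measurable_fun_cvg _ _ _ _ (fun m s => complex.Re (hdot (F m s) y))).
    by move=> m; have [/measurable_int/measurable_EFinP] := Fz m y.
  move=> s _; apply/subr_cvg0/norm_cvg0P.
  apply: (cvg0_le (g := fun m => e m * hnorm y)); last first.
    by rewrite -[0](mul0r (hnorm y)); exact: cvgMr_tmp.
  move=> m; rewrite normr_ge0 /= -cReB -linearBl /=.
  rewrite (le_trans (ler_Re_cabs _))// (le_trans (hdot_le _ _))//.
  by rewrite ler_wpM2r ?hnorm_ge0.
have intf y : mu.-integrable HL
    (EFin \o ((fun s => complex.Re (hdot (f s) y)) : measurableTypeR R -> R)).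
    pose B : measurableTypeR R -> R := fun s => `|complex.Re (hdot (F 0%N s) y)| +
    e 0%N * hnorm y * \1_(`[0, T[%classic : set (measurableTypeR R)) s.
  have iB : mu.-integrable HL (EFin \o B).
    have [i1 _] := Fz 0%N y; have [i2 _] := itv0T T0.
    have i3 := integrableZl mH (e 0%N * hnorm y) i2.
    have := integrableD mH (integrable_norm i1) i3.
    by apply: eq_integrable.
  apply: (le_integrable mH _ _ iB); first exact/measurable_EFinP.
  move=> s _; rewrite /= lee_fin [leRHS]ger0_norm; last first.
    by rewrite addr_ge0// mulr_ge0// mulr_ge0// hnorm_ge0.
  have -> : f s = F 0%N s - (F 0%N s - f s) by rewrite opprB addrC subrK.
  rewrite linearBl /= cReB (le_trans (ler_normB _ _))// lerD2l.
  apply: (norm_indic (f := fun s => F 0%N s - f s)) => // r rT.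
  by rewrite fT// FT// subrr.
exists l => y; split; first exact: intf.
have h1 : complex.Re (hdot (z n) y) @[n --> \oo] --> complex.Re (hdot l y).
  apply/subr_cvg0/norm_cvg0P.
  apply: (cvg0_le (g := fun n => hnorm (z n - l) * hnorm y)); last first.
    by rewrite -[0](mul0r (hnorm y)); exact: cvgMr_tmp.
  move=> n; rewrite normr_ge0 /= -cReB -linearBl /=.
  by rewrite (le_trans (ler_Re_cabs _))// hdot_le.
have h2 : complex.Re (hdot (z n) y) @[n --> \oo] -->
    Rintegral mu HL (fun s => complex.Re (hdot (f s) y)).
  apply/subr_cvg0/norm_cvg0P.
  apply: (cvg0_le (g := fun n => T * e n * hnorm y)); last first.
    by rewrite -[0](mul0r (hnorm y)); exact: cvgMr_tmp.
  move=> n; rewrite normr_ge0 /=; have [i1 ->] := Fz n y.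
    rewrite -RintegralB// -mulrA.
  have iB : mu.-integrable HL (EFin \o ((fun s => complex.Re (hdot (F n s) y) -
      complex.Re (hdot (f s) y)) : measurableTypeR R -> R)).
    by have := integrableB mH i1 (intf y); apply: eq_integrable.
  apply: (Rintegral_bound T0 _ iB); first by rewrite mulr_ge0 ?hnorm_ge0.
  move=> s; rewrite -cReB -linearBl; apply: (norm_indic (f := fun s => F n s - f s)) => //.
  by move=> r rT; rewrite fT// FT// subrr.
exact: (cvg_unique _ h1 h2).
Qed.

End WeakIntegrals.

(** * The Ito isometry *)

Section Ito.
Context (R : realType) (A : tracialVN R) (L2 : L2_space A) (At : R -> set A).
Context (D : nat -> R -> A) (c : nat -> R).
Hypothesis fil : filtration At.
Hypothesis ito : ito_family L2 At D c.
Local Notation n2 a := (hnorm (toL2 L2 a)).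
Local Notation incr k s t := (D k t - D k s).

Lemma tnorm_sqr (x : tensor A A) : (tnorm x ^+ 2)%:C = tdot x x.
Proof. exact/esym/(@hdotxx R (tensorH A) x). Qed.

Lemma phi_tact k s t w y : (0 < k)%N -> 0 <= s -> s <= t -> At s w ->
  tadapted (At s) y ->
  phi (w * tact y (incr k s t)) = (c k * (t - s))%:C * phi (w * tmul y).
Proof.
move=> k0 s0 st Aw [q qA ->]; have sB := filtration_sub fil s0.
rewrite tmulE !tact_suml !mulr_sumr !linear_sum mulr_sumr big_seq [RHS]big_seq /=.
apply: eq_bigr => p /qA[h1 h2]; rewrite !tact_tens mulr1 !mulrA phi_trace !mulrA.
rewrite (ito_mean ito k0 s0 st); last by do 2!apply: (subalgM sB) => //.
by rewrite -!mulrA phi_trace -!mulrA.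
Qed.

Lemma phi_tact2 k s t x y : (0 < k)%N -> 0 <= s -> s <= t ->
  tadapted (At s) x -> tadapted (At s) y ->
  phi (star (tact x (incr k s t)) * tact y (incr k s t)) =
  (c (k + k)%N * (t - s))%:C * tdot y x +
  (c k * (t - s) * (c k * (t - s)))%:C * phi (star (tmul x) * tmul y).
Proof.
move=> k0 s0 st [q qA ->] [q' qA' ->]; have sB := filtration_sub fil s0.
set d := incr k s t; have ds : star d = d := ito_star ito k0 s0 st.
set C1 : R[i] := (_ * (t - s))%:C; set C2 : R[i] := (_ * _ * _)%:C.
have elem p p' : At s p.1 -> At s p.2 -> At s p'.1 -> At s p'.2 ->
    phi (star (p.1 * d * p.2) * (p'.1 * d * p'.2)) =
    C1 * tdot (tens p'.1 p'.2) (tens p.1 p.2) +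
    C2 * phi (star (p.1 * p.2) * (p'.1 * p'.2)).
  move=> h1 h2 h1' h2'; have h1s := subalg_star sB h1; have h2s := subalg_star sB h2.
  rewrite tdot_tens !starM ds.
  have -> : phi (star p.2 * (d * star p.1) * (p'.1 * d * p'.2)) =
      phi (p'.2 * star p.2 * d * (star p.1 * p'.1) * d).
    by rewrite !mulrA phi_trace !mulrA.
  rewrite (ito_covariance ito k0 k0 s0 st); last 2 first.
  - exact: (subalgM sB).
  - exact: (subalgM sB).
  rewrite addrC; congr (_ * _ + _ * _); first by rewrite mulrC.
  by rewrite -!mulrA phi_trace !mulrA.
have dsum (f g : A * A -> A) : phi (star (\sum_(p <- q) f p) * (\sum_(p <- q') g p)) =
    \sum_(p <- q) \sum_(p' <- q') phi (star (f p) * g p').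
  rewrite star_sum mulr_suml linear_sum; apply: eq_bigr => p _.
  by rewrite mulr_sumr linear_sum.
have tsum2 : tdot (\sum_(p <- q') tens p.1 p.2) (\sum_(p <- q) tens p.1 p.2) =
    \sum_(p <- q) \sum_(p' <- q') tdot (tens p'.1 p'.2) (tens p.1 p.2).
  rewrite tdot_suml exchange_big; apply: eq_bigr => p' _.
  by rewrite tdot_sumr.
rewrite !tmulE !tact_suml !dsum tsum2 !mulr_sumr -big_split big_seq [RHS]big_seq.
apply: eq_bigr => p /qA[h1 h2]; rewrite !mulr_sumr -big_split big_seq [RHS]big_seq.
apply: eq_bigr => p' /qA'[h1' h2']; rewrite /= !tact_tens !mulr1.
exact: elem.
Qed.

(* One term of the integral minus its drift; it is orthogonal to the past. *)
Let ctact k s t x := tact x (incr k s t) - (c k * (t - s))%:C *: tmul x.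

Lemma tmul_adapted s x : 0 <= s -> tadapted (At s) x -> At s (tmul x).
Proof.
move=> s0 Ax; have sB := filtration_sub fil s0.
by rewrite tmulE; apply: (tact_adapted sB) => //; exact: subalg1.
Qed.

Lemma phi_ctact k s t w y : (0 < k)%N -> 0 <= s -> s <= t -> At s w ->
  tadapted (At s) y -> phi (w * ctact k s t y) = 0.
Proof.
move=> k0 s0 st Aw Ay; rewrite /ctact mulrBr linearB -scalerAr linearZ /=.
by rewrite phi_tact// subrr.
Qed.

Lemma n2_ctact k s t x : (0 < k)%N -> 0 <= s -> s <= t -> tadapted (At s) x ->
  n2 (ctact k s t x) ^+ 2 = c (k + k)%N * ((t - s) * tnorm x ^+ 2).
Proof.
move=> k0 s0 st Ax; have sB := filtration_sub fil s0.
have Am := tmul_adapted s0 Ax.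
apply: (@complexI R); rewrite n2_sqr {1}/ctact starB mulrBl linearB /=.
rewrite starZ conj_real -scalerAl linearZ /=.
rewrite [phi (star (tmul x) * _)]phi_ctact//; last exact: (subalg_star sB).
rewrite mulr0 subr0 /ctact mulrBr linearB -scalerAr linearZ /= phi_tact2//.
have -> : phi (star (tact x (incr k s t)) * tmul x) =
    (c k * (t - s))%:C * phi (star (tmul x) * tmul x).
  rewrite -[LHS]conjCK -phi_star starM starK phi_tact//; last exact: (subalg_star sB).
  rewrite rmorphM /= conj_real -phi_star starM starK //.
set Q := phi (star (tmul x) * tmul x).
rewrite [X in _ - X]mulrA -[X in _ - X * Q]rmorphM addrK -tnorm_sqr -rmorphM.
by rewrite -mulrA.
Qed.

(** Without the drift the terms are exactly orthogonal. *)
Lemma ito_isometry k (t : nat -> R) K (x : nat -> tensor A A) : (0 < k)%N ->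
  0 <= t 0%N -> {homo t : i j / (i <= j)%N >-> i <= j} ->
  (forall l, (l < K)%N -> tadapted (At (t l)) (x l)) ->
  n2 (\sum_(l < K) ctact k (t l) (t l.+1) (x l)) ^+ 2 =
  c (k + k)%N * \sum_(l < K) (t l.+1 - t l) * tnorm (x l) ^+ 2.
Proof.
move=> k0 t0 tm; have tl l : 0 <= t l by rewrite (le_trans t0)// tm.
have tS l : t l <= t l.+1 by exact: tm.
elim: K => [|K IH] xA; first by rewrite !big_ord0 linear0 hnorm0 expr0n mulr0.
rewrite !big_ord_recr /= n2D_sqr IH; last by move=> l lK; apply: xA; exact: ltnW.
rewrite n2_ctact//; last exact: xA.
rewrite [RHS]mulrDr.
rewrite phi_ctact// ?mulr0 ?addr0//; last exact: xA.
have sB := filtration_sub fil (tl K); apply: (subalg_star sB).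
apply: (subalg_sum sB) => l _; have lK := ltn_ord l.
have Ax : tadapted (At (t l)) (x l) by apply: xA; exact: ltnW.
have up a : At (t l.+1) a -> At (t K) a by apply: (filtration_le fil) => //; exact: tm.
have upl a : At (t l) a -> At (t l.+1) a by apply: (filtration_le fil).
apply: up; have sB' := filtration_sub fil (tl l.+1).
apply: (subalgB sB'); last first.
  by apply: (subalgZ sB'); apply: upl; exact: tmul_adapted.
apply: (tact_adapted sB'); first by apply: tadapted_incl Ax.
exact: (ito_adapted ito).
Qed.

(** The two quantities on the right are those that tend to 0 in the definition of
    an approximating sequence. *)
Lemma ito_bound k (t : nat -> R) K (x : nat -> tensor A A) : (0 < k)%N ->
  0 <= t 0%N -> {homo t : i j / (i <= j)%N >-> i <= j} ->
  (forall l, (l < K)%N -> tadapted (At (t l)) (x l)) ->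
  n2 (\sum_(l < K) tact (x l) (incr k (t l) (t l.+1))) <=
  Num.sqrt (`|c (k + k)%N| * \sum_(l < K) (t l.+1 - t l) * tnorm (x l) ^+ 2) +
  `|c k| * n2 (\sum_(l < K) (t l.+1 - t l)%:C *: tmul (x l)).
Proof.
move=> k0 t0 tm xA.
have -> : \sum_(l < K) tact (x l) (incr k (t l) (t l.+1)) =
    \sum_(l < K) ctact k (t l) (t l.+1) (x l) +
    (c k)%:C *: \sum_(l < K) (t l.+1 - t l)%:C *: tmul (x l).
  rewrite scaler_sumr -big_split; apply: eq_bigr => l _.
  by rewrite /ctact /= scalerA -rmorphM subrK.
rewrite linearD linearZ (le_trans (hnorm_triangle _ _))// hnormZ cabs_real lerD2r.
have S0 : 0 <= \sum_(l < K) (t l.+1 - t l) * tnorm (x l) ^+ 2.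
  by apply: sumr_ge0 => l _; rewrite mulr_ge0 ?sqr_ge0// subr_ge0 tm.
rewrite -(@ler_pXn2r _ 2) ?nnegrE ?hnorm_ge0 ?sqrtr_ge0//.
rewrite (ito_isometry k0 t0 tm xA) sqr_sqrtr ?mulr_ge0//.
by rewrite ler_wpM2r// ler_norm.
Qed.

End Ito.

(** * Approximation and the stochastic integral *)

Section Approximation.
Context (R : realType) (A : tracialVN R) (L2 : L2_space A) (At : R -> set A).
Context (D : nat -> R -> A) (c : nat -> R).
Hypothesis fil : filtration At.
Hypothesis ito : ito_family L2 At D c.
Local Notation n2 a := (hnorm (toL2 L2 a)).
Local Notation mu := (@lebesgue_measure R).
Local Notation HL := (half_line R).
Implicit Types (U W : biprocess A).
Let mH : measurable HL := @measurable_half_line R.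

Lemma cellsB (V : zmodType) (t : nat -> R) K (F G : nat -> V) s :
  cells t K F s - cells t K G s = cells t K (fun l => F l - G l) s.
Proof. by rewrite /cells -sumrB; apply: eq_bigr => l _; case: ifP; rewrite ?subr0. Qed.

Lemma tmulB (x y : tensor A A) : tmul (x - y) = tmul x - tmul y.
Proof. by rewrite !tmulE tactBl. Qed.

Lemma tmul0 : tmul (0 : tensor A A) = 0.
Proof. by rewrite tmulE tact0l. Qed.

Lemma tmulN (x : tensor A A) : tmul (- x) = - tmul x.
Proof. by rewrite -[- x]sub0r tmulB tmul0 sub0r. Qed.

Lemma tnorm0 : tnorm (0 : tensor A A) = 0.
Proof. by rewrite tnormE hnorm0. Qed.

(** Both biprocesses are step functions on a common grid, on which [ito_bound]
    applies to their difference. *)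
Lemma simple_dist U U' k : (0 < k)%N -> simple_adapted At U -> simple_adapted At U' ->
  exists (I : R) (z : L2), [/\ 0 <= I,
    measurable_fun HL ((fun s => tnorm (U s - U' s)) : measurableTypeR R -> R),
    (\int[mu]_(s in HL) (tnorm (U s - U' s) ^+ 2)%:E)%E = I%:E,
    is_hintegral (fun s => toL2 L2 (tmul (U s - U' s))) z &
    n2 (simple_integral At (D k) U - simple_integral At (D k) U') <=
      Num.sqrt (`|c (k + k)%N| * I) + `|c k| * hnorm z].
Proof.
move=> k0 sU sU'; have [P [P0 _ hP]] := simple_on_grid sU.
have [P' [P'0 _ hP']] := simple_on_grid sU'.
have [|K [t [T [g _]]]] := @grid_of_points R (P ++ P') 1 _ ltr01.
  by move=> x; rewrite mem_cat => /orP[/P0|/P'0].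
have g1 : is_grid t K T P by apply: is_grid_sub g => x; rewrite mem_cat => ->.
have g2 : is_grid t K T P' by apply: is_grid_sub g => x; rewrite mem_cat orbC => ->.
have [UE UI] := hP t K T g1; have [UE' UI'] := hP' t K T g2.
have tm := grid_mono g; have t0 : 0 <= t 0%N := grid_ge0 0 g.
pose x l := U (t l) - U' (t l).
have dE s : U s - U' s = cells t K x s by rewrite {1}UE {1}UE' cellsB.
have nE : (fun s => tnorm (U s - U' s)) = cells t K (fun l => tnorm (x l)).
  apply/funext => s; rewrite dE (@cells_map _ _ _ t K x (@tnorm R A) s tm)//.
  exact: tnorm0.
have n2E : (fun s => tnorm (U s - U' s) ^+ 2) = cells t K (fun l => tnorm (x l) ^+ 2).
  apply/funext => s; rewrite dE.
  rewrite (@cells_map _ _ _ t K x (fun y => tnorm y ^+ 2) s tm)//.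
  by rewrite tnorm0 expr0n.
have zE : (fun s => toL2 L2 (tmul (U s - U' s))) =
    cells t K (fun l => toL2 L2 (tmul (x l))).
  apply/funext => s; rewrite dE.
  rewrite (@cells_map _ _ _ t K x (fun y => toL2 L2 (tmul y)) s tm)//.
  by rewrite tmul0 linear0.
exists (\sum_(l < K) (t l.+1 - t l) * tnorm (x l) ^+ 2).
exists (\sum_(l < K) (t l.+1 - t l)%:C *: toL2 L2 (tmul (x l))); split.
- by apply: sumr_ge0 => l _; rewrite mulr_ge0 ?sqr_ge0// subr_ge0 tm.
- by rewrite nE; exact: step_measurable.
- have -> : (fun s : measurableTypeR R => (tnorm (U s - U' s) ^+ 2)%:E) =
      (fun s => (cells t K (fun l => tnorm (x l) ^+ 2) s)%:E).
    by apply/funext => s; rewrite -n2E.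
  exact: step_integral_ereal.
- by rewrite zE; exact: hintegral_step.
have -> : \sum_(l < K) (t l.+1 - t l)%:C *: toL2 L2 (tmul (x l)) =
    toL2 L2 (\sum_(l < K) (t l.+1 - t l)%:C *: tmul (x l)).
  by rewrite linear_sum; apply: eq_bigr => l _; rewrite linearZ.
rewrite UI UI' -sumrB.
under [X in n2 X]eq_bigr do rewrite -tactBl.
apply: (ito_bound fil ito k0 t0 tm) => l lK; have tl := grid_ge0 l g.
by apply: (tadaptedB (filtration_sub fil tl)); apply: (simple_tadapted fil).
Qed.

(** Hence the limit of the integrals does not depend on the approximating
    sequence.  The first few integrals may be infinite, so the estimate is made
    in the extended reals. *)
Lemma approximates_close (W_ W_' : nat -> biprocess A) W k : (0 < k)%N -> approximates L2 At W_ W ->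
  approximates L2 At W_' W ->
  n2 (simple_integral At (D k) (W_ n) - simple_integral At (D k) (W_' n))
    @[n --> \oo] --> (0 : R).
Proof.
move=> k0 [s1 m1 i1 [z1 [h1 c1]]] [s2 m2 i2 [z2 [h2 c2]]].
have [I hI] := choice (fun n => simple_dist k0 (s1 n) (s2 n)).
have [z hz] := choice hI.
have I0 : I n @[n --> \oo] --> (0 : R).
  suff : (I n)%:E @[n --> \oo] --> 0%E by move=> /fine_cvg.
  pose a (W_ : nat -> biprocess A) n : \bar R :=
    (\int[mu]_(s in HL) (tnorm (W_ n s - W s) ^+ 2)%:E)%E.
  have u0 : (2%:E * a W_ n + 2%:E * a W_' n)%E @[n --> \oo] --> 0%E.
    have a0 V : a V n @[n --> \oo] --> 0%E -> (2%:E * a V n)%E @[n --> \oo] --> 0%E.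
      by move=> h; rewrite -(mule0 2%:E); exact: (cvgeZl _ h).
    by rewrite -[0%E]adde0; exact: (cvgeD _ (a0 _ i1) (a0 _ i2)).
  apply: (squeeze_cvge _ (cvg_cst 0%E) u0); apply: nearW => n.
  have [In0 mIn In _ _] := hz n; rewrite lee_fin In0 /= -In.
  have me (V : nat -> biprocess A) : (forall n, measurable_fun HL
        ((fun s => tnorm (V n s - W s)) : measurableTypeR R -> R)) ->
      measurable_fun HL (fun s : measurableTypeR R => (tnorm (V n s - W s) ^+ 2)%:E).
    by move=> mV; apply/measurable_EFinP; exact: measurable_funX.
  rewrite -!ge0_integralZl_EFin//; try exact: me.
  - rewrite -ge0_integralD//.
    + apply: ge0_le_integral => //.
      * by move=> s _; rewrite lee_fin sqr_ge0.
      * by apply/measurable_EFinP; exact: measurable_funX.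
      * by apply: emeasurable_funD; apply: emeasurable_funM => //; exact: me.
      move=> s _; rewrite -!EFinM -EFinD lee_fin.
      have -> : W_ n s - W_' n s = (W_ n s - W s) - (W_' n s - W s).
        by rewrite opprB addrA subrK.
      rewrite !tnormE -[hnorm (W_' n s - W s : tensorH A)]hnorm_opp.
      exact: hnormD_sqr_le.
    + by move=> s _; rewrite mule_ge0// lee_fin sqr_ge0.
    + by apply: emeasurable_funM => //; exact: me.
    + by move=> s _; rewrite mule_ge0// lee_fin sqr_ge0.
    + by apply: emeasurable_funM => //; exact: me.
  - by move=> s _; rewrite lee_fin sqr_ge0.
  - by move=> s _; rewrite lee_fin sqr_ge0.
have z0 : hnorm (z n) @[n --> \oo] --> (0 : R).
  apply: (cvg0_le (g := fun n => hnorm (z1 n) + hnorm (z2 n))) => [n|].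
    rewrite hnorm_ge0 /=; have [_ _ _ h _] := hz n.
    have -> : z n = z1 n - z2 n.
      apply: (hintegral_unique h); have := hintegralB (h1 n) (h2 n).
      congr is_hintegral; apply/funext => s; rewrite -linearB -tmulB.
      by rewrite opprB addrA subrK.
    exact: hnorm_triangleB.
  by rewrite -[0]addr0; exact: cvgD.
apply: (cvg0_le (g := fun n => Num.sqrt (`|c (k + k)%N| * I n) + `|c k| * hnorm (z n))).
  by move=> n; rewrite hnorm_ge0 /=; have [_ _ _ _] := hz n.
rewrite -[0]addr0; apply: cvgD; last first.
  by rewrite -[X in _ --> X](mulr0 `|c k|); exact: cvgMl_tmp.
rewrite -[X in _ --> X]sqrtr0; apply: continuous_cvg; first exact: sqrt_continuous.
by rewrite -[X in _ --> X](mulr0 `|c (k + k)%N|); exact: cvgMl_tmp.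
Qed.

Lemma is_integral_of_limit W (W_ : nat -> biprocess A) (Y : L2) k : (0 < k)%N -> adapted At W ->
  approximates L2 At W_ W ->
  hcvg (fun n => toL2 L2 (simple_integral At (D k) (W_ n))) Y ->
  is_integral At (D k) W Y.
Proof.
move=> k0 aW apW cY; split=> // [|W_' apW']; first by exists W_.
have := approximates_close k0 apW' apW.
under eq_fun do rewrite linearB.
exact: hcvg_near cY.
Qed.

Lemma is_integral_unique W (Y Y' : L2) k :
  is_integral At (D k) W Y -> is_integral At (D k) W Y' -> Y = Y'.
Proof. by move=> [_ [W_ /[dup] ap _] /(_ W_ ap) h1] [_ _ /(_ W_ ap)]; exact: hcvg_unique. Qed.

Lemma stochastic_integralE W (Y : L2) k : is_integral At (D k) W Y ->
  stochastic_integral L2 At (D k) W = Y.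
Proof.
move=> h; apply: xget_unique => // Y' h'; exact: is_integral_unique h' h.
Qed.

End Approximation.

(** * Integrals of Hoelder biprocesses *)

Section HolderBiprocesses.
Context (R : realType) (A : tracialVN R) (L2 : L2_space A) (At : R -> set A).
Context (D : nat -> R -> A) (c : nat -> R).
Hypothesis fil : filtration At.
Hypothesis ito : ito_family L2 At D c.
Local Notation n2 a := (hnorm (toL2 L2 a)).
Local Notation mu := (@lebesgue_measure R).
Local Notation HL := (half_line R).
Implicit Types (U W : biprocess A).
Let mH : measurable HL := @measurable_half_line R.

(** If the integrals were not a Cauchy sequence, two subsequences would stay at a
    positive distance although both approximate [W]. *)
Lemma approximates_cauchy (W_ : nat -> biprocess A) W k : (0 < k)%N ->
  approximates L2 At W_ W ->
  exists Y, hcvg (fun n => toL2 L2 (simple_integral At (D k) (W_ n))) Y.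
Proof.
move=> k0 ap; apply: hil_complete => e e0; apply: contrapT => noN.
have bad n0 : exists p : nat * nat, [/\ (n0 <= p.1)%N, (n0 <= p.2)%N &
    e <= hnorm (toL2 L2 (simple_integral At (D k) (W_ p.1)) -
                toL2 L2 (simple_integral At (D k) (W_ p.2)))].
  apply: contrapT => nop; apply: noN; exists n0 => m n m0 n0n.
  rewrite ltNge; apply/negP => le; apply: nop; by exists (m, n).
have [p hp] := choice bad.
have sub (f : nat -> nat) : (forall n, (n <= f n)%N) ->
    approximates L2 At (fun n => W_ (f n)) W.
  move=> fn; have ft : f n @[n --> \oo] --> \oo.
    by move=> S [N _ hN]; exists N => // n /= Nn; apply: hN; exact: leq_trans (fn n).
  have [s1 m1 i1 [z [hz cz]]] := ap; split.
  - by move=> n.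
  - by move=> n; exact: m1.
  - exact: (cvg_comp _ _ ft i1).
  - by exists (fun n => z (f n)); split=> //; exact: (cvg_comp _ _ ft cz).
have sp1 : approximates L2 At (fun n => W_ (p n).1) W.
  by apply: (sub (fun n => (p n).1)) => n; have [] := hp n.
have sp2 : approximates L2 At (fun n => W_ (p n).2) W.
  by apply: (sub (fun n => (p n).2)) => n; have [] := hp n.
have := approximates_close fil ito k0 sp1 sp2 => /(cvg0_eq (c := e)).
rewrite leNgt e0 => H; suff : ~~ true by []; apply: H => n.
by rewrite linearB; have [] := hp n.
Qed.

(** A 1/2-Hoelder condition away from the points of [P]. *)
Record piecewise_holder (T C : R) (P : seq R) (W : biprocess A) : Prop :=
  PiecewiseHolder {
  holder_vanish : vanish_out T W;
  holder_tnorm : forall s s', 0 <= s -> s <= s' ->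
    (forall x, x \in P -> ~~ (s < x <= s')) ->
    tnorm (W s - W s') <= C * Num.sqrt (s' - s);
  holder_tmul : forall s s', 0 <= s -> s <= s' ->
    (forall x, x \in P -> ~~ (s < x <= s')) ->
    n2 (tmul (W s - W s')) <= C * Num.sqrt (s' - s) }.

(** A breakpoint after [t l] is a later grid point, hence not before [t l.+1]. *)
Lemma grid_cell_breakpoint (t : nat -> R) K T P l s x : is_grid t K T P ->
  t l <= s < t l.+1 -> x \in P -> ~~ (t l < x <= s).
Proof.
move=> g /andP[_ s2] /(grid_mem g)[l' _ <-]; apply/negP => /andP[h1 h2].
have [ll|ll] := leqP l' l.
  by have := grid_mono g ll; rewrite leNgt h1.
by have := grid_mono g ll; rewrite leNgt (le_lt_trans h2).
Qed.

Lemma cells_vanish (V : nmodType) (t : nat -> R) K T P (F : nat -> V) :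
  is_grid t K T P -> vanish_out T (cells t K F).
Proof.
move=> g s sT; apply: cells_out => l lK; apply: contra sT => /andP[h1 h2].
rewrite (le_trans (grid_ge0 l g) h1) (lt_le_trans h2)// -(gridT g).
exact: (grid_mono g).
Qed.

Lemma holder_sample (t : nat -> R) K T C P (e : R) W s : is_grid t K T P ->
  (forall l, t l.+1 - t l <= e) -> 0 <= C -> piecewise_holder T C P W ->
  tnorm (cells t K (fun l => W (t l)) s - W s) <=
    cells t K (fun=> C * Num.sqrt e) s /\
  n2 (tmul (cells t K (fun l => W (t l)) s - W s)) <= C * Num.sqrt e.
Proof.
move=> g te C0 hW; have tm := grid_mono g.
have [[l lK sl]|out] := cells_cases t K s.
  rewrite !(cells_in _ tm lK sl); have [s1 s2] := andP sl.
  have s0 : 0 <= t l := grid_ge0 l g.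
  have P0 x : x \in P -> ~~ (t l < x <= s) by exact: (grid_cell_breakpoint g sl).
  have le : C * Num.sqrt (s - t l) <= C * Num.sqrt e.
    rewrite ler_wpM2l// ler_wsqrtr// (le_trans _ (te l))// lerD2r; exact: ltW.
  by split; apply: (le_trans _ le); [exact: (holder_tnorm hW)|exact: (holder_tmul hW)].
rewrite !cells_out// (holder_vanish hW) ?subrr ?tnorm0 ?tmul0 ?linear0 ?hnorm0//.
  by rewrite mulr_ge0 ?sqrtr_ge0.
apply/negP => sT; have [|l lK sl] := @in_some_cell R t K s.
  by rewrite (grid0 g) (gridT g).
by move: (out l lK); rewrite sl.
Qed.

(** The samples converge to [W] uniformly for both norms, at the rate of the
    square root of the mesh.  The distance to [W] is measurable as a pointwise
    limit of distances between step functions. *)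
Lemma holder_approximates (t : nat -> nat -> R) (K : nat -> nat) (e : nat -> R)
    T C P W : 0 <= T -> 0 <= C ->
  (forall n, is_grid (t n) (K n) T P) ->
  (forall n l, t n l.+1 - t n l <= e n) -> e n @[n --> \oo] --> (0 : R) ->
  adapted At W -> piecewise_holder T C P W ->
  approximates L2 At (fun n => cells (t n) (K n) (fun l => W (t n l))) W.
Proof.
move=> T0 C0 g te e0 aW hW.
pose W_ n : biprocess A := cells (t n) (K n) (fun l => W (t n l)).
have tm n := grid_mono (g n); have t0 n : 0 <= t n 0%N := grid_ge0 0 (g n).
have samp n s := holder_sample s (g n) (te n) C0 hW.
have ege0 n : 0 <= e n by rewrite (le_trans _ (te n 0%N))// subr_ge0 tm.
have Ce0 n : 0 <= C * Num.sqrt (e n) by rewrite mulr_ge0 ?sqrtr_ge0.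
have se0 : C * Num.sqrt (e n) @[n --> \oo] --> (0 : R).
  rewrite -[X in _ --> X](mulr0 C); apply: cvgMl_tmp.
  by rewrite -[X in _ --> X]sqrtr0; apply: continuous_cvg => //; exact: sqrt_continuous.
have cells_le n (b : R) s : 0 <= b -> cells (t n) (K n) (fun=> b) s <= b.
  move=> b0; have [[l lK sl]|out] := cells_cases (t n) (K n) s.
    by rewrite (cells_in _ (tm n) lK sl).
  by rewrite cells_out.
have sW n : simple_adapted At (W_ n).
  have [] // := @simple_value_cells R A At (t n) (K n) (fun l => W (t n l)) (t0 n) (tm n).
  by move=> l _; apply/tadapted_ord; apply: aW; exact: grid_ge0 (g n).
have dist1 (x y : nat) s : W_ x s - W_ y s = (W_ x s - W s) - (W_ y s - W s).
  by rewrite opprB addrA subrK.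
have WT n : vanish_out T (W_ n) by exact: (cells_vanish _ (g n)).
have meas n : measurable_fun HL ((fun s => tnorm (W_ n s - W s)) : measurableTypeR R -> R).
  apply: (@measurable_fun_cvg _ _ _ _ (fun m s => tnorm (W_ n s - W_ m s))).
    move=> m; have [I [z []]] // := simple_dist fil ito (ltn0Sn 0) (sW n) (sW m).
  move=> s _; apply/subr_cvg0/norm_cvg0P.
  apply: (cvg0_le _ se0) => m; rewrite normr_ge0 /=.
  rewrite !tnormE (le_trans (hnorm_dist_dist _ _))//.
  have -> : (W_ n s - W_ m s) - (W_ n s - W s) = - (W_ m s - W s) :> tensorH A.
    by rewrite opprB addrC addrA subrK opprB.
  rewrite hnorm_opp -tnormE (le_trans (samp m s).1)//; exact: cells_le.
split=> //.
- apply: (squeeze_cvge _ (cvg_cst 0%E)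
    (h := fun n => ((C * Num.sqrt (e n)) ^+ 2 * T)%:E)); last first.
    apply: cvg_EFin; first exact: nearW.
    rewrite -[X in _ --> X](mul0r T); apply: cvgMr_tmp.
    by rewrite -[X in _ --> X](mul0r 0); exact: (cvgM se0 se0).
  apply: nearW => n; apply/andP; split.
    by apply: integral_ge0 => s _; rewrite lee_fin sqr_ge0.
  have -> : (C * Num.sqrt (e n)) ^+ 2 * T = \sum_(l < K n)
      (t n l.+1 - t n l) * (C * Num.sqrt (e n)) ^+ 2.
    rewrite -mulr_suml -(big_mkord xpredT (fun l => t n l.+1 - t n l)).
    by rewrite telescope_sumr// (grid0 (g n)) (gridT (g n)) subr0 mulrC.
  rewrite -(step_integral_ereal (K n) (fun=> (C * Num.sqrt (e n)) ^+ 2) (t0 n) (tm n)).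
  apply: ge0_le_integral => //.
  + by move=> s _; rewrite lee_fin sqr_ge0.
  + by apply/measurable_EFinP; exact: (measurable_funX 2 (meas n)).
  + by apply/measurable_EFinP; exact: (step_measurable _ _ (t0 n) (tm n)).
  move=> s _; rewrite lee_fin.
  rewrite -(@cells_map _ _ _ (t n) (K n) _ (fun b : R => b ^+ 2)) ?expr0n//.
  have [h _] := samp n s; rewrite ler_pXn2r ?nnegrE ?sqrtr_ge0//.
  by rewrite (le_trans _ h)// sqrtr_ge0.
have ex n : exists z, is_hintegral (fun s => toL2 L2 (tmul (W_ n s - W s))) z.
  have hz m := simple_dist fil ito (ltn0Sn 0) (sW n) (sW m).
  have [I hI] := choice hz; have [z {}hz] := choice hI.
  apply: (@hintegral_uniform_limit _ _ T _
    (fun m s => toL2 L2 (tmul (W_ n s - W_ m s))) z _ T0 _ _ _ _ se0).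
  - by move=> s sT; rewrite (WT n)// (holder_vanish hW)// subrr tmul0 linear0.
  - by move=> m s sT; rewrite (WT n)// (WT m)// subrr tmul0 linear0.
  - by move=> m; have [] := hz m.
  move=> m s; rewrite -linearB -tmulB.
  have -> : (W_ n s - W_ m s) - (W_ n s - W s) = - (W_ m s - W s) :> tensor A A.
    by rewrite opprB addrC addrA subrK opprB.
  rewrite tmulN linearN hnorm_opp; exact: (samp m s).2.
have [z hz] := choice ex; exists z; split=> //.
apply: (cvg0_le (g := fun n => T * (C * Num.sqrt (e n)))) => [n|]; last first.
  by rewrite -[X in _ --> X](mulr0 T); exact: cvgMl_tmp.
rewrite hnorm_ge0 /=; apply: (hintegral_norm T0 (Ce0 n) (hz n)).
  by move=> s sT; rewrite (WT n)// (holder_vanish hW)// subrr tmul0 linear0.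
by move=> s; exact: (samp n s).2.
Qed.

Lemma holder_integral (t : nat -> nat -> R) (K : nat -> nat) (e : nat -> R)
    T C P W k : (0 < k)%N -> 0 <= T -> 0 <= C ->
  (forall n, is_grid (t n) (K n) T P) ->
  (forall n l, t n l.+1 - t n l <= e n) -> e n @[n --> \oo] --> (0 : R) ->
  adapted At W -> piecewise_holder T C P W ->
  exists2 Y, is_integral At (D k) W Y &
    hcvg (fun n => toL2 L2 (\sum_(l < K n)
      tact (W (t n l)) (D k (t n l.+1) - D k (t n l)))) Y.
Proof.
move=> k0 T0 C0 g te e0 aW hW.
have ap := holder_approximates T0 C0 g te e0 aW hW.
have [Y hY] := approximates_cauchy k0 ap; exists Y.
  exact: (is_integral_of_limit fil ito k0 aW ap).
move: hY; congr hcvg; apply/funext => n; congr (toL2 L2 _).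
have [|_ ->//] := @simple_value_cells R A At (t n) (K n) (fun l => W (t n l))
  (grid_ge0 0 (g n)) (grid_mono (g n)).
by move=> l _; apply/tadapted_ord; apply: aW; exact: grid_ge0 (g n).
Qed.

End HolderBiprocesses.

(** * The diagonal term *)

Section DiagonalTerm.
Context (R : realType) (A : tracialVN R) (L2 : L2_space A) (At : R -> set A).
Context (D : nat -> R -> A) (c : nat -> R).
Hypothesis fil : filtration At.
Hypothesis ito : ito_family L2 At D c.
Local Notation n2 a := (hnorm (toL2 L2 a)).
Local Notation incr k s t := (D k t - D k s).
Implicit Types (U V : biprocess A).

(** Up to the factors [S] and [T'], the defect [w] is the remainder in the product
    rule for [a = T * S'], which has norm O(h).  In its scalar product with a
    past element the terms of order h cancel by the covariance formula, and
    c_i c_j h^2 is left. *)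
Lemma diagonal_cell (S T S' T' : A) i j (H : R) : (0 < i)%N -> (0 < j)%N -> 0 <= H ->
  exists2 C, 0 <= C & forall s t, 0 <= s -> s <= t -> t - s <= H ->
    At s S -> At s T -> At s S' -> At s T' ->
    let w := S * incr i s t * T * (S' * incr j s t * T') -
             phi (T * S') *: (S * incr (i + j)%N s t * T') in
    (forall u, At s u -> cabs (phi (star u * w)) <= C * (t - s) ^+ 2 * n2 u) /\
    n2 w <= C * (t - s).
Proof.
move=> i0 j0 H0; have [C1 C10 hC1] := ito_product ito (T * S') i0 j0 H0.
have [M M0 hM] := mul_bounded L2 S T'.
pose C2 := `|c i * c j| * n2 (S * T * S' * T').
have C20 : 0 <= C2 by rewrite mulr_ge0 ?normr_ge0 ?hnorm_ge0.
have MC0 : 0 <= M * C1 by exact: mulr_ge0.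
exists (M * C1 + C2); first exact: addr_ge0.
move=> s t s0 st stH AS AT AS' AT'.
have gen (x y z : A) (b : R[i]) : S * x * T * (S' * y * T') - b *: (S * z * T') =
    S * (x * (T * S') * y - b *: z) * T'.
  by rewrite mulrBr mulrBl -scalerAr -scalerAl !mulrA.
set d1 := incr i s t; set d2 := incr j s t; set d3 := incr (i + j)%N s t => w.
have sB := filtration_sub fil s0.
have ts0 : 0 <= t - s by rewrite subr_ge0.
set Rm := d1 * (T * S') * d2 - phi (T * S') *: d3.
have wE : w = S * Rm * T'.
  exact: gen.
split=> [u Au|]; last first.
  have h1 : M * n2 Rm <= M * C1 * (t - s).
    by rewrite -mulrA ler_wpM2l//; apply: hC1 => //; exact: (subalgM sB).
  have h2 : 0 <= C2 * (t - s) by exact: mulr_ge0.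
  rewrite wE mulrDl; apply: (le_trans (hM _)); apply: (le_trans h1).
  by rewrite lerDl.
have -> : phi (star u * w) =
    (c i * (t - s) * (c j * (t - s)))%:C * phi (star u * (S * T * S' * T')).
  have -> : phi (star u * w) = phi (T' * star u * S * Rm).
    by rewrite wE !mulrA phi_trace !mulrA.
  have Av : At s (T' * star u * S).
    by do 2!apply: (subalgM sB) => //; exact: (subalg_star sB).
  have -> : phi (T' * star u * S * Rm) = phi (T' * star u * S * d1 * (T * S') * d2) -
      phi (T * S') * phi (T' * star u * S * d3).
    by rewrite /Rm mulrBr linearB /= -[in X in _ - X]scalerAr linearZ /= !mulrA.
  rewrite (ito_covariance ito i0 j0 s0 st)//; last exact: (subalgM sB).
  rewrite (ito_mean ito _ s0 st)//; last by rewrite addn_gt0 i0.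
  rewrite [phi (T * S') * _]mulrC -[X in _ - X]mulrA addrK; congr (_ * _).
  by rewrite -!mulrA phi_trace !mulrA.
rewrite cabsM cabs_real.
have -> : `|c i * (t - s) * (c j * (t - s))| = `|c i * c j| * (t - s) ^+ 2.
  have -> : c i * (t - s) * (c j * (t - s)) = (c i * c j) * (t - s) ^+ 2 by ring.
  by rewrite normrM (ger0_norm (sqr_ge0 _)).
rewrite mulrDl mulrDl -[leLHS]add0r lerD//.
  by rewrite !mulr_ge0 ?hnorm_ge0 ?sqr_ge0.
have -> : C2 * (t - s) ^+ 2 * n2 u =
    `|c i * c j| * (t - s) ^+ 2 * (n2 u * n2 (S * T * S' * T')) by rewrite /C2; ring.
rewrite ler_wpM2l ?mulr_ge0 ?normr_ge0 ?sqr_ge0//.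
by rewrite (le_trans (phi_le L2 _ _))// n2_star.
Qed.

Lemma tadapted_tens2 B (x y : tensor A A) : star_subalg B -> tadapted B x ->
  tadapted B y -> tadapted B (tens2 x y).
Proof.
move=> sB [q qB ->] [q' qB' ->]; rewrite tens2_suml big_seq.
apply: tadapted_sum => p /qB[h1 h2]; rewrite tens2_sumr big_seq.
apply: tadapted_sum => p' /qB'[h1' h2']; rewrite tens2_tens.
by apply: (tadaptedZ _ sB); exact: tadapted_tens.
Qed.

Definition cell_defect i j s t (x y : tensor A A) : A :=
  tact x (incr i s t) * tact y (incr j s t) - tact (tens2 x y) (incr (i + j)%N s t).

Lemma cell_defect0l i j s t y : cell_defect i j s t 0 y = 0.
Proof. by rewrite /cell_defect tens20l !tact0l mul0r subr0. Qed.

Lemma cell_defect0r i j s t x : cell_defect i j s t x 0 = 0.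
Proof. by rewrite /cell_defect tens20r !tact0l mulr0 subr0. Qed.

Lemma cell_defect_sum i j s t (I I' : Type) (q : seq I) (q' : seq I') F G :
  cell_defect i j s t (\sum_(k <- q) F k) (\sum_(k <- q') G k) =
  \sum_(k <- q) \sum_(k' <- q') cell_defect i j s t (F k) (G k').
Proof.
rewrite /cell_defect tens2_suml !tact_suml mulr_suml -sumrB; apply: eq_bigr => k _.
by rewrite tens2_sumr tact_suml mulr_sumr -sumrB.
Qed.

Lemma cell_defect_adapted i j s t x y : (0 < i)%N -> (0 < j)%N -> 0 <= s -> s <= t ->
  tadapted (At s) x -> tadapted (At s) y -> At t (cell_defect i j s t x y).
Proof.
move=> i0 j0 s0 st Ax Ay; have sB := filtration_sub fil (le_trans s0 st).
have up z : tadapted (At s) z -> tadapted (At t) z.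
  by apply: tadapted_incl => a; exact: (filtration_le fil s0 st).
have dA k : (0 < k)%N -> At t (incr k s t) by move=> k0; exact: (ito_adapted ito).
apply: (subalgB sB); first by apply: (subalgM sB); apply: (tact_adapted sB); auto.
apply: (tact_adapted sB); first by apply: (tadapted_tens2 sB); auto.
by apply: dA; rewrite addn_gt0 i0.
Qed.

(** With h the mesh, the almost orthogonal defects, of norms O(h_l), add up to at
    most O(sum h_l^2) + sqrt (O(sum h_l^2)), where sum h_l^2 <= h T. *)
Lemma elementary_defect (t : nat -> nat -> R) (K : nat -> nat) (h : nat -> R) T P
    (e e' : elementary A) i j : (0 < i)%N -> (0 < j)%N ->
  (forall n, is_grid (t n) (K n) T P) ->
  (forall n l, t n l.+1 - t n l <= h n) -> (forall n, h n <= 1) ->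
  h n @[n --> \oo] --> (0 : R) -> el_adapted At e -> el_adapted At e' ->
  hcvg (fun n => toL2 L2 (\sum_(l < K n) cell_defect i j (t n l) (t n l.+1)
    (el_biprocess e (t n l)) (el_biprocess e' (t n l)))) 0.
Proof.
move=> i0 j0 g th h1 h0 [a0 ab AS AT] [a0' ab' AS' AT'].
have [C C0 hC] := diagonal_cell (el_S e) (el_T e) (el_S e') (el_T e') i0 j0 ler01.
have t0 n l : 0 <= t n l := grid_ge0 l (g n).
have tm n := grid_mono (g n).
have tS n l : t n l <= t n l.+1 := gridS l (g n).
have T0 : 0 <= T by rewrite -(gridT (g 0%N)).
have hge0 n : 0 <= h n by rewrite (le_trans _ (th n 0%N))// subr_ge0.
have dl_ge0 n l : 0 <= t n l.+1 - t n l by rewrite subr_ge0.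
have sqr_dl n l : (t n l.+1 - t n l) ^+ 2 <= h n * (t n l.+1 - t n l).
  by rewrite expr2 ler_wpM2r.
have sum_dl n : \sum_(l < K n) (t n l.+1 - t n l) = T.
  rewrite -(big_mkord xpredT (fun l => t n l.+1 - t n l)).
  by rewrite telescope_sumr// (grid0 (g n)) (gridT (g n)) subr0.
pose w n l := cell_defect i j (t n l) (t n l.+1)
  (el_biprocess e (t n l)) (el_biprocess e' (t n l)).
have wP n l : [/\ At (t n l.+1) (w n l),
    forall u, At (t n l) u ->
      cabs (phi (star u * w n l)) <= C * (t n l.+1 - t n l) ^+ 2 * n2 u &
    n2 (w n l) <= C * (t n l.+1 - t n l)].
  (* Outside of the two intervals the defect is 0. *)
  have trivial0 : w n l = 0 -> [/\ At (t n l.+1) (w n l),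
      forall u, At (t n l) u ->
        cabs (phi (star u * w n l)) <= C * (t n l.+1 - t n l) ^+ 2 * n2 u &
      n2 (w n l) <= C * (t n l.+1 - t n l)].
    move=> ->; split.
    - exact: (subalg0 (filtration_sub fil (t0 n l.+1))).
    - move=> u _; rewrite mulr0 linear0 cabs0.
      by apply: mulr_ge0; [apply: mulr_ge0 => //; exact: sqr_ge0|exact: hnorm_ge0].
    - by rewrite linear0 hnorm0 mulr_ge0.
  rewrite /w /el_biprocess in trivial0 *.
  case: ifP trivial0 => [/andP[e1 _]|_ triv]; last by apply: triv; rewrite cell_defect0l.
  case: ifP => [/andP[e1' _] _|_ triv]; last by apply: triv; rewrite cell_defect0r.
  have up s a : 0 <= s -> s <= t n l -> At s a -> At (t n l) a.
    by move=> s0 st; exact: (filtration_le fil s0 st).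
  have AS1 := up _ _ a0 e1 AS; have AT1 := up _ _ a0 e1 AT.
  have AS1' := up _ _ a0' e1' AS'; have AT1' := up _ _ a0' e1' AT'.
  have := hC _ _ (t0 n l) (tS n l) (le_trans (th n l) (h1 n)) AS1 AT1 AS1' AT1'.
  have wE : cell_defect i j (t n l) (t n l.+1) (tens (el_S e) (el_T e))
      (tens (el_S e') (el_T e')) =
    el_S e * incr i (t n l) (t n l.+1) * el_T e *
      (el_S e' * incr j (t n l) (t n l.+1) * el_T e') -
    phi (el_T e * el_S e') *: (el_S e * incr (i + j)%N (t n l) (t n l.+1) * el_T e').
    by rewrite /cell_defect tens2_tens tactZl !tact_tens.
  move=> /= [q1 q2]; split; last 2 first.
  - by move=> u Au; rewrite wE; exact: q1.
  - by rewrite wE.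
  by apply: cell_defect_adapted => //; exact: tadapted_tens.
have bound n : n2 (\sum_(l < K n) w n l) <=
    2 * (C * T) * h n + Num.sqrt (C ^+ 2 * T * h n).
  apply: (le_trans (@almost_orthogonal_sum _ _ L2 _ fil (t n) (w n)
    (fun l => C * (t n l.+1 - t n l) ^+ 2)
    (fun l => (C * (t n l.+1 - t n l)) ^+ 2) (K n) (t0 n 0%N) (tm n) _ _ _ _)).
  - by move=> q _; have [] := wP n q.
  - by move=> q u _ Au; have [_ h2 _] := wP n q; exact: h2.
  - move=> q _; have [_ _ h3] := wP n q.
    by rewrite ler_pXn2r ?nnegrE ?hnorm_ge0// mulr_ge0.
  - by move=> q _; rewrite mulr_ge0 ?sqr_ge0.
  have le1 : \sum_(l < K n) (t n l.+1 - t n l) ^+ 2 <= h n * T.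
    by rewrite -(sum_dl n) mulr_sumr; apply: ler_sum => l _.
  apply: lerD.
    by rewrite -mulr_sumr -!mulrA ler_wpM2l// ler_wpM2l// [leRHS]mulrC.
  rewrite ler_wsqrtr//; under eq_bigr do rewrite exprMn.
  by rewrite -mulr_sumr -[leRHS]mulrA ler_wpM2l ?sqr_ge0// [leRHS]mulrC.
rewrite /hcvg; apply: (cvg0_le (g := fun n =>
  2 * (C * T) * h n + Num.sqrt (C ^+ 2 * T * h n))).
  by move=> n; rewrite subr0 hnorm_ge0 /=; exact: bound.
rewrite -[X in _ --> X]addr0; apply: cvgD.
  by rewrite -[X in _ --> X](mulr0 (2 * (C * T))); exact: cvgMl_tmp.
rewrite -[X in _ --> X]sqrtr0; apply: continuous_cvg; first exact: sqrt_continuous.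
by rewrite -[X in _ --> X](mulr0 (C ^+ 2 * T)); exact: cvgMl_tmp.
Qed.

Lemma simple_defect (t : nat -> nat -> R) (K : nat -> nat) (h : nat -> R) T P
    V U i j : (0 < i)%N -> (0 < j)%N ->
  (forall n, is_grid (t n) (K n) T P) ->
  (forall n l, t n l.+1 - t n l <= h n) -> (forall n, h n <= 1) ->
  h n @[n --> \oo] --> (0 : R) -> simple_adapted At V -> simple_adapted At U ->
  hcvg (fun n => toL2 L2 (\sum_(l < K n) cell_defect i j (t n l) (t n l.+1)
    (V (t n l)) (U (t n l)))) 0.
Proof.
move=> i0 j0 g th h1 h0 [m [e [eA ->]]] [m' [e' [eA' ->]]].
have lim k k' := elementary_defect i0 j0 g th h1 h0 (eA k) (eA' k').
have lim1 k := @hcvg_sum _ _ _ (index_enum 'I_m') _ _ (fun k' _ => lim k k').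
have := @hcvg_sum _ _ _ (index_enum 'I_m) _ _ (fun k _ => lim1 k).
under eq_bigr do rewrite big1//; rewrite big1//.
congr hcvg; apply/funext => n.
under [in RHS]eq_bigr do rewrite cell_defect_sum.
rewrite [in RHS]exchange_big [RHS]linear_sum; apply: eq_bigr => k _ /=.
by rewrite [in RHS]exchange_big [RHS]linear_sum.
Qed.

End DiagonalTerm.

(** * Integral processes *)

Section Primitives.
Context (R : realType) (A : tracialVN R) (L2 : L2_space A) (At : R -> set A).
Context (D : nat -> R -> A) (c : nat -> R).
Hypothesis fil : filtration At.
Hypothesis ito : ito_family L2 At D c.
Local Notation n2 a := (hnorm (toL2 L2 a)).
Local Notation incr k s t := (D k t - D k s).
Implicit Types (U V : biprocess A).

Lemma tnorm_tens (a b : A) : tnorm (tens a b) = n2 a * n2 b.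
Proof.
apply/eqP; rewrite -(@eqrXn2 _ 2)// ?tnormE ?mulr_ge0 ?hnorm_ge0//.
apply/eqP; apply: (@complexI R); rewrite -[hnorm _]tnormE tnorm_sqr tdot_tens.
by rewrite exprMn rmorphM /= !n2_sqr [phi (b * _)]phi_trace.
Qed.

(* A simple biprocess takes finitely many values. *)
Let uniform_bound (f : tensor A A -> A -> R) :
  (forall x, exists2 M : R, 0 <= M & forall d, f x d <= M * n2 d) ->
  forall U, simple_adapted At U ->
  exists2 M : R, 0 <= M & forall s d, f (U s) d <= M * n2 d.
Proof.
move=> fP U /simple_on_grid[P [P0 _ hP]].
have fP' x : exists M : R, 0 <= M /\ forall d, f x d <= M * n2 d.
  by have [M M0 hM] := fP x; exists M.
have [M hM] := choice fP'.
have [K [t [T [g _]]]] := grid_of_points P0 ltr01.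
have tm := grid_mono g.
have M0 x : 0 <= M x by have [] := hM x.
have S0 : 0 <= \sum_(l < K) M (U (t l)) by exact: sumr_ge0.
exists (M 0 + \sum_(l < K) M (U (t l))); first exact: addr_ge0.
move=> s d; have [_ h0] := hM 0.
have -> : U s = cells t K (fun l => U (t l)) s by rewrite {1}(hP t K T g).1.
have [[l lK sl]|out] := cells_cases t K s.
  rewrite (cells_in _ tm lK sl) (le_trans ((hM _).2 d))//.
  have le : M (U (t l)) <= \sum_(l < K) M (U (t l)).
    by rewrite (bigD1 (Ordinal lK))//= lerDl sumr_ge0.
  by rewrite ler_wpM2r ?hnorm_ge0// (le_trans le)// lerDr.
rewrite cells_out// (le_trans (h0 d))// ler_wpM2r ?hnorm_ge0//.
by rewrite lerDl.
Qed.

Let sum_bound (I : Type) (s : seq I) (f : I -> A -> R) :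
  (forall i, exists2 M : R, 0 <= M & forall d, f i d <= M * n2 d) ->
  exists2 M : R, 0 <= M & forall d, \sum_(i <- s) f i d <= M * n2 d.
Proof.
move=> fP; elim: s => [|i s [M M0 hM]].
  by exists 0 => // d; rewrite big_nil mul0r.
have [M' M'0 hM'] := fP i; exists (M' + M); first exact: addr_ge0.
by move=> d; rewrite big_cons mulrDl lerD.
Qed.

Lemma tact_bounded U : simple_adapted At U ->
  exists2 M : R, 0 <= M & forall s d, n2 (tact (U s) d) <= M * n2 d.
Proof.
apply: (uniform_bound (f := fun x d => n2 (tact x d))) => x.
have [M M0 hM] := @sum_bound _ (tsum x) (fun p d => n2 (p.1 * d * p.2))
  (fun p => mul_bounded L2 p.1 p.2).
exists M => // d; apply: le_trans (hM d).
by rewrite tact_expand linear_sum; exact: hnorm_sum.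
Qed.

Lemma sharpl_bounded U : simple_adapted At U ->
  exists2 M : R, 0 <= M & forall s d, tnorm (sharp (tens d 1) (U s)) <= M * n2 d.
Proof.
apply: (uniform_bound (f := fun x d => tnorm (sharp (tens d 1) x))) => x.
have b1 (p : A * A) : exists2 M : R, 0 <= M &
    forall d, n2 p.2 * n2 (1 * d * p.1) <= M * n2 d.
  have [M M0 hM] := mul_bounded L2 1 p.1; exists (n2 p.2 * M).
    by rewrite mulr_ge0 ?hnorm_ge0.
  by move=> d; rewrite -[leRHS]mulrA ler_wpM2l ?hnorm_ge0.
have [M M0 hM] := sum_bound (tsum x) b1.
exists M => // d; apply: le_trans (hM d).
rewrite sharp_expandl tnormE; apply: (le_trans (hnorm_sum _ _ _)).
by apply: ler_sum => p _; rewrite -tnormE tnorm_tens mul1r mulrC.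
Qed.

Lemma sharpr_bounded U : simple_adapted At U ->
  exists2 M : R, 0 <= M & forall s d, tnorm (sharp (tens 1 d) (U s)) <= M * n2 d.
Proof.
apply: (uniform_bound (f := fun x d => tnorm (sharp (tens 1 d) x))) => x.
have b1 (p : A * A) : exists2 M : R, 0 <= M &
    forall d, n2 p.1 * n2 (p.2 * d * 1) <= M * n2 d.
  have [M M0 hM] := mul_bounded L2 p.2 1; exists (n2 p.1 * M).
    by rewrite mulr_ge0 ?hnorm_ge0.
  by move=> d; rewrite -[leRHS]mulrA ler_wpM2l ?hnorm_ge0.
have [M M0 hM] := sum_bound (tsum x) b1.
exists M => // d; apply: le_trans (hM d).
rewrite sharp_expandr tnormE; apply: (le_trans (hnorm_sum _ _ _)).
by apply: ler_sum => p _; rewrite -tnormE tnorm_tens mulr1.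
Qed.

Lemma tmul_sharpl_bounded U : simple_adapted At U ->
  exists2 M : R, 0 <= M & forall s d, n2 (tmul (sharp (tens d 1) (U s))) <= M * n2 d.
Proof.
apply: (uniform_bound (f := fun x d => n2 (tmul (sharp (tens d 1) x)))) => x; have [M M0 hM] := mul_bounded L2 1 (tact x 1).
by exists M => // d; have := hM d; rewrite tmulE tact_sharpl mul1r.
Qed.

Lemma tmul_sharpr_bounded U : simple_adapted At U ->
  exists2 M : R, 0 <= M & forall s d, n2 (tmul (sharp (tens 1 d) (U s))) <= M * n2 d.
Proof.
apply: (uniform_bound (f := fun x d => n2 (tmul (sharp (tens 1 d) x)))) => x; have [M M0 hM] := mul_bounded L2 (tact x 1) 1.
by exists M => // d; have := hM d; rewrite tmulE tact_sharpr mulr1.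
Qed.

Lemma sharplB (a b : A) x : sharp (tens a 1) x - sharp (tens b 1) x =
  sharp (tens (a - b) 1) x.
Proof.
rewrite !sharp_expandl -sumrB; apply: eq_bigr => p _.
by rewrite -[tens (b * _) _]scale1r -scaleNr -tensZl -tensDl scaleN1r -mulrBl.
Qed.

Lemma sharprB (a b : A) x : sharp (tens 1 a) x - sharp (tens 1 b) x =
  sharp (tens 1 (a - b)) x.
Proof.
rewrite !sharp_expandr -sumrB; apply: eq_bigr => p _.
by rewrite -[tens _ (_ * b)]scale1r -scaleNr -tensZr -tensDr scaleN1r -mulrBr.
Qed.

(** The squared norm of an increment of length h is c_2k h + c_k^2 h^2. *)
Lemma incr_holder k T : (0 < k)%N -> 0 <= T -> exists2 M : R, 0 <= M &
  forall s t, 0 <= s -> s <= t -> t <= T -> n2 (incr k s t) <= M * Num.sqrt (t - s).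
Proof.
move=> k0 T0; pose M := `|c (k + k)%N| + c k * c k * T.
have ck0 : 0 <= c k * c k by rewrite -expr2 sqr_ge0.
have M0 : 0 <= M by apply: addr_ge0; [exact: normr_ge0|exact: mulr_ge0].
exists (Num.sqrt M); first exact: sqrtr_ge0.
move=> s t s0 st tT; have sB := filtration_sub fil s0.
rewrite -sqrtrM// -[leLHS]ger0_norm ?hnorm_ge0// -sqrtr_sqr ler_wsqrtr//.
have -> : n2 (incr k s t) ^+ 2 =
    c k * (t - s) * (c k * (t - s)) + c (k + k)%N * (t - s).
  apply: (@complexI R); rewrite n2_sqr (ito_star ito k0 s0 st).
  have := ito_covariance ito k0 k0 s0 st (subalg1 sB) (subalg1 sB).
  by rewrite !(mul1r, mulr1) phi1 !mulr1 -rmorphD.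
have ts0 : 0 <= t - s by rewrite subr_ge0.
have tsT : t - s <= T by rewrite lerBlDr (le_trans tT)// lerDl.
rewrite /M mulrDl addrC lerD//; first by rewrite ler_wpM2r// ler_norm.
have -> : c k * (t - s) * (c k * (t - s)) = c k * c k * (t - s) * (t - s) by ring.
by rewrite ler_wpM2r// ler_wpM2l.
Qed.

Definition primitive k U t : A := simple_integral At (D k) (restrict_to 0 t U).

Lemma primitive_grid U P : (forall x, x \in P -> 0 <= x) ->
  (forall (t : nat -> R) K T, is_grid t K T P -> U = cells t K (fun l => U (t l))) ->
  simple_adapted At U -> forall (t : nat -> R) K T l, is_grid t K T P -> (l <= K)%N ->
  simple_adapted At (restrict_to 0 (t l) U) /\
  forall k, primitive k U (t l) = \sum_(q < l) tact (U (t q)) (incr k (t q) (t q.+1)).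
Proof.
move=> P0 hP sU t K T l g lK; have tm := grid_mono g.
have E : restrict_to 0 (t l) U = cells t l (fun q => U (t q)).
  apply/funext => s; rewrite /restrict_to; case: ifP => [sl|nsl].
    have [|q ql sq] := @in_some_cell R t l s; first by rewrite (grid0 g).
    have -> : U s = cells t K (fun q => U (t q)) s by rewrite {1}(hP t K T g).
    by rewrite (cells_in _ tm ql sq) (cells_in _ tm (leq_trans ql lK) sq).
  rewrite cells_out// => q ql; apply: contraFN nsl => /andP[h1 h2].
  by rewrite (le_trans (grid_ge0 q g) h1) (lt_le_trans h2)// tm.
have [q _|h1 h2] := @simple_value_cells R A At t l (fun q => U (t q)) (grid_ge0 0 g) tm.
  by apply: (simple_tadapted fil) => //; exact: grid_ge0 g.
by rewrite /primitive E; split=> // k; rewrite h2.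
Qed.

Lemma primitive_adapted k U s : (0 < k)%N -> simple_adapted At U -> 0 <= s ->
  simple_adapted At (restrict_to 0 s U) /\ At s (primitive k U s).
Proof.
move=> k0 sU s0; have [P [P0 _ hP]] := simple_on_grid sU.
have [|K [t [T [g _]]]] := @grid_of_points R (s :: P) 1 _ ltr01.
  by move=> x; rewrite inE => /orP[/eqP ->|/P0].
have g' : is_grid t K T P by apply: is_grid_sub g => x xP; rewrite inE xP orbT.
have [l lK tl] := grid_mem g (mem_head _ _).
have hP' t' K' T' (g0 : is_grid t' K' T' P) := (hP t' K' T' g0).1.
have [h1 h2] := primitive_grid P0 hP' sU g' lK.
rewrite -tl; split=> //; rewrite h2; have sB := filtration_sub fil (grid_ge0 l g).
apply: (subalg_sum sB) => q _; have ql := ltn_ord q.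
have up r a : (r <= l)%N -> At (t r) a -> At (t l) a.
  by move=> rl; apply: (filtration_le fil); [exact: grid_ge0 g|exact: (grid_mono g)].
apply: (tact_adapted sB).
  apply: (@tadapted_incl _ _ (At (t q))) => [a|]; first exact/up/ltnW.
  by apply: (simple_tadapted fil) => //; exact: grid_ge0 g.
apply: (up q.+1) => //; apply: (ito_adapted ito) => //; first exact: grid_ge0 g.
exact: gridS g.
Qed.

(** On an interval where [U] is constant the integral process moves by the action
    of this constant on the increment of the integrator. *)
Lemma primitive_step k U s s' : (0 < k)%N -> simple_adapted At U -> 0 <= s -> s <= s' ->
  (forall r, s <= r < s' -> U r = U s) ->
  primitive k U s' = primitive k U s + tact (U s) (incr k s s').
Proof.
move=> k0 sU s0 ss' cst; have [sr _] := primitive_adapted k0 sU s0.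
have v1 : simple_value At (restrict_to 0 s U)
    (fun D => simple_integral At D (restrict_to 0 s U)) by [].
have v2 := simple_value_tensor s0 ss' (simple_tadapted fil sU s0).
have [_ h] := simple_valueD v1 v2; rewrite /primitive -h; congr (simple_integral _ _ _).
apply/funext => r; rewrite /restrict_to.
have [r0|r0] := leP 0 r; last by rewrite leNgt (lt_le_trans r0 s0) /= add0r.
have [rs|rs] := ltP r s; first by rewrite (lt_le_trans rs ss') addr0.
by rewrite add0r; case: ifP => //= rs'; rewrite cst// rs rs'.
Qed.

End Primitives.

(** * The product formula *)

Section ProductFormula.
Context (R : realType) (A : tracialVN R) (L2 : L2_space A) (At : R -> set A).
Context (D : nat -> R -> A) (c : nat -> R).
Hypothesis fil : filtration At.
Hypothesis ito : ito_family L2 At D c.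
Local Notation n2 a := (hnorm (toL2 L2 a)).
Local Notation incr k s t := (D k t - D k s).
Implicit Types (U : biprocess A).

(** These properties of a simple biprocess survive an enlargement of [P], so that
    one list serves for all the given biprocesses. *)
Record breakpoints (P : seq R) U : Prop := Breakpoints {
  bp_constant : forall s s', s <= s' ->
    (forall x, x \in P -> ~~ (s < x <= s')) -> U s = U s';
  bp_cells : forall (t : nat -> R) K T, is_grid t K T P -> U = cells t K (fun l => U (t l));
  bp_integral : forall (t : nat -> R) K T D, is_grid t K T P ->
    simple_integral At D U = \sum_(l < K) tact (U (t l)) (D (t l.+1) - D (t l)) }.

Lemma breakpoints_sub P P' U : {subset P <= P'} -> breakpoints P U -> breakpoints P' U.
Proof.
move=> PP' [h1 h2 h3]; split.
- by move=> s s' ss' no; apply: h1 => // x /PP'; exact: no.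
- by move=> t K T /(is_grid_sub PP'); exact: h2.
- by move=> t K T E /(is_grid_sub PP'); exact: h3.
Qed.

Lemma common_breakpoints n (F : nat -> biprocess A) :
  (forall i, (1 <= i <= n)%N -> simple_adapted At (F i)) ->
  exists2 P : seq R, forall x, x \in P -> 0 <= x &
    forall i, (1 <= i <= n)%N -> breakpoints P (F i).
Proof.
move=> sF; have ex i : exists P : seq R, (forall x, x \in P -> 0 <= x) /\
    ((1 <= i <= n)%N -> breakpoints P (F i)).
  have [/sF/simple_on_grid[P [P0 h1 h2]]|] := boolP (1 <= i <= n)%N; last by exists [::].
  exists P; split=> // _; split=> // [t K T g|t K T E g]; have [h3 h4] := h2 t K T g.
    exact: h3.
  exact: h4.
have [P hP] := choice ex; exists (flatten [seq P i | i <- index_iota 1 n.+1]).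
  by move=> x /flatten_mapP[i _ xi]; exact: (hP i).1.
move=> i ir; apply: breakpoints_sub ((hP i).2 ir) => x xi.
by apply/flatten_mapP; exists i => //; rewrite mem_index_iota.
Qed.

Lemma breakpoints_vanish P U T : (forall x, x \in P -> 0 <= x <= T) -> 0 <= T ->
  breakpoints P U -> vanish_out T U.
Proof.
move=> PT T0 bU; have [K [t [g _]]] := grid_exists T0 PT ltr01.
by rewrite (bp_cells bU g); exact: (cells_vanish _ g).
Qed.

Definition holder_process (T C : R) (P : seq R) (n : R -> A) : Prop :=
  forall s s', 0 <= s -> s <= s' -> s' <= T ->
    (forall x, x \in P -> ~~ (s < x <= s')) -> n2 (n s - n s') <= C * Num.sqrt (s' - s).

Lemma primitive_holder k U P T : (0 < k)%N -> 0 <= T -> simple_adapted At U ->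
  breakpoints P U -> exists2 C, 0 <= C & holder_process T C P (primitive At D k U).
Proof.
move=> k0 T0 sU bU; have [M M0 hM] := tact_bounded L2 sU.
have [M' M'0 hM'] := incr_holder fil ito k0 T0.
exists (M * M'); first exact: mulr_ge0.
move=> s s' s0 ss' s'T no.
rewrite (primitive_step fil ito k0 sU s0 ss').
  rewrite opprD addNKr linearN hnorm_opp (le_trans (hM _ _))// -mulrA ler_wpM2l//.
  exact: hM'.
move=> r /andP[sr rs']; apply/esym/(bp_constant bU sr) => x /no.
by apply: contra => /andP[-> xr] /=; exact: le_trans xr (ltW rs').
Qed.

Lemma holder_process_sum T P (s : seq nat) (f : nat -> R -> A) :
  (forall i, i \in s -> exists2 C, 0 <= C & holder_process T C P (f i)) ->
  exists2 C, 0 <= C & holder_process T C P (fun t => \sum_(i <- s) f i t).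
Proof.
elim: s => [_|i s IH h].
  by exists 0 => // r r' *; rewrite !big_nil subrr linear0 hnorm0 mul0r.
have [C C0 hC] := h i (mem_head _ _).
have [|C' C'0 hC'] := IH; first by move=> j js; apply: h; rewrite inE js orbT.
exists (C + C'); first exact: addr_ge0.
move=> r r' r0 rr' r'T no; rewrite !big_cons opprD addrACA linearD mulrDl.
by rewrite (le_trans (hnorm_triangle _ _))// lerD; [|exact: hC|exact: hC'].
Qed.

(** The map [f] stands for multiplication by an element of [A] on one of the two
    legs.  Between breakpoints [U] is constant, and only the factor [n t]
    varies. *)
Lemma holder_leg (f : A -> tensor A A -> tensor A A) T C P (n : R -> A) U : 0 <= C ->
  (forall a b x, f a x - f b x = f (a - b) x) -> (forall a, f a 0 = 0) ->
  (exists2 M : R, 0 <= M & forall s d, tnorm (f d (U s)) <= M * n2 d) ->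
  (exists2 M : R, 0 <= M & forall s d, n2 (tmul (f d (U s))) <= M * n2 d) ->
  holder_process T C P n -> breakpoints P U -> vanish_out T U ->
  exists2 C', 0 <= C' & piecewise_holder L2 T C' P (fun t => f (n t) (U t)).
Proof.
move=> C0 fB f0 [M M0 hM] [M' M'0 hM'] hn bU U0.
exists (M * C + M' * C); first by rewrite addr_ge0 ?mulr_ge0.
have key s s' : 0 <= s -> s <= s' -> (forall x, x \in P -> ~~ (s < x <= s')) ->
    f (n s) (U s) - f (n s') (U s') = 0 \/
    (f (n s) (U s) - f (n s') (U s') = f (n s - n s') (U s) /\
      n2 (n s - n s') <= C * Num.sqrt (s' - s)).
  move=> s0 ss' no; have cst := bp_constant bU ss' no.
  have [s'T|Ts'] := leP s' T; first by right; rewrite -cst fB; split=> //; exact: hn.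
  by left; rewrite cst U0 ?f0 ?subrr// negb_and -leNgt (ltW Ts') orbT.
split=> [s sT|s s' s0 ss' no|s s' s0 ss' no]; first by rewrite U0.
  have [->|[-> h]] := key s s' s0 ss' no.
    by rewrite tnorm0 mulr_ge0 ?sqrtr_ge0// addr_ge0 ?mulr_ge0.
  rewrite (le_trans (hM _ _))// mulrDl -!mulrA (le_trans (ler_wpM2l M0 h))// lerDl.
  by rewrite !mulr_ge0 ?sqrtr_ge0.
have [->|[-> h]] := key s s' s0 ss' no.
  by rewrite tmul0 linear0 hnorm0 mulr_ge0 ?sqrtr_ge0// addr_ge0 ?mulr_ge0.
rewrite (le_trans (hM' _ _))// mulrDl -!mulrA (le_trans (ler_wpM2l M'0 h))// lerDr.
by rewrite !mulr_ge0 ?sqrtr_ge0.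
Qed.

Lemma tens2_simple P V U (t : nat -> R) K T : simple_adapted At V -> simple_adapted At U ->
  breakpoints P V -> breakpoints P U -> is_grid t K T P ->
  simple_value At (fun s => tens2 (V s) (U s))
    (fun E => \sum_(l < K) tact (tens2 (V (t l)) (U (t l))) (E (t l.+1) - E (t l))).
Proof.
move=> sV sU bV bU g; have tm := grid_mono g.
have -> : (fun s => tens2 (V s) (U s)) = cells t K (fun l => tens2 (V (t l)) (U (t l))).
  apply/funext => s.
  have -> : V s = cells t K (fun l => V (t l)) s by rewrite {1}(bp_cells bV g).
  have -> : U s = cells t K (fun l => U (t l)) s by rewrite {1}(bp_cells bU g).
  have [[l lK sl]|out] := cells_cases t K s; first by rewrite !(cells_in _ tm lK sl).
  by rewrite !cells_out// tens20l.
have tl l : 0 <= t l := grid_ge0 l g.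
apply: simple_value_cells => // l _; apply: (tadapted_tens2 (filtration_sub fil (tl l))).
  exact: (simple_tadapted fil).
exact: (simple_tadapted fil).
Qed.

Lemma discrete_product_rule (a b : nat -> A) n :
  (\sum_(l < n) a l) * (\sum_(l < n) b l) =
  \sum_(l < n) (\sum_(q < l) a q) * b l + \sum_(l < n) a l * (\sum_(q < l) b q) +
  \sum_(l < n) a l * b l.
Proof.
rewrite -[X in X * _]mulr1 product_of_sums -addrA addrC.
by congr (_ + _ + _); apply: eq_bigr => l _; rewrite mulr1.
Qed.

Lemma fine_grids (P : seq R) T : 0 <= T -> (forall x, x \in P -> 0 <= x <= T) ->
  exists (t : nat -> nat -> R) (K : nat -> nat),
  (forall n, is_grid (t n) (K n) T P) /\ forall n l, t n l.+1 - t n l <= n.+1%:R^-1.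
Proof.
move=> T0 PT; have ex n : exists tK : (nat -> R) * nat, is_grid tK.1 tK.2 T P /\
    forall l, tK.1 l.+1 - tK.1 l <= n.+1%:R^-1.
  have n0 : 0 < n.+1%:R^-1 :> R by rewrite invr_gt0 ltr0n.
  by have [K [t h]] := grid_exists T0 PT n0; exists (t, K).
have [tK h] := choice ex; exists (fun n => (tK n).1), (fun n => (tK n).2).
by split=> n; have [] := h n.
Qed.

(** On the n-th grid [discrete_product_rule] writes N M as the sum of the sampled
    integrals of [NU j] and [VM i], of the integrals of the simple biprocesses
    [VU i j], and of the defects; the conclusion is the limit of this identity. *)
Lemma ito_product_formula I J (V U : nat -> biprocess A) :
  (forall i, (1 <= i <= I)%N -> simple_adapted At (V i)) ->
  (forall j, (1 <= j <= J)%N -> simple_adapted At (U j)) ->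
  let Nt t := \sum_(1 <= i < I.+1) primitive At D i (V i) t in
  let Mt t := \sum_(1 <= j < J.+1) primitive At D j (U j) t in
  let N := \sum_(1 <= i < I.+1) simple_integral At (D i) (V i) in
  let M := \sum_(1 <= j < J.+1) simple_integral At (D j) (U j) in
  let NU j : biprocess A := fun t => sharp (tens (Nt t) (1 : A)) (U j t) in
  let VM i : biprocess A := fun t => sharp (tens (1 : A) (Mt t)) (V i t) in
  let VU i j : biprocess A := fun t => tens2 (V i t) (U j t) in
  [/\ forall j, (1 <= j <= J)%N -> integrable_biprocess L2 At (D j) (NU j),
      forall i, (1 <= i <= I)%N -> integrable_biprocess L2 At (D i) (VM i),
      forall i j, (1 <= i <= I)%N -> (1 <= j <= J)%N -> simple_adapted At (VU i j) &
      toL2 L2 (N * M) =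
        \sum_(1 <= j < J.+1) stochastic_integral L2 At (D j) (NU j) +
        \sum_(1 <= i < I.+1) stochastic_integral L2 At (D i) (VM i) +
        \sum_(1 <= i < I.+1) \sum_(1 <= j < J.+1)
          toL2 L2 (simple_integral At (D (i + j)%N) (VU i j))].
Proof.
move=> sV sU Nt Mt N M NU VM VU.
have [PV PV0 bV'] := common_breakpoints sV; have [PU PU0 bU'] := common_breakpoints sU.
pose P := PV ++ PU.
have bV i : (1 <= i <= I)%N -> breakpoints P (V i).
  by move=> /bV'; apply: breakpoints_sub => x xP; rewrite mem_cat xP.
have bU j : (1 <= j <= J)%N -> breakpoints P (U j).
  by move=> /bU'; apply: breakpoints_sub => x xP; rewrite mem_cat xP orbT.
have [T T0 PT'] := seq_upper_bound P.
have P0 x : x \in P -> 0 <= x by rewrite mem_cat => /orP[/PV0|/PU0].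
have PT x : x \in P -> 0 <= x <= T by move=> xP; rewrite P0//= PT'.
have [t [K [g mesh]]] := fine_grids T0 PT.
have mesh0 : n.+1%:R^-1 @[n --> \oo] --> (0 : R) by exact: cvg_harmonic.
have mesh1 n : n.+1%:R^-1 <= 1 :> R by rewrite invf_le1 ?ltr0n// ler1n.
have range F i n : (forall i, (1 <= i <= n)%N -> F i) -> i \in index_iota 1 n.+1 -> F i.
  by move=> h; rewrite mem_index_iota => /h.
have adapt n (F : nat -> biprocess A) s : (forall i, (1 <= i <= n)%N ->
    simple_adapted At (F i)) -> 0 <= s ->
    At s (\sum_(1 <= i < n.+1) primitive At D i (F i) s).
  move=> sF s0; rewrite big_nat; apply: (subalg_sum (filtration_sub fil s0)) => i ir.
  have /andP[i0 _] := ir.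
  by have [_] := primitive_adapted fil ito i0 (sF i ir) s0.
have holder n (F : nat -> biprocess A) :
    (forall i, (1 <= i <= n)%N -> simple_adapted At (F i)) ->
    (forall i, (1 <= i <= n)%N -> breakpoints P (F i)) ->
    exists2 C, 0 <= C & holder_process T C P
      (fun s => \sum_(1 <= i < n.+1) primitive At D i (F i) s).
  move=> sF bF; apply: holder_process_sum => i; rewrite mem_index_iota => ir.
  by have /andP[i0 _] := ir; exact: (primitive_holder i0 T0 (sF i ir) (bF i ir)).
have NUint j : (1 <= j <= J)%N -> exists2 Y, is_integral At (D j) (NU j) Y &
    hcvg (fun n => toL2 L2 (\sum_(l < K n)
      tact (NU j (t n l)) (incr j (t n l) (t n l.+1)))) Y.
  move=> jr; have /andP[j0 _] := jr; have [C C0 hN] := holder I V sV bV.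
  have [C' C'0 hNU] := holder_leg (f := fun a x => sharp (tens a 1) x) C0
    (fun a b x => sharplB a b x) (fun a => sharp0r _) (sharpl_bounded L2 (sU j jr))
    (tmul_sharpl_bounded L2 (sU j jr)) hN (bU j jr)
    (breakpoints_vanish PT T0 (bU j jr)).
  apply: (holder_integral fil ito j0 T0 C'0 g mesh mesh0 _ hNU) => s s0.
  apply/tadapted_ord/(tadapted_sharpl (filtration_sub fil s0)); first exact: adapt.
  exact: (simple_tadapted fil (sU j jr)).
have VMint i : (1 <= i <= I)%N -> exists2 Y, is_integral At (D i) (VM i) Y &
    hcvg (fun n => toL2 L2 (\sum_(l < K n)
      tact (VM i (t n l)) (incr i (t n l) (t n l.+1)))) Y.
  move=> ir; have /andP[i0 _] := ir; have [C C0 hM] := holder J U sU bU.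
  have [C' C'0 hVM] := holder_leg (f := fun a x => sharp (tens 1 a) x) C0
    (fun a b x => sharprB a b x) (fun a => sharp0r _) (sharpr_bounded L2 (sV i ir))
    (tmul_sharpr_bounded L2 (sV i ir)) hM (bV i ir)
    (breakpoints_vanish PT T0 (bV i ir)).
  apply: (holder_integral fil ito i0 T0 C'0 g mesh mesh0 _ hVM) => s s0.
  apply/tadapted_ord/(tadapted_sharpr (filtration_sub fil s0)); first exact: adapt.
  exact: (simple_tadapted fil (sV i ir)).
have VUval n i j ir jr :=
  tens2_simple (sV i ir) (sU j jr) (bV i ir) (bU j jr) (g n).
split.
- by move=> j /NUint[Y hY _]; exists Y.
- by move=> i /VMint[Y hY _]; exists Y.
- by move=> i j ir jr; have [] := VUval 0%N i j ir jr.
pose defect n i j : A := \sum_(l < K n) cell_defect D i j (t n l) (t n l.+1)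
  (V i (t n l)) (U j (t n l)).
have decomposition n : N * M =
    \sum_(1 <= j < J.+1) \sum_(l < K n) tact (NU j (t n l)) (incr j (t n l) (t n l.+1)) +
    \sum_(1 <= i < I.+1) \sum_(l < K n) tact (VM i (t n l)) (incr i (t n l) (t n l.+1)) +
    \sum_(1 <= i < I.+1) \sum_(1 <= j < J.+1)
      (defect n i j + simple_integral At (D (i + j)%N) (VU i j)).
  pose a l := \sum_(1 <= i < I.+1) tact (V i (t n l)) (incr i (t n l) (t n l.+1)).
  pose b l := \sum_(1 <= j < J.+1) tact (U j (t n l)) (incr j (t n l) (t n l.+1)).
  have NE : N = \sum_(l < K n) a l.
    rewrite /N /a exchange_big; apply: eq_big_nat => i ir.
    exact: (bp_integral (bV i ir) _ (g n)).
  have ME : M = \sum_(l < K n) b l.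
    rewrite /M /b exchange_big; apply: eq_big_nat => j jr.
    exact: (bp_integral (bU j jr) _ (g n)).
  have prim (F : nat -> biprocess A) m l : (l < K n)%N ->
      (forall i, (1 <= i <= m)%N -> simple_adapted At (F i)) ->
      (forall i, (1 <= i <= m)%N -> breakpoints P (F i)) ->
      \sum_(q < l) \sum_(1 <= i < m.+1) tact (F i (t n q)) (incr i (t n q) (t n q.+1)) =
      \sum_(1 <= i < m.+1) primitive At D i (F i) (t n l).
    move=> lK sF bF; rewrite exchange_big; apply: eq_big_nat => i ir.
    by have [_ ->] := primitive_grid D fil P0 (bp_cells (bF i ir)) (sF i ir) (g n) (ltnW lK).
  rewrite NE ME discrete_product_rule; congr (_ + _ + _).
  - rewrite [RHS]exchange_big; apply: eq_bigr => l _.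
    rewrite prim// mulr_sumr; apply: eq_bigr => j _.
    by rewrite tact_sharpl.
  - rewrite [RHS]exchange_big; apply: eq_bigr => l _.
    rewrite prim// mulr_suml; apply: eq_bigr => i _.
    by rewrite tact_sharpr.
  have -> : \sum_(l < K n) a l * b l = \sum_(1 <= i < I.+1) \sum_(1 <= j < J.+1)
      \sum_(l < K n) tact (V i (t n l)) (incr i (t n l) (t n l.+1)) *
        tact (U j (t n l)) (incr j (t n l) (t n l.+1)).
    under [RHS]eq_bigr do rewrite exchange_big; rewrite [RHS]exchange_big.
    apply: eq_bigr => l _; rewrite mulr_suml; apply: eq_bigr => i _.
    by rewrite mulr_sumr.
  apply: eq_big_nat => i ir.
  apply: eq_big_nat => j jr.
  have [_ ->] := VUval n i j ir jr; rewrite /defect -big_split; apply: eq_bigr => l _.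
  by rewrite /= subrK.
apply: (hcvg_unique (hcvg_cst (toL2 L2 (N * M)))).
under eq_fun => n do rewrite (decomposition n) !linearD !linear_sum /=.
apply: hcvgD; first apply: hcvgD.
- apply: hcvg_sum => j; rewrite mem_index_iota => jr.
  by have [Y hY lim] := NUint j jr; rewrite (stochastic_integralE hY).
- apply: hcvg_sum => i; rewrite mem_index_iota => ir.
  by have [Y hY lim] := VMint i ir; rewrite (stochastic_integralE hY).
apply: hcvg_sum => i; rewrite mem_index_iota => ir.
under eq_fun do rewrite linear_sum /=.
apply: hcvg_sum => j; rewrite mem_index_iota => jr.
under eq_fun do rewrite linearD /=.
have /andP[i0 _] := ir; have /andP[j0 _] := jr.
have := simple_defect fil ito i0 j0 g mesh mesh1 mesh0 (sV i ir) (sU j jr).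
move=> /hcvgD /(_ (hcvg_cst (toL2 L2 (simple_integral At (D (i + j)%N) (VU i j))))).
by rewrite add0r.
Qed.

End ProductFormula.

Theorem proposition2 (R : realType) (A : tracialVN R) (L2 : L2_space A)
    (At : R -> set A) (mu : probability (measurableTypeR R) R) (r : nat -> R)
    (mu_ : R -> probability (measurableTypeR R) R) (X : set R -> A)
    (Delta : nat -> set R -> A) (I J : nat) (V U : nat -> biprocess A) :
  filtration At ->
  compactly_supported mu ->
  freely_infinitely_divisible mu ->
  variance mu (fun x : measurableTypeR R => (x : R)) = 1%E ->
  free_cumulants mu r ->
  free_convolution_semigroup r mu_ ->
  free_stochastic_measure At mu_ X ->
  diagonal_measures X Delta ->
  (forall i, (1 <= i <= I)%N -> simple_adapted At (V i)) ->
  (forall j, (1 <= j <= J)%N -> simple_adapted At (U j)) ->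
  let D := diagonal_process Delta in
  let Nt t := \sum_(1 <= i < I.+1)
    simple_integral At (D i) (restrict_to 0 t (V i)) in
  let Mt t := \sum_(1 <= j < J.+1)
    simple_integral At (D j) (restrict_to 0 t (U j)) in
  let N := \sum_(1 <= i < I.+1) simple_integral At (D i) (V i) in
  let M := \sum_(1 <= j < J.+1) simple_integral At (D j) (U j) in
  let NU j : biprocess A := fun t => sharp (tens (Nt t) (1 : A)) (U j t) in
  let VM i : biprocess A := fun t => sharp (tens (1 : A) (Mt t)) (V i t) in
  let VU i j : biprocess A := fun t => tens2 (V i t) (U j t) in
  [/\ forall j, (1 <= j <= J)%N -> integrable_biprocess L2 At (D j) (NU j),
      forall i, (1 <= i <= I)%N -> integrable_biprocess L2 At (D i) (VM i),
      forall i j, (1 <= i <= I)%N -> (1 <= j <= J)%N ->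
        simple_adapted At (VU i j) &
      toL2 L2 (N * M) =
        \sum_(1 <= j < J.+1) stochastic_integral L2 At (D j) (NU j) +
        \sum_(1 <= i < I.+1) stochastic_integral L2 At (D i) (VM i) +
        \sum_(2 <= m < (I + J).+1)
          \sum_(1 <= i < I.+1) \sum_(1 <= j < J.+1 | (i + j == m)%N)
            toL2 L2 (simple_integral At (D m) (VU i j))].
Proof.
move=> fil _ _ _ _ semi fsm diag sV sU D Nt Mt N M NU VM VU.
have ito := diagonal_process_ito L2 fil semi fsm diag.
have [h1 h2 h3 h4] := ito_product_formula fil ito sV sU; split=> //.
rewrite h4; congr (_ + _); rewrite [RHS]exchange_big.
apply: eq_big_nat => i /andP[i0 iI].
under [RHS]eq_bigr do rewrite big_mkcond; rewrite [RHS]exchange_big.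
apply: eq_big_nat => j /andP[j0 jJ].
under eq_bigr do rewrite eq_sym.
rewrite -big_mkcond big_nat1_eq; case: ifP => // /negP[].
lia.
Qed.
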